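(* Let $J\subseteq I$, let $\nu\in\Lambda_J^\vee$ and let $W$ be a finite-dimensional irreducible $U_q^{\nu}(\mathfrak g_J)$-module. Then $W$ admits a $J$-inflation to $\mathfrak g$, i.e. there exist a coweight $\mu\in\Lambda^\vee$ with $\mathrm{res}_J(\mu)=\nu$ and an object $V$ of $\mathcal O^{\mu}$ such that $V$ is a $J$-inflation of $W$ to $\mathfrak g$ with coweight $\mu$.
   Context: Setup. Everything is over $\mathbb C$; $\mathbb N=\mathbb Z_{\ge 0}$. $\mathfrak g$ is a finite-dimensional simple Lie algebra with Dynkin index set $I=\{1,\dots,n\}$ and Cartan matrix $C=(C_{i,j})_{i,j\in I}$; $d_1,\dots,d_n$ are the relatively prime positive integers such that $(d_iC_{i,j})$ is symmetric. $\alpha_i,\omega_i,\omega_i^\vee$ are the simple roots, fundamental weights and fundamental coweights (so $\alpha_i(\omega_j^\vee)=\delta_{i,j}$ and $\alpha_i=\sum_jC_{j,i}\omega_j$), and $\Lambda^\vee=\bigoplus_{i\in I}\mathbb Z\omega_i^\vee$. $q\in\mathbb C^\times$ is not a root of unity and $q_i=q^{d_i}$. For $J\subseteq I$, $\mathfrak g_J$ is the semisimple Lie algebra with Cartan matrix $(C_{i,j})_{i,j\in J}$, $Q_J^+=\bigoplus_{j\in J}\mathbb N\alpha_j$, $\Lambda_J^\vee=\bigoplus_{j\in J}\mathbb Z\omega_j^\vee\subseteq\Lambda^\vee$, and $\mathrm{res}_J:\Lambda^\vee\to\Lambda_J^\vee$ is the projection. Algebras. For $J\subseteq I$ and $\nu\in\Lambda_J^\vee$,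 $U_q^\nu(\mathfrak g_J)$ is the unital algebra generated by $x_{i,r}^\pm,\phi_{i,r}^\pm$ ($i\in J$, $r\in\mathbb Z$), with $\phi_{i,0}^+$ and $\phi^-_{i,\alpha_i(\nu)}$ invertible, and relations (for $i,j\in J$, $r,s\in\mathbb Z$, $m\in\mathbb Z\setminus\{0\}$): all the $\phi^{\pm}_{i,r}$ commute with each other; $\phi_{i,0}^+x_{j,r}^\pm=q_i^{\pm C_{i,j}}x_{j,r}^\pm\phi_{i,0}^+$; $\phi_{i,\alpha_i(\nu)}^-x_{j,r}^\pm=q_i^{\mp C_{i,j}}x_{j,r}^\pm\phi_{i,\alpha_i(\nu)}^-$; $[h_{i,m},x_{j,r}^\pm]=\pm\frac1m[mC_{i,j}]_{q_i}x_{j,m+r}^\pm$; $(q_i-q_i^{-1})[x_{i,r}^+,x_{j,s}^-]=\delta_{i,j}(\phi_{i,r+s}^+-\phi_{j,r+s}^-)$; $x_{i,r+1}^\pm x_{j,s}^\pm-q_i^{\pm C_{i,j}}x_{j,s}^\pm x_{i,r+1}^\pm=q_i^{\pm C_{i,j}}x_{i,r}^\pm x_{j,s+1}^\pm-x_{j,s+1}^\pm x_{i,r}^\pm$; and, for $i\ne j$, $p=1-C_{i,j}$ and $r',r_1,\dots,r_p\in\mathbb Z$, $\sum_{\pi\in\Sigma_p}\sum_{\ell=0}^p(-1)^\ell\frac{[p]_{q_i}!}{[\ell]_{q_i}![p-\ell]_{q_i}!}x^\pm_{i,r_{\pi(1)}}\cdots x^\pm_{i,r_{\pi(\ell)}}x^\pm_{j,r'}x^\pm_{i,r_{\pi(\ell+1)}}\cdots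 x^\pm_{i,r_{\pi(p)}}=0$. Here $[m]_x=\frac{x^m-x^{-m}}{x-x^{-1}}$, $[m]_x!=\prod_{r=1}^m[r]_x$, and the $h_{i,m}$ are defined by $\sum_{r\in\mathbb Z}\phi^\pm_{i,\pm r}z^{\pm r}=z^{\nu(i,\pm)}\phi^\pm_{i,\nu(i,\pm)}\exp\big(\pm(q_i-q_i^{-1})\sum_{m>0}h_{i,\pm m}z^{\pm m}\big)$ with $\nu(i,+)=0$, $\nu(i,-)=\alpha_i(\nu)$ (so $\phi_{i,r}^+=0$ for $r<0$ and $\phi_{i,r}^-=0$ for $r>\alpha_i(\nu)$). Currents: $x_i^\pm(z)=\sum_{r\in\mathbb Z}x_{i,r}^\pm z^r$. For $J=I$ this is the shifted quantum affine algebra $U_q^\mu(\mathfrak g)$, $\mu\in\Lambda^\vee$. If $\mathrm{res}_J(\mu)=\nu$, identifying generators with the same name gives an embedding $U_q^\nu(\mathfrak g_J)\hookrightarrow U_q^\mu(\mathfrak g)$, and $\mathrm{res}_J^\mu$ denotes the corresponding restriction functor from $U_q^\mu(\mathfrak g)$-modules to $U_q^\nu(\mathfrak g_J)$-modules. Category $\mathcal O$. Let $\mathfrak t_J^\times=(\mathbb C^\times)^J$, ordered by: $\gamma\le\gamma'$ iff $\gamma'\gamma^{-1}=\big(\prod_{i\in J}q_j^{a_iC_{j,i}}\big)_{j\in J}$ for some $\sum_{i\in J} a_i\alpha_i\in Q_J^+$. For a $U_q^\nu(\mathfrak g_J)$-module $V$ and $\gamma\in\mathfrak t_J^\times$ let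 $V_\gamma=V_\gamma^+=\{v:\phi_{i,0}^+v=\gamma_iv\ \forall i\in J\}$, $V_\gamma^-=\{v:\phi_{i,\alpha_i(\nu)}^-v=\gamma_i^{-1}v\ \forall i\in J\}$, $P(V)=\{\gamma:V_\gamma\ne0\}$, $P^-(V)=\{\gamma:V_\gamma^-\neq0\}$. $\mathcal O_J^\nu$ is the full subcategory of $U_q^\nu(\mathfrak g_J)$-modules $V$ with $V=\bigoplus_\gamma V_\gamma=\bigoplus_\gamma V_\gamma^-$, $\dim V_\gamma^\pm<\infty$ for all $\gamma$, and $P(V)\cup P^-(V)\subseteq\bigcup_{i=1}^s\{\gamma:\gamma\le\lambda_i\}$ for some $\lambda_1,\dots,\lambda_s\in\mathfrak t_J^\times$. (All finite-dimensional irreducible $U_q^\nu(\mathfrak g_J)$-modules are in $\mathcal O_J^\nu$.) $\mathcal O^\mu=\mathcal O_I^\mu$. Inflation. Let $W$ be an object of $\mathcal O_J^\nu$, $\mu\in\Lambda^\vee$ with $\mathrm{res}_J(\mu)=\nu$ and $V$ an object of $\mathcal O^\mu$. $V$ is a $J$-inflation of $W$ to $\mathfrak g$ with coweight $\mu$ if (i) $\mathrm{res}_J^\mu(V)\simeq W$ as $U_q^\nu(\mathfrak g_J)$-modules and (ii) $x_{i,r}^\pm V=0$ for all $i\in I\setminus J$ and $r\in\mathbb Z$. *)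

(* Defs.v *)
From HB Require Import structures.
From mathcomp Require Import all_boot all_order all_algebra all_fingroup.
From mathcomp Require Import generic_quotient ring_quotient.
From mathcomp Require Import boolp reals.
From mathcomp.real_closed Require Import complex.
From mathcomp.multinomials Require Import monalg.

Set Implicit Arguments.
Unset Strict Implicit.
Unset Printing Implicit Defensive.

Import Order.TTheory GRing.Theory Num.Theory.
Local Open Scope ring_scope.
Local Open Scope quotient_scope.

Notation freeAlg K G := {malg K[{fmonom G}]}.

HB.lock Definition fgen (K : fieldType) (G : choiceType) (g : G) : freeAlg K G :=
  << fmu g >>.

(* The two-sided ideal generated by all r - s with R r s. *)
Inductive relIdeal (K : fieldType) (G : choiceType)
    (R : freeAlg K G -> freeAlg K G -> Prop) : freeAlg K G -> Prop :=
| RelIdeal0 : relIdeal R 0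
| RelIdealD x y : relIdeal R x -> relIdeal R y -> relIdeal R (x + y)
| RelIdealM a b r s : R r s -> relIdeal R (a * (r - s) * b).

Section Presentation.
Variables (K : fieldType) (G : choiceType).
Local Notation F := (freeAlg K G).
Variable R : F -> F -> Prop.

Lemma malgC_comm (k : K) (x : F) : k%:MP * x = x * k%:MP.
Proof.
rewrite !malgM_def fgmulUg fgmulgU.
by apply: eq_bigr => m _; rewrite mulrC mul1m mulm1.
Qed.

Lemma malg_scalerAr (k : K) (x y : F) : k *: (x * y) = x * (k *: y).
Proof. by rewrite -[LHS]mul_malgC -[in RHS]mul_malgC !mulrA malgC_comm. Qed.

Lemma relIdeal_mull a x : relIdeal R x -> relIdeal R (a * x).
Proof.
elim=> [|y z _ hy _ hz|b c r s h]; first by rewrite mulr0; exact: RelIdeal0.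
  by rewrite mulrDr; exact: RelIdealD.
by rewrite mulrA (mulrA a b); exact: RelIdealM.
Qed.

Lemma relIdeal_mulr a x : relIdeal R x -> relIdeal R (x * a).
Proof.
elim=> [|y z _ hy _ hz|b c r s h]; first by rewrite mul0r; exact: RelIdeal0.
  by rewrite mulrDl; exact: RelIdealD.
by rewrite -mulrA; exact: RelIdealM.
Qed.

Definition relIdeal_pred : {pred F} := [pred x | `[< relIdeal R x >]].

Fact relIdeal_zmod : zmod_closed relIdeal_pred.
Proof.
split=> [|x y]; rewrite !inE; first by apply/asboolP; exact: RelIdeal0.
move=> /asboolP hx /asboolP hy; apply/asboolP; apply: RelIdealD => //.
by rewrite -mulN1r; exact: relIdeal_mull.
Qed.
HB.instance Definition _ := GRing.isZmodClosed.Build F relIdeal_pred relIdeal_zmod.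

Definition presAlg := Quotient.quot relIdeal_pred.
HB.instance Definition _ := GRing.Zmodule.on presAlg.
HB.instance Definition _ := Quotient.on presAlg.

Definition pres_pi (x : F) : presAlg := \pi x.

Lemma pres_piP (x y : F) : pres_pi x = pres_pi y <-> relIdeal R (x - y).
Proof.
split=> [/eqP|h]; last apply/eqP;
  rewrite /pres_pi -Quotient.idealrBE inE ?[in X in X -> _]inE.
  by move/asboolP.
exact/asboolP.
Qed.

Lemma pres_repr (u : presAlg) : pres_pi (repr u) = u.
Proof. exact: reprK. Qed.

Lemma pres_piD x y : pres_pi (x + y) = pres_pi x + pres_pi y.
Proof. exact: Quotient.pi_add. Qed.

Definition pres_one : presAlg := pres_pi 1.
Definition pres_mul (u v : presAlg) : presAlg := pres_pi (repr u * repr v).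
Definition pres_scale (k : K) (u : presAlg) : presAlg := pres_pi (k *: repr u).

Lemma pres_piM x y : pres_pi (x * y) = pres_mul (pres_pi x) (pres_pi y).
Proof.
apply/pres_piP; set x' := repr _; set y' := repr _.
have hx : relIdeal R (x - x') by apply/pres_piP; rewrite pres_repr.
have hy : relIdeal R (y - y') by apply/pres_piP; rewrite pres_repr.
have -> : x * y - x' * y' = (x - x') * y + x' * (y - y').
  by rewrite mulrBl mulrBr addrA addrNK.
by apply: RelIdealD; [exact: relIdeal_mulr | exact: relIdeal_mull].
Qed.

Lemma pres_piZ k x : pres_pi (k *: x) = pres_scale k (pres_pi x).
Proof.
apply/pres_piP; set x' := repr _; rewrite -scalerBr -mul_malgC.
by apply: relIdeal_mull; apply/pres_piP; rewrite pres_repr.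
Qed.

Fact pres_mulA : associative pres_mul.
Proof.
move=> u v w; rewrite -(pres_repr u) -(pres_repr v) -(pres_repr w).
by rewrite -!pres_piM mulrA.
Qed.

Fact pres_mul1 : left_id pres_one pres_mul.
Proof. by move=> u; rewrite -(pres_repr u) -pres_piM mul1r. Qed.

Fact pres_mulr1 : right_id pres_one pres_mul.
Proof. by move=> u; rewrite -(pres_repr u) -pres_piM mulr1. Qed.

Fact pres_mulDl : left_distributive pres_mul +%R.
Proof.
move=> u v w; rewrite -(pres_repr u) -(pres_repr v) -(pres_repr w).
by rewrite -pres_piD -!pres_piM -pres_piD mulrDl.
Qed.

Fact pres_mulDr : right_distributive pres_mul +%R.
Proof.
move=> u v w; rewrite -(pres_repr u) -(pres_repr v) -(pres_repr w).
by rewrite -pres_piD -!pres_piM -pres_piD mulrDr.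
Qed.

(* The quotient may be zero a priori, hence no nzRingType (nor algType). *)
HB.instance Definition _ := GRing.Zmodule_isPzRing.Build presAlg
  pres_mulA pres_mul1 pres_mulr1 pres_mulDl pres_mulDr.

Fact pres_scaleA a b u : pres_scale a (pres_scale b u) = pres_scale (a * b) u.
Proof. by rewrite -(pres_repr u) -!pres_piZ scalerA. Qed.

Fact pres_scale1 : left_id 1 pres_scale.
Proof. by move=> u; rewrite -(pres_repr u) -pres_piZ scale1r. Qed.

Fact pres_scaleDr : right_distributive pres_scale +%R.
Proof.
move=> a u v; rewrite -(pres_repr u) -(pres_repr v) -pres_piD -!pres_piZ.
by rewrite -pres_piD scalerDr.
Qed.

Fact pres_scaleDl u : {morph pres_scale^~ u : a b / a + b}.
Proof.
by move=> a b; rewrite -(pres_repr u) -!pres_piZ -pres_piD scalerDl.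
Qed.

HB.instance Definition _ := GRing.Zmodule_isLmodule.Build K presAlg
  pres_scaleA pres_scale1 pres_scaleDr pres_scaleDl.

Lemma pres_scalerAl (k : K) (u v : presAlg) : k *: (u * v) = (k *: u) * v.
Proof.
rewrite -(pres_repr u) -(pres_repr v).
have E x y : pres_pi x * pres_pi y = pres_pi (x * y) by rewrite pres_piM.
have Z x : k *: pres_pi x = pres_pi (k *: x) by rewrite pres_piZ.
by rewrite E Z Z E scalerAl.
Qed.

Lemma pres_scalerAr (k : K) (u v : presAlg) : k *: (u * v) = u * (k *: v).
Proof.
rewrite -(pres_repr u) -(pres_repr v).
have E x y : pres_pi x * pres_pi y = pres_pi (x * y) by rewrite pres_piM.
have Z x : k *: pres_pi x = pres_pi (k *: x) by rewrite pres_piZ.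
by rewrite E Z Z E malg_scalerAr.
Qed.

Definition pgen (g : G) : presAlg := pres_pi (fgen K g).

End Presentation.

(* The coefficient of z^m in exp(\sum_(k > 0) a_k z^k): neither the powers
   p > m nor the truncation at order m change it. *)
Definition expCoef (K : fieldType) (F : lalgType K) (a : nat -> F) (m : nat) : F :=
  \sum_(p < m.+1) (p`!%:R^-1 : K) *:
    ((\poly_(k < m.+1) (if k == 0%N then 0 else a k)) ^+ p)`_m.

Section FreeMap.
Variables (K : fieldType) (G G' : choiceType) (phi : G -> G').

Definition monMap (m : {fmonom G}) : freeAlg K G' :=
  << fmonom_of_seq fmonom_key [seq phi g | g <- m] >>.

Fact monMap_mmorphism : mmorphism monMap.
Proof.
split=> [x y|]; rewrite /monMap !fmE.
  rewrite fmM map_cat malgM_def fgmulUU mulr1; congr << _ >>.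
  by apply/eqP; rewrite -val_eqE /= fmM.
by rewrite fm1; congr << _ >>; apply/eqP; rewrite -val_eqE /= fm1.
Qed.
HB.instance Definition _ :=
  isMultiplicative.Build {fmonom G} (freeAlg K G') monMap monMap_mmorphism.

Definition freeMap : freeAlg K G -> freeAlg K G' := mmap (@malgC {fmonom G'} K) monMap.

HB.instance Definition _ := GRing.Additive.on freeMap.

Fact freeMap_multiplicative : multiplicative freeMap.
Proof.
apply: commr_mmap_is_multiplicative => g m m'.
exact: malgC_comm.
Qed.
HB.instance Definition _ :=
  GRing.isMultiplicative.Build _ _ freeMap freeMap_multiplicative.

Lemma freeMap_gen g : freeMap (fgen K g) = fgen K (phi g).
Proof.
rewrite !fgen.unlock /freeMap mmapU /= mpolyC1E mul1r /monMap fmU /=.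
by congr << _ >>; apply/eqP; rewrite -val_eqE /= fmU fmE.
Qed.

Lemma freeMap0 : freeMap 0 = 0.
Proof. exact: mmap0. Qed.

Lemma freeMapD x y : freeMap (x + y) = freeMap x + freeMap y.
Proof. exact: mmapD. Qed.

Lemma freeMapB x y : freeMap (x - y) = freeMap x - freeMap y.
Proof. exact: mmapB. Qed.

Lemma freeMap1 : freeMap 1 = 1.
Proof. exact: freeMap_multiplicative.2. Qed.

Lemma freeMapM x y : freeMap (x * y) = freeMap x * freeMap y.
Proof. exact: freeMap_multiplicative.1. Qed.

Lemma freeMapZ k x : freeMap (k *: x) = k *: freeMap x.
Proof. by rewrite -[k *: x]mul_malgC -[RHS]mul_malgC rmorphM /= /freeMap mmapC. Qed.

Lemma freeMap_sum (I : Type) (r : seq I) (P : pred I) (E : I -> freeAlg K G) :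
  freeMap (\sum_(i <- r | P i) E i) = \sum_(i <- r | P i) freeMap (E i).
Proof. by apply: (big_morph freeMap); [exact: freeMapD | exact: freeMap0]. Qed.

Lemma freeMap_prod (I : Type) (r : seq I) (P : pred I) (E : I -> freeAlg K G) :
  freeMap (\prod_(i <- r | P i) E i) = \prod_(i <- r | P i) freeMap (E i).
Proof. by apply: (big_morph freeMap); [exact: freeMapM | exact: freeMap1]. Qed.

Lemma freeMap_expCoef a m :
  freeMap (expCoef a m) = expCoef (fun k => freeMap (a k)) m.
Proof.
have X p (P : {poly freeAlg K G}) (Q : {poly freeAlg K G'}) :
    (forall k, freeMap P`_k = Q`_k) -> forall k, freeMap (P ^+ p)`_k = (Q ^+ p)`_k.
  move=> PQ; elim: p => [|p IH] k.
    by rewrite !expr0 !coef1; case: eqP => _; [exact: freeMap1 | exact: freeMap0].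
  rewrite !exprS !coefM freeMap_sum; apply: eq_bigr => l _.
  by rewrite freeMapM PQ IH.
rewrite /expCoef freeMap_sum; apply: eq_bigr => p _.
rewrite freeMapZ; congr (_ *: _); apply: X => k.
rewrite !coef_poly; case: ifP => _; last exact: freeMap0.
by case: ifP => _ //; exact: freeMap0.
Qed.

End FreeMap.

Section PresMap.
Variables (K : fieldType) (G G' : choiceType) (phi : G -> G').
Variables (R : freeAlg K G -> freeAlg K G -> Prop).
Variables (R' : freeAlg K G' -> freeAlg K G' -> Prop).

Definition presMap (u : presAlg R) : presAlg R' :=
  pres_pi R' (freeMap phi (repr u)).

Hypothesis phiR : forall r s, R r s -> R' (freeMap phi r) (freeMap phi s).

Lemma freeMap_ideal x : relIdeal R x -> relIdeal R' (freeMap phi x).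
Proof.
elim=> [|y z _ hy _ hz|a b r s h]; first by rewrite freeMap0; exact: RelIdeal0.
  by rewrite freeMapD; exact: RelIdealD.
by rewrite !freeMapM freeMapB; apply: RelIdealM; exact: phiR.
Qed.

Lemma presMap_pi x : presMap (pres_pi R x) = pres_pi R' (freeMap phi x).
Proof.
apply/pres_piP; rewrite -freeMapB; apply: freeMap_ideal.
by apply/pres_piP; rewrite pres_repr.
Qed.

Lemma presMap_gen g : presMap (pgen R g) = pgen R' (phi g).
Proof. by rewrite presMap_pi freeMap_gen. Qed.

Lemma presMapD u v : presMap (u + v) = presMap u + presMap v.
Proof.
rewrite -(pres_repr u) -(pres_repr v) -pres_piD.
by rewrite !presMap_pi freeMapD pres_piD.
Qed.

Lemma presMap1 : presMap 1 = 1.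
Proof. by rewrite [LHS]presMap_pi freeMap1. Qed.

Lemma presMapM u v : presMap (u * v) = presMap u * presMap v.
Proof.
rewrite -(pres_repr u) -(pres_repr v).
have E x y : pres_pi R x * pres_pi R y = pres_pi R (x * y) by rewrite pres_piM.
by rewrite E !presMap_pi freeMapM pres_piM.
Qed.

Lemma presMapZ k u : presMap (k *: u) = k *: presMap u.
Proof.
rewrite -(pres_repr u).
have E x : k *: pres_pi R x = pres_pi R (k *: x) by rewrite pres_piZ.
by rewrite E !presMap_pi freeMapZ pres_piZ.
Qed.

End PresMap.

Definition sg (s : bool) : int := if s then 1 else -1.

Definition qint (K : fieldType) (x : K) (m : int) : K :=
  (x ^ m - x ^ (- m)) / (x - x^-1).

Definition qfact (K : fieldType) (x : K) (m : nat) : K :=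
  \prod_(1 <= r < m.+1) qint x r%:Z.

(* A sign is a boolean, true standing for +.  [GPhiInv s i] is the inverse of
   phi^s_(i, nu(i, s)).  The elements h_(i, m) are added to the generators,
   subject to the equation that defines them in terms of the phi's; the index
   m = 0 is not used and [GH i 0] is set to 0. *)
Inductive gen (T : Type) :=
| GX of bool & T & int
| GPhi of bool & T & int
| GPhiInv of bool & T
| GH of T & int.

HB.instance Definition _ (T : Type) := gen_eqMixin (gen T).
HB.instance Definition _ (T : Type) := gen_choiceMixin (gen T).

Definition genMap (T T' : Type) (e : T -> T') (g : gen T) : gen T' :=
  match g with
  | GX s i r => GX s (e i) r
  | GPhi s i r => GPhi s (e i) r
  | GPhiInv s i => GPhiInv s (e i)
  | GH i m => GH (e i) m
  end.

Section ShiftedQuantumAffine.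
Variables (K : fieldType) (T : finType).
Variables (C : T -> T -> int) (d : T -> nat) (q : K) (nu : {ffun T -> int}).

Local Notation F := (freeAlg K (gen T)).
Local Notation x s i r := (fgen K (GX s i r)).
Local Notation phi s i r := (fgen K (GPhi s i r)).
Local Notation phiInv s i := (fgen K (GPhiInv s i)).
Local Notation h i m := (fgen K (GH i m)).

Definition qi (i : T) : K := q ^+ d i.

(* nu(i, +) = 0 and nu(i, -) = alpha_i(nu); nu is given by its coordinates
   alpha_i(nu) in the basis of fundamental coweights. *)
Definition lead (s : bool) (i : T) : int := if s then 0 else nu i.

Definition serre (s : bool) (i j : T) (r' : int) (p : nat) (r : 'I_p -> int) : F :=
  \sum_(w : 'S_p) \sum_(l < p.+1)
    ((-1) ^+ l * (qfact (qi i) p / (qfact (qi i) l * qfact (qi i) (p - l)))) *: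
    ((\prod_(k < p | (k < l)%N) x s i (r (w k))) * x s j r' *
     (\prod_(k < p | (l <= k)%N) x s i (r (w k)))).

Inductive UqRel : F -> F -> Prop :=
| Rel_phi_comm s t i j r m :
    UqRel (phi s i r * phi t j m) (phi t j m * phi s i r)
| Rel_phi_invl s i :
    UqRel (phiInv s i * phi s i (lead s i)) 1
| Rel_phi_invr s i :
    UqRel (phi s i (lead s i) * phiInv s i) 1
| Rel_phi_vanish s i (m : nat) : (0 < m)%N ->
    UqRel (phi s i (lead s i - sg s * m%:Z)) 0
| Rel_phi_exp s i (m : nat) :
    UqRel (phi s i (lead s i + sg s * m%:Z))
      (phi s i (lead s i) *
       expCoef (fun k => ((sg s)%:~R * (qi i - (qi i)^-1)) *: h i (sg s * k%:Z)) m)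
| Rel_h0 i :
    UqRel (h i 0) 0
| Rel_phi_x s t i j r :
    UqRel (phi s i (lead s i) * x t j r)
      ((qi i ^ (sg s * sg t * C i j)) *: (x t j r * phi s i (lead s i)))
| Rel_h_x t i j (m r : int) : m != 0 ->
    UqRel (h i m * x t j r - x t j r * h i m)
      (((sg t)%:~R * (m%:~R)^-1 * qint (qi i) (m * C i j)) *: x t j (m + r))
| Rel_x_x i j (r s : int) :
    UqRel ((qi i - (qi i)^-1) *: (x true i r * x false j s - x false j s * x true i r))
      (if i == j then phi true i (r + s) - phi false j (r + s) else 0)
| Rel_drinfeld t i j (r s : int) :
    UqRel (x t i (r + 1) * x t j s
           - (qi i ^ (sg t * C i j)) *: (x t j s * x t i (r + 1)))
          ((qi i ^ (sg t * C i j)) *: (x t i r * x t j (s + 1))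
           - x t j (s + 1) * x t i r)
| Rel_serre t i j (r' : int) (p : nat) (r : 'I_p -> int) :
    i != j -> p%:Z = 1 - C i j ->
    UqRel (serre t i j r' r) 0.

Definition Uq := presAlg UqRel.
HB.instance Definition _ := GRing.PzRing.on Uq.
HB.instance Definition _ := GRing.Lmodule.on Uq.

Definition Ux (s : bool) (i : T) (r : int) : Uq := pgen UqRel (GX s i r).
Definition Uphi (s : bool) (i : T) (r : int) : Uq := pgen UqRel (GPhi s i r).
Definition Uscal (k : K) : Uq := k *: (1 : Uq).

End ShiftedQuantumAffine.

Record torus (K : fieldType) (T : finType) := Torus {
  torus_val :> {ffun T -> K};
  _ : [forall i, torus_val i != 0]
}.
HB.instance Definition _ K T := [isSub for @torus_val K T].
HB.instance Definition _ K T := [Choice of torus K T by <:].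

Section Modules.
Variables (K : fieldType) (T : finType).
Variables (C : T -> T -> int) (d : T -> nat) (q : K) (nu : {ffun T -> int}).
Variable V : lmodType (Uq C d q nu).

(* Scalars of K act through their images [Uscal k] in the algebra. *)
Definition findimSub (E : V -> Prop) : Prop :=
  exists2 b : seq V, (forall v, v \in b -> E v) &
    forall v, E v -> exists c : nat -> K,
      v = \sum_(i < size b) Uscal C d q nu (c i) *: b`_i.

Definition findim : Prop := findimSub (fun=> True).

Definition submodule (E : V -> Prop) : Prop :=
  [/\ E 0, forall v w, E v -> E w -> E (v + w) &
      forall (u : Uq C d q nu) v, E v -> E (u *: v)].

Definition irreducibleModule : Prop :=
  (exists v : V, v != 0) /\
  forall E, submodule E -> (forall v, E v -> v = 0) \/ (forall v, E v).

Definition torus_le (g g' : torus K T) : Prop :=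
  exists a : T -> nat, forall j,
    g' j * (g j)^-1 = \prod_i qi d q j ^ ((a i)%:Z * C j i).

(* V_g^+ for s = true, V_g^- for s = false *)
Definition weightSpace (s : bool) (g : torus K T) (v : V) : Prop :=
  forall i, Uphi C d q nu s i (lead nu s i) *: v =
            Uscal C d q nu (g i ^ sg s) *: v.

Definition is_weight (s : bool) (g : torus K T) : Prop :=
  exists2 v, v != 0 & weightSpace s g v.

Definition directSum (E : torus K T -> V -> Prop) : Prop :=
  (forall v, exists (gs : seq (torus K T)) (f : torus K T -> V),
     (forall g, g \in gs -> E g (f g)) /\ v = \sum_(g <- gs) f g) /\
  (forall (gs : seq (torus K T)) (f : torus K T -> V), uniq gs ->
     (forall g, g \in gs -> E g (f g)) -> \sum_(g <- gs) f g = 0 ->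
     forall g, g \in gs -> f g = 0).

Definition categoryO : Prop :=
  [/\ forall s, directSum (weightSpace s),
      forall s g, findimSub (weightSpace s g) &
      exists ls : seq (torus K T), forall s g, is_weight s g ->
        exists2 l, l \in ls & torus_le g l].

End Modules.

Section Restriction.
Variables (K : fieldType) (T : finType).
Variables (C : T -> T -> int) (d : T -> nat) (q : K) (J : {set T}).

Definition cartanJ (i j : {i | i \in J}) : int := C (val i) (val j).
Definition symJ (i : {i | i \in J}) : nat := d (val i).

Definition resCoweight (mu : {ffun T -> int}) : {ffun {i | i \in J} -> int} :=
  [ffun j => mu (val j)].

Variables (nu : {ffun {i | i \in J} -> int}) (mu : {ffun T -> int}).
Hypothesis mu_nu : resCoweight mu = nu.

Definition resMap : Uq cartanJ symJ q nu -> Uq C d q mu := presMap (genMap val) (UqRel C d q mu).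

Local Notation fm := (@freeMap K _ _ (genMap (val : {i | i \in J} -> T))).

Lemma freeMap_serre s i j r' p (r : 'I_p -> int) :
  fm (serre symJ q s i j r' r) = serre d q s (val i) (val j) r' r.
Proof.
rewrite /serre freeMap_sum; apply: eq_bigr => w _.
rewrite freeMap_sum; apply: eq_bigr => l _.
have X (P : pred 'I_p) :
    fm (\prod_(k < p | P k) fgen K (GX s i (r (w k)))) =
    \prod_(k < p | P k) fgen K (GX s (val i) (r (w k))).
  by rewrite freeMap_prod; apply: eq_bigr => k _; rewrite freeMap_gen.
by rewrite freeMapZ 2!freeMapM freeMap_gen 2!X.
Qed.

Lemma resMap_rel r s :
  UqRel cartanJ symJ q nu r s ->
  UqRel C d q mu (fm r) (fm s).
Proof.
have E t i : lead nu t i = lead mu t (val i) by rewrite -mu_nu /lead ffunE.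
have M a b : fm (fgen K a * fgen K b) =
    fgen K (genMap val a) * fgen K (genMap val b).
  by rewrite freeMapM; congr (_ * _); exact: freeMap_gen.
have Z c a : fm (c *: fgen K a) = c *: fgen K (genMap val a).
  by rewrite freeMapZ; congr (_ *: _); exact: freeMap_gen.
have B a b a' b' : fm (fgen K a * fgen K b - fgen K a' * fgen K b') =
    fgen K (genMap val a) * fgen K (genMap val b) -
    fgen K (genMap val a') * fgen K (genMap val b').
  by rewrite freeMapB; apply: f_equal2; [exact: M | apply: f_equal; exact: M].
have conv x y x' y' : UqRel C d q mu x' y' -> x = x' -> y = y' ->
  UqRel C d q mu x y by move=> ? -> ->.
case=> {r s}.
- by move=> s t i j r m; apply: conv (M _ _) (M _ _); exact: Rel_phi_comm.
- by move=> s i; rewrite M freeMap1 /= E; exact: Rel_phi_invl.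
- by move=> s i; rewrite M freeMap1 /= E; exact: Rel_phi_invr.
- by move=> s i m m0; rewrite freeMap_gen freeMap0 /= E; exact: Rel_phi_vanish.
- move=> t i m; rewrite freeMap_gen freeMapM freeMap_gen freeMap_expCoef /= E.
  set a := fun k : nat => fm _.
  have -> : a = fun k => ((sg t)%:~R * (qi d q (val i) -
    (qi d q (val i))^-1)) *: fgen K (GH (val i) (sg t * k%:Z)).
    by apply/funext => k; rewrite /a Z.
  exact: Rel_phi_exp.
- by move=> i; rewrite freeMap_gen freeMap0; exact: Rel_h0.
- by move=> *; rewrite M freeMapZ M /= E; exact: Rel_phi_x.
- by move=> *; apply: conv (B _ _ _ _) (Z _ _); exact: Rel_h_x.
- move=> i j r s; rewrite freeMapZ B.
  have -> : fm (if i == j then fgen K (GPhi true i (r + s)) -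
      fgen K (GPhi false j (r + s)) else 0) =
    if val i == val j then fgen K (GPhi true (val i) (r + s)) -
      fgen K (GPhi false (val j) (r + s)) else 0.
    rewrite val_eqE; case: ifP => _; last exact: freeMap0.
    by rewrite freeMapB; apply: f_equal2; [|apply: f_equal]; exact: freeMap_gen.
  exact: Rel_x_x.
- move=> t i j r s; apply: conv (Rel_drinfeld _ _ _ _ t (val i) (val j) r s) _ _.
    rewrite freeMapB freeMapZ; apply: f_equal2; by rewrite M.
  rewrite freeMapB freeMapZ; apply: f_equal2; by rewrite M.
- move=> t i j r' p r ij hp; rewrite freeMap0 freeMap_serre.
  by apply: Rel_serre => //; rewrite val_eqE.
Qed.

Fact resMapD : {morph resMap : u v / u + v}.
Proof. exact: presMapD resMap_rel. Qed.

Fact resMapM u v : resMap (u * v) = resMap u * resMap v.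
Proof. exact: presMapM resMap_rel u v. Qed.

Fact resMap1 : resMap 1 = 1.
Proof. exact: presMap1 resMap_rel. Qed.

End Restriction.

Arguments cartanJ {T} C J.
Arguments symJ {T} d J.

Section RestrictedModule.
Variables (K : fieldType) (T : finType).
Variables (C : T -> T -> int) (d : T -> nat) (q : K) (J : {set T}).
Variables (nu : {ffun {i | i \in J} -> int}) (mu : {ffun T -> int}).
Variable mu_nu : resCoweight J mu = nu.
Variable V : lmodType (Uq C d q mu).

(* res_J^mu(V): the space V on which U_q^nu(g_J) acts through [resMap]. *)
Definition resModule (_ : resCoweight J mu = nu) (V : lmodType (Uq C d q mu)) : Type := V.

Local Notation RV := (resModule mu_nu V).
HB.instance Definition _ := GRing.Zmodule.on RV.

Definition res_scale (u : Uq (cartanJ C J) (symJ d J) q nu) (v : RV) : RV :=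
  resMap mu u *: (v : V).

Fact res_scaleA u1 u2 v :
  res_scale u1 (res_scale u2 v) = res_scale (u1 * u2) v.
Proof. by rewrite /res_scale [in RHS](resMapM mu_nu); exact: scalerA. Qed.

Fact res_scale1 : left_id 1 res_scale.
Proof. by move=> v; rewrite /res_scale (resMap1 C d q mu_nu) scale1r. Qed.

Fact res_scaleDr : right_distributive res_scale +%R.
Proof. by move=> u v w; exact: scalerDr. Qed.

Fact res_scaleDl v : {morph res_scale^~ v : a b / a + b}.
Proof.
move=> a b; apply: etrans (scalerDl (v : V) (resMap mu a) (resMap mu b)).
by apply: (congr1 (fun u => u *: (v : V))); exact: (resMapD mu_nu).
Qed.

HB.instance Definition _ := GRing.Zmodule_isLmodule.Build
  (Uq (cartanJ C J) (symJ d J) q nu) RV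
  res_scaleA res_scale1 res_scaleDr res_scaleDl.

End RestrictedModule.

Definition isInflation (K : fieldType) (T : finType) (C : T -> T -> int)
    (d : T -> nat) (q : K) (J : {set T}) (nu : {ffun {i | i \in J} -> int})
    (mu : {ffun T -> int}) (mu_nu : resCoweight J mu = nu)
    (W : lmodType (Uq (cartanJ C J) (symJ d J) q nu))
    (V : lmodType (Uq C d q mu)) : Prop :=
  (exists f : {linear resModule mu_nu V -> W}, bijective f) /\
  (forall s i r (v : V), i \notin J -> Ux C d q mu s i r *: v = 0).

(* The simple Lie algebra is given by its Cartan matrix C, with symmetrizer d:
   by Cartan-Killing and Serre, the Cartan matrices of finite-dimensional
   complex simple Lie algebras are the indecomposable ones of finite type, for
   which the form (alpha_i, alpha_j) = d_i C_(i,j) is positive definite on the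
   root lattice. *)
Record simpleCartan (n : nat) (C : 'M[int]_n) (d : 'I_n -> nat) : Prop := {
  sc_rank : (0 < n)%N;
  sc_diag : forall i, C i i = 2;
  sc_offdiag : forall i j, i != j -> C i j <= 0;
  sc_zero : forall i j, C i j = 0 -> C j i = 0;
  sc_indec : forall S : {set 'I_n}, S != set0 -> S != setT ->
    exists i j, [/\ i \in S, j \notin S & C i j != 0];
  sc_sym_gt0 : forall i, (0 < d i)%N;
  sc_sym_coprime : \big[gcdn/0%N]_i d i = 1%N;
  sc_sym : forall i j, (d i)%:Z * C i j = (d j)%:Z * C j i;
  sc_posdef : forall a : 'I_n -> int, (exists i, a i != 0) ->
    0 < \sum_i \sum_j a i * a j * ((d i)%:Z * C i j)
}.

(* Main.v *)
(** W is spanned by the words x^-_(j_1,r_1) ... x^-_(j_k,r_k) w with w in its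
    top weight space.  Multiplying each lowering current x_j^-(u) by
    a_j + b_j u^-1 in such words is a well defined operator on W: its graph is
    stable under the Cartan currents and under the pairs
    ((a_j + b_j u^-1) x_j^+(u), x_j^+(u)), since [x^+_(j,r), x^-_(j,s)] depends
    only on r + s; hence the vectors related to 0 are stable under the x^+, and
    if there were a nonzero one there would be a singular vector outside the
    top, against irreducibility.

    For a node i outside J, let N(z) and D(z) be the operators of this kind for
    the factors q_i^(-C_ij) - z u^-1 and 1 - q_i^(-C_ij) z u^-1.  Then N/D has
    the commutation relations with x_j^+-(u) required of phi_i(z), and so has
    phi_i(z) := N(z) adj(D(z)), which differs from it by the scalar det D(z) and
    is polynomial in z.  On the top weight space it is det D(z), so that its
    degree is that of det D and its extreme coefficients are invertible.  Taking
    this polynomial for both phi_i^+ and phi_i^-, its degree for alpha_i(mu),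
    its logarithms at 0 and at infinity for the h_(i,m), and x_i^+- = 0, gives
    the inflation. *)
From HB Require Import structures.
From mathcomp Require Import ring boolp.
Require Import Defs.
From mathcomp Require Import all_boot all_order all_algebra.
From mathcomp Require Import reals.
From mathcomp.real_closed Require Import complex.
From mathcomp.multinomials Require Import monalg.

Import GRing.Theory Num.Theory.
Local Open Scope ring_scope.

Set Implicit Arguments.
Unset Strict Implicit.

(** * Exponentials and logarithms of currents *)

(** The factors come from the defining relations: exponentiating the commutators with the h_(i,m)
    and including the leading term, moving phi_i(z) past x_j^-(u) has to multiply it by (q_i^(-C_ij)
    - z u^-1) / (1 - q_i^(-C_ij) z u^-1), and moving it past x_j^+(u) by the inverse. Numerator and
    denominator are realized separately because each is polynomial in u^-1 and so acts on a current
    by finitely many shifts of the index. Setting x_i^+- to zero forces phi_(i,r)^+ = phi_(i,r)^-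
    for every r, while the former vanishes for r < 0 and the latter for r > alpha_i(mu): the common
    current has to be a polynomial. N/D is only rational, with different expansions at 0 and at
    infinity, hence the adjugate; the degree that det D brings in is absorbed by the free
    coordinates of the coweight outside J. The new currents also have to commute with the Cartan
    operators of W and with each other. This holds on the top weight space, where they are scalars,
    and is carried along the words. *)

Section ExpCoef.
Variables (K : numFieldType) (F : algType K).
Implicit Types (a : nat -> F) (Q : F -> Prop).

Definition subalg Q : Prop :=
  [/\ Q 1, forall x y, Q x -> Q y -> Q (x + y), forall x y, Q x -> Q y -> Q (x * y) &
      forall (k : K) x, Q x -> Q (k *: x)].

Lemma subalg0 Q : subalg Q -> Q 0.
Proof. by case=> Q1 _ _ /(_ 0 _ Q1); rewrite scale0r. Qed.

Lemma subalgB Q x y : subalg Q -> Q x -> Q y -> Q (x - y).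
Proof. by case=> _ QD _ QZ Qx Qy; rewrite -scaleN1r; apply: QD => //; apply: QZ. Qed.

Lemma subalg_sum Q (I : Type) (r : seq I) (P : pred I) (f : I -> F) :
  subalg Q -> (forall i, P i -> Q (f i)) -> Q (\sum_(i <- r | P i) f i).
Proof.
move=> QA Qf; elim/big_rec: _ => [|i x Pi Qx]; first exact: subalg0.
by case: QA => _ QD _ _; apply: QD => //; apply: Qf.
Qed.

Lemma subalg_centralizer (x : F) : subalg (fun y => GRing.comm x y).
Proof.
split=> [|y z|y z|k y]; rewrite /GRing.comm.
- by rewrite mulr1 mul1r.
- by move=> xy xz; rewrite mulrDl mulrDr xy xz.
- by move=> xy xz; rewrite mulrA xy -mulrA xz mulrA.
- by move=> xy; rewrite -scalerAl -scalerAr xy.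
Qed.

Lemma subalg_exp_coef Q (p : {poly F}) k m :
  subalg Q -> (forall l, (l <= m)%N -> Q p`_l) -> Q (p ^+ k)`_m.
Proof.
move=> QA; elim: k m => [|k IH] m Qp.
  by rewrite expr0 coef1; case: eqP => _ /=; [case: QA | exact: (subalg0 QA)].
rewrite exprS coefM; apply: subalg_sum => // l _; case: (QA) => _ _ QM _.
by apply: QM; [apply: Qp; rewrite -ltnS | apply: IH => l' h; apply: Qp;
  exact: leq_trans h (leq_subr _ _)].
Qed.

Let trunc a N : {poly F} := \poly_(k < N.+1) (if k == 0%N then 0 else a k).

Lemma subalg_expCoef Q a m :
  subalg Q -> (forall k, (0 < k)%N -> Q (a k)) -> Q (expCoef a m).
Proof.
move=> QA Qa; apply: subalg_sum => // p _; case: (QA) => _ _ _ QZ.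
apply: QZ; apply: subalg_exp_coef => // l _; rewrite coef_poly.
case: ifP => _; last exact: (subalg0 QA).
by case: eqP => [_|/eqP]; [exact: (subalg0 QA) | rewrite -lt0n; exact: Qa].
Qed.

(* [expCoef a m] is [a m] plus a polynomial in the [a k] with [k < m]. *)
Lemma subalg_expCoef_inv Q a :
  subalg Q -> (forall m, (0 < m)%N -> Q (expCoef a m)) ->
  forall m, (0 < m)%N -> Q (a m).
Proof.
move=> QA Qe m; elim/ltn_ind: m => m IH m0.
have Qp l : (l < m)%N -> Q (trunc a m)`_l.
  move=> lm; rewrite coef_poly ltnS (ltnW lm).
  by case: eqP => [_|/eqP l0]; [exact: (subalg0 QA) | apply: IH; rewrite ?lt0n].
have := Qe m m0; rewrite /expCoef -/(trunc a m).
case: m IH m0 Qp => // m IH m0 Qp.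
rewrite big_ord_recl big_ord_recl /= expr0 coef1 scaler0 add0r expr1 invr1 scale1r.
rewrite coef_poly ltnSn /= => Qs.
set s := \sum_(i < _) _ in Qs; have -> : a m.+1 = a m.+1 + s - s by rewrite addrK.
apply: subalgB => //; apply: subalg_sum => // p _; case: (QA) => _ _ QM QZ; apply: QZ.
rewrite exprS coefM; apply: subalg_sum => // -[[|l] /= lm] _.
  by rewrite coef_poly /= mul0r; exact: (subalg0 QA).
have [->|lm'] := eqVneq l m.
  rewrite subnn [X in _ * X](_ : _ = 0) ?mulr0; first exact: (subalg0 QA).
  by rewrite exprS coefM big_ord1 coef_poly /= mul0r.
have {}lm' : (l.+1 < m.+1)%N by rewrite ltn_neqAle eqSS lm' -ltnS.
apply: QM; first exact: Qp.
apply: subalg_exp_coef => // l' hl'; apply: Qp.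
by apply: leq_ltn_trans hl' _; rewrite subSS ltnS leq_subr.
Qed.

(** A single polynomial whose coefficients up to order [N] are those of the exponential, so that
    formal derivation applies. *)
Let texp a N : {poly F} := \sum_(p < N.+1) (p`!%:R^-1 : K)%:A *: trunc a N ^+ p.

Lemma coef_lt_exp (p : {poly F}) k m : p`_0 = 0 -> (m < k)%N -> (p ^+ k)`_m = 0.
Proof.
move=> p0; elim: k m => // k IH m; rewrite ltnS => mk; rewrite exprS coefM.
rewrite big1 // => -[[|l] /= lm] _; first by rewrite p0 mul0r.
by rewrite IH ?mulr0 //; case: m mk lm => // m mk lm;
  rewrite subSS (leq_ltn_trans (leq_subr _ _)).
Qed.

Lemma coef_exp_eq (p r : {poly F}) k m :
  (forall l, (l <= m)%N -> p`_l = r`_l) -> (p ^+ k)`_m = (r ^+ k)`_m.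
Proof.
elim: k m => [|k IH] m pr; first by rewrite !expr0.
rewrite !exprS !coefM; apply: eq_bigr => -[l /= lm] _.
by rewrite pr // IH // => l' hl'; apply: pr; exact: leq_trans hl' (leq_subr _ _).
Qed.

Lemma coef_texp a m N : (m <= N)%N -> (texp a N)`_m = expCoef a m.
Proof.
move=> mN; rewrite coef_sum /expCoef -(subnKC mN) -addSn big_split_ord /= [X in _ + X]big1 ?addr0; last first.
  move=> p _; rewrite coefZ coef_lt_exp ?mulr0 ?coef_poly //.
  by rewrite addSn ltnS leq_addr.
apply: eq_bigr => p _; rewrite coefZ -scalerAl mul1r; congr (_ *: _).
by apply: coef_exp_eq => l lm; rewrite !coef_poly !ltnS lm (leq_trans lm) ?leq_addr.
Qed.

Lemma deriv_exp_comm (p : {poly F}) k :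
  GRing.comm p p^`() -> (p ^+ k.+1)^`() = p^`() * p ^+ k *+ k.+1.
Proof.
move=> pc; elim: k => [|k IH]; first by rewrite expr0 mulr1 expr1.
rewrite exprS derivM IH mulrnAr mulrA pc -mulrA -exprS [RHS]mulrS.
by [].
Qed.

Lemma trunc_comm a N : (forall k l, GRing.comm (a k) (a l)) ->
  GRing.comm (trunc a N) (trunc a N)^`().
Proof.
move=> ac; apply/polyP => m; rewrite !coefM [RHS](reindex_inj rev_ord_inj) /=.
apply: eq_bigr => -[l /= lm] _; rewrite subSS subKn // !coef_deriv.
rewrite mulrnAl mulrnAr; congr (_ *+ _); rewrite !coef_poly.
by do 4?case: ifP => _; rewrite ?mulr0 ?mul0r //; apply: ac.
Qed.

Lemma expCoef0 a : expCoef a 0 = 1.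
Proof. by rewrite /expCoef big_ord1 expr0 coef1 invr1 scale1r. Qed.

(* Newton's identities: the logarithmic derivative of the exponential. *)
Lemma expCoef_newton a m : (forall k l, GRing.comm (a k) (a l)) ->
  expCoef a m *+ m = \sum_(k < m) a k.+1 * expCoef a (m - k.+1) *+ k.+1.
Proof.
case: m => [|m] ac; first by rewrite mulr0n big_ord0.
pose N := m.+1; pose g p : F := (p`!%:R^-1 : K)%:A.
have gS p : g p.+1 *+ p.+1 = g p.
  rewrite /g scalerMnl; congr (_ *: _).
  by rewrite -mulr_natr factS natrM invfM mulrC mulrA mulfV ?mul1r ?pnatr_eq0.
(* Truncated form of exp(a)' = a' exp(a). The term removed on the right has no coefficient below
   degree [N], which is m + 1 for the coefficient m used below. *)
have D : (texp a N)^`() = (trunc a N)^`() * (texp a N - g N *: trunc a N ^+ N).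
  rewrite /texp [in RHS]big_ord_recr /= addrK raddf_sum big_ord_recl /= expr0 derivZ derivC scaler0 add0r.
  rewrite mulr_sumr; apply: eq_bigr => p _.
  rewrite derivZ deriv_exp_comm; last exact: trunc_comm.
  rewrite -scalerMnr scalerMnl gS.
  apply/polyP => l; rewrite coefZ !coefM mulr_sumr; apply: eq_bigr => i _.
  by rewrite coefZ /g -!scalerAl !mul1r scalerAr.
have := congr1 (fun p : {poly F} => p`_m) D.
rewrite coef_deriv coef_texp // => ->; rewrite coefM; apply: eq_bigr => -[l /= lm] _.
rewrite coef_deriv coef_poly ltnS lm /= coefB coefZ coef_lt_exp ?coef_poly ?ltnS ?leq_subr //.
by rewrite mulr0 subr0 coef_texp ?(leq_trans (leq_subr _ _)) // subSS mulrnAl.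
Qed.

End ExpCoef.

Lemma subDB (U : zmodType) (a b c : U) : a - b + c - a = c - b.
Proof. by rewrite addrAC (addrAC a) subrr add0r addrC. Qed.

Lemma addB_rearrange (U : zmodType) (a b c f g : U) :
  a - c + f - g = f - g + (a + b - c) - b.
Proof. by rewrite (addrAC a b) -[RHS]addrA addrK [RHS]addrC addrA. Qed.

(** * Logarithms of currents and their commutators *)

Section Logarithm.
Variables (K : numFieldType) (F : algType K).
Variable e : nat -> F.
Hypothesis e0 : e 0 = 1.

(** Solves Newton's identities m e_m = sum_(1 <= k <= m) k l_k e_(m-k) for l_m, using e_0 = 1. The
    list makes all earlier values available to a structural recursion; its entry 0 is a
    placeholder. *)
Fixpoint logs m : seq F :=
  if m is m'.+1 then
    rcons (logs m') ((m%:R^-1 : K) *: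
      (e m *+ m - \sum_(k < m') (logs m')`_k.+1 * e (m - k.+1) *+ k.+1))
  else [:: 0].

Definition logc m : F := (logs m)`_m.

Lemma size_logs m : size (logs m) = m.+1.
Proof. by elim: m => //= m IH; rewrite size_rcons IH. Qed.

Lemma nth_logs m k : (k <= m)%N -> (logs m)`_k = logc k.
Proof.
elim: m => [|m IH]; first by case: k.
rewrite leq_eqVlt => /orP[/eqP-> //|]; rewrite ltnS => km.
by rewrite /= nth_rcons size_logs ltnS km IH.
Qed.

Lemma logcS m : logc m.+1 = (m.+1%:R^-1 : K) *:
  (e m.+1 *+ m.+1 - \sum_(k < m) logc k.+1 * e (m.+1 - k.+1) *+ k.+1).
Proof.
rewrite [LHS]/logc /= nth_rcons size_logs ltnn eqxx; congr (_ *: (_ - _)).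
by apply: eq_bigr => k _; rewrite nth_logs.
Qed.

Lemma subalg_logc (Q : F -> Prop) : subalg Q -> (forall m, Q (e m)) ->
  forall m, Q (logc m).
Proof.
move=> QA Qe; elim/ltn_ind => -[_|m IH]; first exact: (subalg0 QA).
case: (QA) => _ _ QM QZ; rewrite logcS; apply: (QZ).
have Qn x n : Q x -> Q (x *+ n) by rewrite -scaler_nat; exact: QZ.
apply: subalgB => //; first exact: Qn.
by apply: subalg_sum => // k _; apply: Qn; apply: QM => //; apply: IH; rewrite ltnS.
Qed.

Hypothesis ec : forall k l, GRing.comm (e k) (e l).

Lemma logc_comm k l : GRing.comm (logc k) (logc l).
Proof.
apply: (subalg_logc (subalg_centralizer (logc k))) => m; apply: commr_sym.
by apply: (subalg_logc (subalg_centralizer (e m))) => m'; exact: ec.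
Qed.

Lemma logc_newton m : e m *+ m = \sum_(k < m) logc k.+1 * e (m - k.+1) *+ k.+1.
Proof.
case: m => [|m]; first by rewrite mulr0n big_ord0.
rewrite big_ord_recr /= subnn e0 mulr1 logcS scalerMnl -mulr_natr.
by rewrite mulVf ?pnatr_eq0 // scale1r addrC subrK.
Qed.

Lemma expCoef_logc m : expCoef logc m = e m.
Proof.
elim/ltn_ind: m => -[_|m IH]; first by rewrite expCoef0.
have : expCoef logc m.+1 *+ m.+1 = e m.+1 *+ m.+1.
  rewrite logc_newton expCoef_newton; last exact: logc_comm.
  by apply: eq_bigr => k _; rewrite IH // subSS ltnS leq_subr.
rewrite -!scaler_nat => /(congr1 ( *:%R (m.+1%:R^-1 : K))).
by rewrite !scalerA mulVf ?pnatr_eq0 // !scale1r.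
Qed.

(* If [e(z) (x(w) - b z x(w) w^-1) = (x(w) - a z x(w) w^-1) e(z)] for the
   current [x(w)], then the logarithm of [e] shifts [x]. *)
Lemma logc_commutator (x : int -> F) (al be : K) :
  (forall m r, e m.+1 * x r - be *: (e m * x (r + 1)) =
               x r * e m.+1 - al *: (x (r + 1) * e m)) ->
  forall m r, (logc m.+1 * x r - x r * logc m.+1) *+ m.+1 =
    (be ^+ m.+1 - al ^+ m.+1) *: x (r + m.+1%:Z).
Proof.
move=> ex; pose p k : K := be ^+ k - al ^+ k; pose B k := logc k *+ k.
have p0 : p 0%N = 0 by rewrite /p !expr0 subrr.
have xS r k : x (r + 1 + k%:Z) = x (r + k.+1%:Z).
  by rewrite -addrA -PoszD add1n.
(* The coefficient of z^m in (sum_k (be^k - al^k) x_(r+k) z^k) e(z). *)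
pose P m r := \sum_(k < m) p k.+1 *: (x (r + k.+1%:Z) * e (m - k.+1)).
have G m r : e m.+1 * x r - x r * e m.+1 = P m.+1 r - al *: P m (r + 1).
  elim: m r => [|m IH] r.
    rewrite /P big_ord1 big_ord0 scaler0 subr0 subnn e0 mulr1 /p !expr1.
    have := ex 0%N r; rewrite e0 mul1r mulr1 => /(canRL (subrK _)) ->.
    by rewrite subDB scalerBl.
  have -> : e m.+2 * x r = x r * e m.+2 - al *: (x (r + 1) * e m.+1) +
      be *: (e m.+1 * x (r + 1)) by apply: canRL (subrK _) (ex m.+1 r).
  have -> : e m.+1 * x (r + 1) =
      P m.+1 (r + 1) - al *: P m (r + 1 + 1) + x (r + 1) * e m.+1.
    by apply: canRL (subrK _) (IH (r + 1)).
  have -> : P m.+2 r = (be - al) *: (x (r + 1) * e m.+1) +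
      (be *: P m.+1 (r + 1) + al *: P m.+1 (r + 1) - be *: (al *: P m (r + 1 + 1))).
    rewrite /P [LHS]big_ord_recl subSS subn0 /=; congr (_ + _).
    have -> : \sum_(k < m) p k.+1 *: (x (r + 1 + 1 + k.+1%:Z) * e (m - k.+1)) =
        \sum_(k < m.+1) p k *: (x (r + 1 + k.+1%:Z) * e (m.+1 - k.+1)).
      rewrite [RHS]big_ord_recl /= p0 scale0r add0r.
      by apply: eq_bigr => k _; rewrite /bump /= add1n subSS xS.
    rewrite !scaler_sumr -big_split -sumrB /=; apply: eq_bigr => k _.
    rewrite /bump /= add1n subSS -xS !scalerA -scalerDl -scalerBl; congr (_ *: _).
    by rewrite /p !exprS; move: (be ^+ k) (al ^+ k) => u v; ring.
  by rewrite subDB scalerDr scalerBr scalerBl; exact: addB_rearrange.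
(* The coefficient of z^m in z l'(z) x_r e(z). Since z l'(z) e(z) = z e'(z), comparing it with x_r z
   e'(z) isolates the commutators of the k l_k with x_r, multiplied by e(z). *)
pose N m r := \sum_(k < m) B k.+1 * x r * e (m - k.+1).
have Be m : \sum_(k < m) B k.+1 * e (m - k.+1) = e m *+ m.
  by rewrite logc_newton; apply: eq_bigr => k _; rewrite mulrnAl.
have NE m r : N m r = x r * e m *+ m + P m r.
  elim: m r => [|m IH] r; first by rewrite /N /P !big_ord0 mulr0n addr0.
  have -> : N m.+1 r = e m.+1 *+ m.+1 * x r - be *: (e m *+ m * x (r + 1)) + al *: N m
    (r + 1).
    rewrite /N big_ord_recr /= subnn e0 mulr1.
    have -> : \sum_(k < m) B k.+1 * x r * e (m.+1 - k.+1) =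
        \sum_(k < m) B k.+1 * e (m.+1 - k.+1) * x r -
        be *: (\sum_(k < m) B k.+1 * e (m - k.+1) * x (r + 1)) +
        al *: (\sum_(k < m) B k.+1 * x (r + 1) * e (m - k.+1)).
      rewrite !scaler_sumr -sumrB -big_split /=; apply: eq_bigr => k _.
      rewrite subSS -(subnSK (ltn_ord k)) -!mulrA.
      have -> : x r * e (m - k.+1).+1 = e (m - k.+1).+1 * x r -
          be *: (e (m - k.+1) * x (r + 1)) + al *: (x (r + 1) * e (m - k.+1)).
        by apply: canRL (subrK _) _; rewrite ex.
      by rewrite mulrDr mulrBr -!scalerAr.
    rewrite -!mulr_suml Be.
    have -> : \sum_(k < m) B k.+1 * e (m.+1 - k.+1) = e m.+1 *+ m.+1 - B m.+1.
      by rewrite -Be [in RHS]big_ord_recr /= subnn e0 mulr1 addrK.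
    by rewrite mulrBl addrAC; congr (_ + _); rewrite addrAC subrK.
  have -> : P m.+1 r = e m.+1 * x r - x r * e m.+1 + al *: P m (r + 1).
    by apply: canRL (subrK _) _; rewrite G.
  rewrite IH !mulrnAl scalerDr.
  have exm : e m.+1 * x r *+ m - be *: (e m * x (r + 1) *+ m) =
      x r * e m.+1 *+ m - al *: (x (r + 1) * e m *+ m).
    by rewrite -!scalerMnr -!mulrnBl ex.
  have -> : e m.+1 * x r *+ m.+1 - be *: (e m * x (r + 1) *+ m) =
      e m.+1 * x r + (x r * e m.+1 *+ m - al *: (x (r + 1) * e m *+ m)).
    by rewrite mulrS -addrA exm.
  rewrite mulrS addrA -(addrA (e m.+1 * x r)) subrK [RHS]addrA; congr (_ + _).
  by rewrite [RHS]addrC addrA subrK.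
move=> m r.
have Z n : \sum_(k < n) (B k.+1 * x r - x r * B k.+1 - p k.+1 *: x (r + k.+1%:Z)) * e
  (n - k.+1) = 0.
  rewrite [LHS](_ : _ = N n r - x r * (\sum_(k < n) B k.+1 * e (n - k.+1)) - P n r).
    by rewrite NE Be mulrnAr addrAC addrK subrr.
  by rewrite mulr_sumr -!sumrB; apply: eq_bigr => k _; rewrite !mulrBl -scalerAl mulrA.
rewrite mulrnBl -mulrnAl -mulrnAr -/(B m.+1) -/(p m.+1); apply/eqP; rewrite -subr_eq0;
  apply/eqP.
(* As e_0 = 1, the system [Z] is triangular and its unknowns vanish one after another. *)
elim/ltn_ind: m => m IH; have := Z m.+1; rewrite big_ord_recr /= big1 ?add0r => [|k _].
  by rewrite subnn e0 mulr1.
by rewrite IH ?mul0r.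
Qed.

End Logarithm.

(** * Highest weight theory *)

Section Eigen.
Variables (K : closedFieldType) (n : nat).
Local Notation vec := 'cV[K]_n.+1.
Implicit Types (E : vec -> Prop) (A : 'M[K]_n.+1).

Lemma mx_eq_mulcol (A B : 'M[K]_n.+1) : (forall u : vec, A *m u = B *m u) -> A = B.
Proof.
move=> E; apply/matrixP => k l; have /matrixP/(_ k 0) := E (delta_mx l 0).
by rewrite -!colE !mxE.
Qed.

Definition subspace E : Prop :=
  [/\ E 0, forall u v, E u -> E v -> E (u + v) & forall c u, E u -> E (c *: u)].

Definition stable A E : Prop := forall u, E u -> E (A *m u).

Lemma subspaceB E u v : subspace E -> E u -> E v -> E (u - v).
Proof. by case=> _ ED EZ Eu Ev; rewrite -scaleN1r; apply: ED => //; apply: EZ. Qed.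

(** By Cayley-Hamilton a product of factors A - z kills [v]; when the factors are applied one by
    one, the last nonzero vector is an eigenvector, and it has not left [E]. *)
Lemma stable_eigenvector A E v : subspace E -> stable A E -> E v -> v != 0 ->
  exists c u, [/\ E u, u != 0 & A *m u = c *: u].
Proof.
move=> sE sA; have [rs chE] := closed_field_poly_normal (char_poly A).
rewrite (monicP (char_poly_monic A)) scale1r in chE.
have : horner_mx A (\prod_(z <- rs) ('X - z%:P)) *m v = 0.
  by rewrite -chE Cayley_Hamilton mul0mx.
elim: rs v {chE} => [|z rs IH] v.
  by rewrite big_nil rmorph1 mul1mx => -> _; rewrite eqxx.
rewrite big_cons mulrC rmorphM /= -mulmxE -mulmxA => Hv Ev v0.
have Az : horner_mx A ('X - z%:P) *m v = A *m v - z *: v.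
  by rewrite rmorphB /= horner_mx_X horner_mx_C mulmxBl mul_scalar_mx.
rewrite Az in Hv; have [|u0] := eqVneq (A *m v - z *: v) 0.
  by move/eqP; rewrite subr_eq0 => /eqP; exists z, v.
by apply: IH Hv _ u0; apply: subspaceB => //; [apply: sA | case: sE => _ _; apply].
Qed.

(** Induction on the list: [E] is cut down to an eigenspace of one operator, which the others
    preserve because they commute with it. *)
Lemma joint_eigenvector (I : eqType) (s : seq I) (A : I -> 'M[K]_n.+1) E v :
  subspace E -> (forall i, stable (A i) E) ->
  (forall i j, A i *m A j = A j *m A i) -> E v -> v != 0 ->
  exists (c : I -> K) u, [/\ E u, u != 0 & forall i, i \in s -> A i *m u = c i *: u].
Proof.
move=> + + AC; elim: s E v => [|i s IH] E v sE sA Ev v0.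
  by exists (fun=> 0), v.
have [ci [w [Ew w0 Aw]]] := stable_eigenvector sE (sA i) Ev v0.
have [||c [u [[Eu Au] u0 cu]]] := IH (fun u => E u /\ A i *m u = ci *: u) w _ _
  (conj Ew Aw) w0.
- case: sE => E0 ED EZ; split=> [|u u' [Eu Au] [Eu' Au']|c u [Eu Au]].
  + by rewrite mulmx0 scaler0.
  + by split; [exact: ED | rewrite mulmxDr Au Au' scalerDr].
  + by split; [exact: EZ | rewrite -scalemxAr Au !scalerA mulrC].
- move=> j u [Eu Au]; split; first exact: sA.
  by rewrite mulmxA AC -mulmxA Au scalemxAr.
exists (fun j => if j == i then ci else c j), u; split=> // j.
by rewrite inE; case: eqP => [-> //|_] /=; exact: cu.
Qed.

End Eigen.

Section Highest.
Variables (K : numClosedFieldType) (T : finType).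
Variables (C : T -> T -> int) (d : T -> nat) (q : K) (nu : {ffun T -> int}) (n : nat).
Local Notation vec := 'cV[K]_n.+1.
Local Notation qi := (qi d q).

(* Operators on K^(n+1) satisfying those relations of the shifted quantum
   affine algebra that the highest weight theory uses (not the quadratic
   Drinfeld relations nor the Serre relations). *)
Record operators := Operators {
  opX : bool -> T -> int -> 'M[K]_n.+1;
  opPhi : bool -> T -> int -> 'M[K]_n.+1;
  opPhiInv : bool -> T -> 'M[K]_n.+1;
  opH : T -> int -> 'M[K]_n.+1;
  opPhi_comm s t i j r m : opPhi s i r * opPhi t j m = opPhi t j m * opPhi s i r;
  opPhi_invl s i : opPhiInv s i * opPhi s i (lead nu s i) = 1;
  opPhi_vanish s i m : (0 < m)%N -> opPhi s i (lead nu s i - sg s * m%:Z) = 0;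
  opPhi_exp s i m : (0 < m)%N -> opPhi s i (lead nu s i + sg s * m%:Z) =
    opPhi s i (lead nu s i) *
    expCoef (fun k => ((sg s)%:~R * (qi i - (qi i)^-1)) *: opH i (sg s * k%:Z)) m;
  opH0 i : opH i 0 = 0;
  opPhi_X s t i j r : opPhi s i (lead nu s i) * opX t j r =
    (qi i ^ (sg s * sg t * C i j)) *: (opX t j r * opPhi s i (lead nu s i));
  opH_X t i j m r : m != 0 -> opH i m * opX t j r - opX t j r * opH i m =
    ((sg t)%:~R * (m%:~R)^-1 * qint (qi i) (m * C i j)) *: opX t j (m + r);
  opX_X i j r s : (qi i - (qi i)^-1) *:
    (opX true i r * opX false j s - opX false j s * opX true i r) =
    if i == j then opPhi true i (r + s) - opPhi false j (r + s) else 0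
}.

(* The last condition says that the weights met along a string of raising or
   lowering operators are distinct. *)
Definition generic : Prop :=
  (forall i, qi i - (qi i)^-1 != 0) /\
  (forall w : seq T, w != [::] -> exists j, \prod_(k <- w) qi j ^ C j k != 1).

Variable V : operators.
Local Notation X := (opX V).
Local Notation P := (opPhi V).
Local Notation Pi := (opPhiInv V).
Local Notation H := (opH V).
Local Notation L s i := (P s i (lead nu s i)).

Definition irreducible_ops : Prop := forall E : vec -> Prop, subspace E ->
  (forall s i r, stable (X s i r) E) -> (forall s i r, stable (P s i r) E) ->
  (forall s i, stable (Pi s i) E) -> (forall i r, stable (H i r) E) ->
  (forall v, E v -> v = 0) \/ (forall v, E v).

Hypothesis q_generic : generic.

Let qi_gen := q_generic.1.
Let q_gen := q_generic.2.

Lemma mulAv (A B : 'M[K]_n.+1) (v : vec) : (A * B) *m v = A *m (B *m v).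
Proof. by rewrite -mulmxE mulmxA. Qed.

Lemma qi_neq0 i : qi i != 0.
Proof. by apply: contraNneq (qi_gen i) => ->; rewrite invr0 subr0. Qed.

Lemma opPhi_unit s i : L s i \is a GRing.unit.
Proof.
apply/unitrP; exists (Pi s i); split; first exact: opPhi_invl.
by have := opPhi_invl V s i; rewrite -!mulmxE => /mulmx1C.
Qed.

Lemma opPhiInv_def s i : Pi s i = (L s i)^-1.
Proof. by rewrite -[LHS]mulr1 -(divrr (opPhi_unit s i)) mulrA opPhi_invl mul1r. Qed.

Lemma opPhi_invr s i : L s i * Pi s i = 1.
Proof. by rewrite opPhiInv_def divrr ?opPhi_unit. Qed.

(** Each phi is zero or a leading coefficient times a polynomial in the h's, so properties closed
    under the algebra operations can be tested on these. *)
Lemma subalg_opPhi (Q : 'M[K]_n.+1 -> Prop) : subalg Q ->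
  (forall s i, Q (L s i)) -> (forall i m, Q (H i m)) -> forall s i r, Q (P s i r).
Proof.
move=> QA QL QH s i r.
have [k ->] : exists k : int, r = lead nu s i + sg s * k.
  by exists (sg s * (r - lead nu s i)); rewrite mulrA [sg s * sg s](_ : _ = 1);
    [rewrite mul1r addrC subrK | case: s].
case: k => [[|k]|k]; first by rewrite mulr0 addr0.
  rewrite opPhi_exp //; case: (QA) => _ _ QM QZ; apply: QM => //.
  by apply: subalg_expCoef => // l _; apply: QZ.
by rewrite NegzE mulrN opPhi_vanish //; exact: (subalg0 QA).
Qed.

(* The h's are polynomials in the phi's. *)
Lemma opH_opPhi i m t j r : GRing.comm (P t j r) (H i m).
Proof.
pose Q y := GRing.comm (P t j r) y; have QA : subalg Q := subalg_centralizer _.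
have QPi s k : Q (Pi s k) by rewrite opPhiInv_def; apply: commrV; exact: opPhi_comm.
have QH s k : (0 < k)%N -> Q (H i (sg s * k%:Z)).
  pose c : K := (sg s)%:~R * (qi i - (qi i)^-1).
  have c0 : c != 0 by rewrite mulf_neq0 // intr_eq0; case: (s).
  have QcH k' : (0 < k')%N -> Q (c *: H i (sg s * k'%:Z)).
    move: k'; apply: (subalg_expCoef_inv QA) => k0 k00; case: (QA) => _ _ QM _.
    rewrite -[expCoef _ _]mul1r -(opPhi_invl V s i) -mulrA -opPhi_exp //.
    by apply: (QM _ _ (QPi _ _)); exact: opPhi_comm.
  move=> k0; case: (QA) => _ _ _ QZ.
  by have := QZ c^-1 _ (QcH k k0); rewrite scalerA mulVf // scale1r.
case: m => [[|m]|m]; first by rewrite opH0; exact: (subalg0 QA).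
  by have := QH true m.+1 isT; rewrite mul1r.
by have := QH false m.+1 isT; rewrite mulN1r -NegzE.
Qed.

Definition singular (v : vec) : Prop := forall i r, X true i r *m v = 0.

Lemma singular_subspace : subspace singular.
Proof.
split=> [|u v su sv|c u su] i r; first by rewrite mulmx0.
  by rewrite mulmxDr su sv addr0.
by rewrite -scalemxAr su scaler0.
Qed.

Lemma opL_X s t i j r :
  X t j r * L s i = (qi i ^ (- (sg s * sg t * C i j))) *: (L s i * X t j r).
Proof. by rewrite opPhi_X scalerA -expfzDr ?qi_neq0 // addNr expr0z scale1r. Qed.

Lemma singular_opL s i : stable (L s i) singular.
Proof. by move=> v sv j r; rewrite -mulAv opL_X -scalemxAl mulAv sv mulmx0 scaler0. Qed.

(** The constant is uniform in [r], which lets h pass through a whole current and through its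
    shifts. *)
Lemma opH_Xr t i j m : exists c : K, forall r : int,
  H i m * X t j r = X t j r * H i m + c *: X t j (m + r).
Proof.
have [->|m0] := eqVneq m 0; first by exists 0 => r'; rewrite opH0 mul0r mulr0 scale0r addr0.
exists ((sg t)%:~R * (m%:~R)^-1 * qint (qi i) (m * C i j)) => r'.
by rewrite -opH_X // addrC subrK.
Qed.


Lemma eigenvalue_root (A : 'M[K]_n.+1) (c : K) (u : vec) :
  u != 0 -> A *m u = c *: u -> root (char_poly A) c.
Proof.
move=> u0 Au; have : horner_mx A (char_poly A) *m u = (char_poly A).[c] *: u.
  move: (char_poly A); elim/poly_ind => [|p a IH].
    by rewrite rmorph0 mul0mx horner0 scale0r.
  rewrite rmorphD rmorphM /= horner_mx_X horner_mx_C hornerMXaddC mulmxDl mul_scalar_mx.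
  by rewrite mulAv Au -scalemxAr IH scalerA scalerDl mulrC.
rewrite Cayley_Hamilton mul0mx => /esym/eqP.
by rewrite scaler_eq0 (negPf u0) orbF.
Qed.

(** Without a singular vector in [E], raising operators could be applied forever to a joint
    eigenvector of the phi_(i,0)^+. By genericity the weights met would be pairwise distinct, while
    the coordinates of a weight are roots of finitely many characteristic polynomials. *)
Lemma singular_vector (E : vec -> Prop) v : subspace E ->
  (forall i r, stable (X true i r) E) -> (forall i, stable (L true i) E) ->
  E v -> v != 0 -> exists u, [/\ E u, u != 0 & singular u].
Proof.
move=> sE sX sL Ev v0; apply: contrapT => Nsing.
have NZ u : E u -> u != 0 -> exists i r, X true i r *m u != 0.
  move=> Eu u0; apply: contrapT => N; apply: Nsing; exists u; split=> // i r.
  by apply: contrapT => /eqP N'; apply: N; exists i, r.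
have LC i j : L true i *m L true j = L true j *m L true i by rewrite !mulmxE opPhi_comm.
have [c [u0 [Eu0 u00 cu0]]] := joint_eigenvector (enum T) sE sL LC Ev v0.
(* [g] is the current weight and [s] lists the earlier ones; each of them differs from [g] by the
   factor of a word [w] of simple roots. *)
have chain l : exists (s : seq {ffun T -> K}) (g : {ffun T -> K}) u,
    [/\ size s = l, uniq (g :: s), E u & u != 0] /\
    (forall j, L true j *m u = g j *: u) /\
    forall g', g' \in g :: s -> (forall j, root (char_poly (L true j)) (g' j)) /\
      exists w, forall j, g j = g' j * \prod_(k <- w) qi j ^ C j k.
  elim: l => [|l [s [g [u [[sl us Eu u_neq0] [gu gs]]]]]].
    have cu j : L true j *m u0 = [ffun j => c j] j *: u0 by rewrite ffunE cu0 ?mem_enum.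
    exists [::], [ffun j => c j], u0; split=> //; split=> // g'.
    rewrite inE => /eqP ->; split=> [j|]; first exact: eigenvalue_root u00 (cu j).
    by exists [::] => j; rewrite big_nil mulr1.
  have [i [r Xu]] := NZ u Eu u_neq0.
  pose h := [ffun j => g j * qi j ^ C j i].
  have hu j : L true j *m (X true i r *m u) = h j *: (X true i r *m u).
    rewrite -mulAv opPhi_X -scalemxAl mulAv gu -scalemxAr scalerA ffunE.
    by rewrite /= !mul1r mulrC.
  have hs g' : g' \in g :: s -> exists w, w != [::] /\
      forall j, h j = g' j * \prod_(k <- w) qi j ^ C j k.
    move=> /gs[_ [w gw]]; exists (i :: w); split=> // j.
    by rewrite big_cons ffunE gw -mulrA [_ ^ _ * _]mulrC.
  have h_neq0 j : h j != 0.
    apply: contraNneq Xu => h0; have := hu j; rewrite h0 scale0r => E0.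
    by rewrite -[X true i r *m u](@mul1mx K) -[1%:M](opPhi_invl V true j) mulAv E0 mulmx0.
  exists (g :: s), h, (X true i r *m u); split; [split|] => //=.
  - by rewrite sl.
  - rewrite -[(g \notin s) && _]/(uniq (g :: s)) us andbT; apply/negP => /hs[w [w0 hw]].
    have [j /eqP] := q_gen w0; apply.
    by apply: (mulfI (h_neq0 j)); rewrite mulr1 -hw.
  - exact: sX.
  - split=> // g'; rewrite inE => /orP[/eqP->|g's].
      split=> [j|]; first exact: eigenvalue_root Xu (hu j).
      by exists [::] => j; rewrite big_nil mulr1.
    by split; [case: (gs g' g's) | have [w [_ hw]] := hs g' g's; exists w].
pose rs j := sval (closed_field_poly_normal (char_poly (L true j))).
have rsP j z : root (char_poly (L true j)) z -> z \in rs j.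
  rewrite /rs; case: closed_field_poly_normal => r /= chE; rewrite {1}chE.
  by rewrite (monicP (char_poly_monic _)) scale1r root_prod_XsubC.
pose N := (\max_j size (rs j))%N.
(* A weight is encoded by the positions of its coordinates in the lists of roots, which leaves
   finitely many codes. *)
pose F (g : {ffun T -> K}) : {ffun T -> 'I_N.+1} := [ffun j => inord (index (g j) (rs j))].
have [s [g [u [[sl us _ _] [_ gs]]]]] := chain #|{ffun T -> 'I_N.+1}|.
have Finj : {in g :: s &, injective F}.
  move=> g1 g2 /gs[r1 _] /gs[r2 _] /ffunP eF; apply/ffunP => j.
  have sz z : z \in rs j -> (index z (rs j) < N.+1)%N.
    by rewrite -index_mem ltnS => /ltnW h; apply: leq_trans h _; exact: leq_bigmax.
  have := eF j; rewrite !ffunE => /(congr1 val); rewrite /= !inordK;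
    try exact: sz (rsP _ _ _).
  move=> E'; rewrite -(nth_index 0 (rsP _ _ (r1 j))) E' nth_index //; exact: rsP.
have := max_card (mem (map F (g :: s))).
by rewrite (card_uniqP _) ?map_inj_in_uniq // size_map /= sl ltnn.
Qed.

End Highest.

(** * The relation that rescales the lowering currents *)

Section Lowering.
Variables (K : numClosedFieldType) (T : finType).
Variables (C : T -> T -> int) (d : T -> nat) (q : K) (nu : {ffun T -> int}) (n : nat).
Variable V : operators C d q nu n.
Local Notation vec := 'cV[K]_n.+1.
Local Notation qi := (qi d q).
Local Notation X := (opX V).
Local Notation P := (opPhi V).
Local Notation Pi := (opPhiInv V).
Local Notation H := (opH V).
Local Notation L s i := (P s i (lead nu s i)).
Local Notation singular := (singular V).
Hypothesis q_generic : generic C d q.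

Definition qcommutes (A : 'M[K]_n.+1) : Prop := forall s j,
  exists c : K, forall r, A * X s j r = c *: (X s j r * A).

Lemma qcommutes_opL s i : qcommutes (L s i).
Proof. by move=> t j; eexists => r; exact: opPhi_X. Qed.

Lemma qcommutes_opPhiInv s i : qcommutes (Pi s i).
Proof.
move=> t j; exists (qi i ^ (- (sg s * sg t * C i j))) => r.
rewrite -[LHS]mulr1 -(opPhi_invr V s i) -mulrA (mulrA (X t j r)) (opL_X V q_generic).
by rewrite -scalerAl -scalerAr 2!mulrA opPhi_invl mul1r.
Qed.

Section Relation.
Variables (a b : T -> K) (E : vec -> Prop).

Definition shiftX s i r : 'M[K]_n.+1 := a i *: X s i r + b i *: X s i (r + 1).

(* The graph of the linear map that is the identity on E and multiplies each
   lowering current x_i^-(w) by a_i + b_i w^-1. *)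
Inductive lowrel : vec -> vec -> Prop :=
| LowBase v : E v -> lowrel v v
| LowAdd u t u' t' : lowrel u t -> lowrel u' t' -> lowrel (u + u') (t + t')
| LowScale c u t : lowrel u t -> lowrel (c *: u) (c *: t)
| LowX i r u t : lowrel u t -> lowrel (X false i r *m u) (shiftX false i r *m t).

(** What a starting space must satisfy for words on it to be stable under raising: singularity
    settles the empty word, and stability under the Cartan part absorbs the commutators. *)
Definition cartan_stable : Prop :=
  [/\ subspace E, forall v, E v -> singular v, forall s i, stable (L s i) E,
      forall s i, stable (Pi s i) E & forall i m, stable (H i m) E].

Hypothesis cE : cartan_stable.

Definition lowrel_stable (A : 'M[K]_n.+1) : Prop :=
  forall u t, lowrel u t -> lowrel (A *m u) (A *m t).

Lemma lowrel0 : lowrel 0 0.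
Proof. by case: cE => -[E0 _ _] _ _ _ _; apply: LowBase. Qed.

Lemma subalg_lowrel : subalg lowrel_stable.
Proof.
split=> [u t ut|A B hA hB u t ut|A B hA hB u t ut|c A hA u t ut].
- by rewrite !mul1mx.
- by rewrite !mulmxDl; apply: LowAdd; [exact: hA | exact: hB].
- by rewrite !mulAv; apply/hA/hB.
- by rewrite -!scalemxAl; apply: LowScale; exact: hA.
Qed.

(** The same c, c' and m serve for r and r + 1, so the commutation rule passes to [shiftX false j r]
    and both components of a pair move alike. *)
Lemma lowrel_commutator (A : 'M[K]_n.+1) : stable A E ->
  (forall j, exists (c c' : K) m, forall r,
     A * X false j r = c *: (X false j r * A) + c' *: X false j (m + r)) ->
  lowrel_stable A.
Proof.
move=> sA hA u t; elim=> {u t} [v Ev|u t u' t' _ h _ h'|c u t _ h|j r u t ut h].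
- by apply: LowBase; exact: sA.
- by rewrite !mulmxDr; exact: LowAdd.
- by rewrite -!scalemxAr; exact: LowScale.
have [c [c' [m E']]] := hA j.
have -> : A *m (X false j r *m u) =
    c *: (X false j r *m (A *m u)) + c' *: (X false j (m + r) *m u).
  by rewrite -!mulAv E' mulmxDl -!scalemxAl.
have -> : A *m (shiftX false j r *m t) =
    c *: (shiftX false j r *m (A *m t)) + c' *: (shiftX false j (m + r) *m t).
  rewrite -!mulAv !scalemxAl -mulmxDl; congr (_ *m _).
  rewrite -[in RHS]scalemxAl mulmxE /shiftX mulrDr -!scalerAr !E' mulrDl -!scalerAl.
  rewrite !scalerDr !scalerA !(mulrC c) !(mulrC c') addrACA.
  by have -> : m + (r + 1) = m + r + 1 by rewrite addrA.
by apply: LowAdd; apply: LowScale; apply: LowX.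
Qed.

Lemma lowrel_qcommutes A : qcommutes A -> stable A E -> lowrel_stable A.
Proof.
move=> hA sA; apply: lowrel_commutator => // j; have [c hc] := hA false j.
by exists c, 0, 0 => r; rewrite hc scale0r addr0.
Qed.

Lemma lowrel_opH i m : lowrel_stable (H i m).
Proof.
case: cE => _ _ _ _ sH; apply: lowrel_commutator => // j.
by have [c hc] := opH_Xr V false i j m; exists 1, c, m => r; rewrite hc scale1r.
Qed.

Lemma lowrel_opPhi s i r : lowrel_stable (P s i r).
Proof.
case: cE => _ _ sL _ _; apply: subalg_opPhi; [exact: subalg_lowrel | | exact: lowrel_opH].
by move=> s' i'; apply: lowrel_qcommutes; [exact: qcommutes_opL | exact: sL].
Qed.

Definition opK i j m : 'M[K]_n.+1 :=
  if i == j then (qi i - (qi i)^-1)^-1 *: (P true i m - P false j m) else 0.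

Lemma opX_XE i j r s :
  X true i r * X false j s = X false j s * X true i r + opK i j (r + s).
Proof.
apply/eqP; rewrite addrC -subr_eq; apply/eqP.
apply: (scalerI (q_generic.1 i)); rewrite opX_X /opK.
by case: eqP => [->|_]; rewrite ?scaler0 // scalerA mulfV ?scale1r // q_generic.1.
Qed.

Lemma lowrel_raise i r u t : lowrel u t ->
  lowrel (shiftX true i r *m u) (X true i r *m t).
Proof.
move=> ut; elim: ut i r => {u t} [v Ev|u t u' t' _ h _ h'|c u t _ h|j s u t ut h] i r.
- case: cE => _ sing _ _ _; rewrite /shiftX mulmxDl -!scalemxAl !(sing v Ev).
  by rewrite !scaler0 addr0; exact: lowrel0.
- by rewrite !mulmxDr; apply: LowAdd.
- by rewrite -!scalemxAr; apply: LowScale.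
(* The Cartan term of both commutators. The shift sits on the raising operator for [u] and on the
   lowering one for [t]; the terms agree because they see only r + s and vanish unless i = j. *)
pose D := a j *: opK i j (r + s) + b j *: opK i j (r + s + 1).
have -> : shiftX true i r *m (X false j s *m u) =
    X false j s *m (shiftX true i r *m u) + D *m u.
  rewrite -!mulAv -mulmxDl; congr (_ *m _); rewrite /shiftX mulrDl -!scalerAl.
  rewrite !opX_XE !scalerDr mulrDr -!scalerAr addrACA; congr (_ + _).
  rewrite /D -addrA [1 + s]addrC addrA /opK.
  by case: eqP => [-> //|_]; rewrite !scaler0.
have -> : X true i r *m (shiftX false j s *m t) =
    shiftX false j s *m (X true i r *m t) + D *m t.
  rewrite -!mulAv -mulmxDl; congr (_ *m _); rewrite /shiftX mulrDr -!scalerAr.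
  rewrite !opX_XE !scalerDr mulrDl -!scalerAl addrACA /D.
  by have -> : r + (s + 1) = r + s + 1 by rewrite addrA.
apply: LowAdd; first by apply: LowX.
have QA := subalg_lowrel; suff QD : lowrel_stable D by exact: QD.
have QK m : lowrel_stable (opK i j m).
  rewrite /opK; case: ifP => _; last exact: (subalg0 QA).
  by case: (QA) => _ _ _ QZ; apply: QZ; apply: (subalgB QA); exact: lowrel_opPhi.
by case: (QA) => _ QD _ QZ; apply: (QD); exact: QZ.
Qed.

End Relation.

Lemma lowrel_sub a b (E F : vec -> Prop) u t : subspace F ->
  (forall i r, stable (X false i r) F) -> (forall v, E v -> F v) ->
  lowrel a b E u t -> F u.
Proof.
by case=> _ FD FZ sX EF; elim=> {u t} [v /EF|u t u' t' _ h _ h'|c u t _ h|j r u t _ h] //;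
  [exact: FD | exact: FZ | exact: sX].
Qed.

Hypothesis irr : irreducible_ops V.

(** For a = 1 and b = 0 there is no shift, and the domain of the relation is the span of the words
    on [E]: a nonzero subspace stable under all the operators, hence everything by
    irreducibility. *)
Lemma lowrel_full (E : vec -> Prop) v : cartan_stable E -> E v -> v != 0 ->
  forall u, exists t, lowrel (fun=> 1) (fun=> 0) E u t.
Proof.
move=> cE Ev v0.
have [|||||Z|] // := irr (E := fun u => exists t, lowrel (fun=> 1) (fun=> 0) E u t).
- split=> [|u u' [t ut] [t' ut']|c u [t ut]].
  + by exists 0; exact: lowrel0.
  + by exists (t + t'); exact: LowAdd.
  + by exists (c *: t); exact: LowScale.
- move=> [] i r u [t ut]; last by exists (shiftX (fun=> 1) (fun=> 0) false i r *m t);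
  exact: LowX.
  exists (X true i r *m t); have := lowrel_raise cE i r ut.
  by rewrite {1}/shiftX scale1r scale0r addr0.
- by move=> s i r u [t ut]; exists (P s i r *m t); exact: lowrel_opPhi.
- move=> s i u [t ut]; exists (Pi s i *m t); apply: lowrel_qcommutes ut.
    exact: qcommutes_opPhiInv.
  by case: cE.
- by move=> i r u [t ut]; exists (H i r *m t); exact: lowrel_opH.
by move: v0; rewrite (Z v) ?eqxx //; exists v; exact: LowBase.
Qed.

End Lowering.

(** * The top weight space, and why the relation is a function *)

Section Top.
Variables (K : numClosedFieldType) (T : finType).
Variables (C : T -> T -> int) (d : T -> nat) (q : K) (nu : {ffun T -> int}) (n : nat).
Variable V : operators C d q nu n.
Local Notation vec := 'cV[K]_n.+1.
Local Notation qi := (qi d q).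
Local Notation X := (opX V).
Local Notation P := (opPhi V).
Local Notation Pi := (opPhiInv V).
Local Notation H := (opH V).
Local Notation L s i := (P s i (lead nu s i)).
Local Notation singular := (singular V).
Hypothesis q_generic : generic C d q.
Hypothesis irr : irreducible_ops V.

(** Only the leading coefficients, of both signs, are required to be scalars; the other Cartan
    operators preserve this space. *)
Definition top (g : bool -> T -> K) (v : vec) : Prop :=
  singular v /\ forall s i, L s i *m v = g s i *: v.

Lemma singular_opPhiInv s i : stable (Pi s i) singular.
Proof.
move=> v sv j r; rewrite -[LHS]mul1mx -[1%:M](opPhi_invl V s i) mulAv -(mulAv
  (L s i)) opPhi_X.
by rewrite -scalemxAl mulAv -(mulAv (L s i)) opPhi_invr mul1mx sv scaler0 mulmx0.
Qed.

Lemma top_exists : exists g v, top g v /\ v != 0.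
Proof.
have F0 : (const_mx 1 : vec) != 0.
  by apply/eqP => /matrixP/(_ 0 0); rewrite !mxE => /eqP; rewrite oner_eq0.
have [||||u [_ u0 su]] := singular_vector q_generic (E := fun=> True)
  (V := V) _ _ _ _ F0 => //.
have sL (p : bool * T) : stable (L p.1 p.2) singular by exact: singular_opL.
have LC (p p' : bool * T) : L p.1 p.2 *m L p'.1 p'.2 = L p'.1 p'.2 *m L p.1 p.2.
  by rewrite !mulmxE opPhi_comm.
have [g [v [sv v0 gv]]] := joint_eigenvector (enum {: bool * T})
  (singular_subspace V) sL LC su u0.
exists (fun s i => g (s, i)), v; split=> //; split=> // s i.
by rewrite (gv (s, i)) ?mem_enum.
Qed.

Variable g : bool -> T -> K.

Lemma singular_opH i m : stable (H i m) singular.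
Proof.
move=> v sv j r; have [c hc] := opH_Xr V true i j m.
have := congr1 (fun A => A *m v) (hc r); rewrite mulmxDl !mulAv -scalemxAl !sv.
by rewrite mulmx0 scaler0 addr0.
Qed.

Lemma top_cartan : cartan_stable V (top g).
Proof.
split.
- split=> [|u v [su gu] [sv gv]|c u [su gu]].
  + by split=> [i r|s i]; rewrite !mulmx0 ?scaler0.
  + case: (singular_subspace V) => _ SD _; split; first exact: SD.
    by move=> s i; rewrite mulmxDr gu gv scalerDr.
  + case: (singular_subspace V) => _ _ SZ; split; first exact: SZ.
    by move=> s i; rewrite -scalemxAr gu !scalerA mulrC.
- by move=> v [].
- move=> s i v [sv gv]; split; first exact: singular_opL.
  by move=> s' i'; rewrite -mulAv opPhi_comm mulAv gv -scalemxAr.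
- move=> s i v [sv gv]; split; first exact: singular_opPhiInv.
  have PC t j : GRing.comm (L t j) (Pi s i).
    by rewrite opPhiInv_def; apply: commrV; exact: opPhi_comm.
  by move=> t j; rewrite -mulAv PC mulAv gv -scalemxAr.
move=> i m v [sv gv]; split; first exact: singular_opH.
by move=> s j; rewrite -mulAv opH_opPhi // mulAv gv -scalemxAr.
Qed.

(** The sum of the images of all lowering operators; [u] is an arbitrary vector. *)
Inductive lowered : vec -> Prop :=
| Lowered0 : lowered 0
| LoweredX i r u m : lowered m -> lowered (X false i r *m u + m).

Lemma lowered_subspace : subspace lowered.
Proof.
split=> [|u v + hv|c u]; first exact: Lowered0.
  by elim=> [|i r w m _ IH]; [rewrite add0r | rewrite -addrA; exact: LoweredX].
elim=> [|i r w m _ IH]; first by rewrite scaler0; exact: Lowered0.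
by rewrite scalerDr scalemxAr; exact: LoweredX.
Qed.

Lemma lowered_X i r u : lowered (X false i r *m u).
Proof. by rewrite -[X in lowered X]addr0; apply: LoweredX; exact: Lowered0. Qed.

Lemma lowered_commutator (A : 'M[K]_n.+1) :
  (forall j r, exists (c c' : K) m,
     A * X false j r = c *: (X false j r * A) + c' *: X false j m) ->
  stable A lowered.
Proof.
have [L0 LD LZ] := lowered_subspace.
move=> hA u; elim=> [|j r w m _ IH]; first by rewrite mulmx0.
rewrite mulmxDr; apply: (LD) => //; have [c [c' [l E]]] := hA j r.
by rewrite -mulAv E mulmxDl -!scalemxAl mulAv; apply: (LD); apply: (LZ); exact: lowered_X.
Qed.

Lemma lowered_qcommutes A : qcommutes V A -> stable A lowered.
Proof.
move=> hA; apply: lowered_commutator => j r; have [c hc] := hA false j.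
by exists c, 0, 0; rewrite hc scale0r addr0.
Qed.

Lemma lowered_opH i m : stable (H i m) lowered.
Proof.
apply: lowered_commutator => j r; have [c hc] := opH_Xr V false i j m.
by exists 1, c, (m + r); rewrite hc scale1r.
Qed.

Fixpoint lowword (w : seq (T * int)) : 'M[K]_n.+1 :=
  if w is p :: w' then X false p.1 p.2 * lowword w' else 1.

Lemma lowrel_words a b (E : vec -> Prop) u t : subspace E -> lowrel V a b E u t ->
  exists s : seq (seq (T * int) * vec), (forall p, p \in s -> E p.2) /\
    u = \sum_(p <- s) lowword p.1 *m p.2.
Proof.
case=> _ _ EZ; elim=> {u t} [v Ev|u t u' t' _ [s [sE ->]] _ [s' [sE' ->]]
  |c u t _ [s [sE ->]]|i r u t _ [s [sE ->]]].
- exists [:: ([::], v)]; split=> [p|]; first by rewrite inE => /eqP->.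
  by rewrite big_seq1 mul1mx.
- exists (s ++ s'); split=> [p|]; last by rewrite big_cat.
  by rewrite mem_cat => /orP[/sE|/sE'].
- exists [seq (p.1, c *: p.2) | p <- s]; split=> [p /mapP[p' /sE Ep ->]|]; first exact: EZ.
  by rewrite big_map scaler_sumr; apply: eq_bigr => p _; rewrite scalemxAr.
exists [seq ((i, r) :: p.1, p.2) | p <- s]; split=> [p /mapP[p' /sE Ep ->]|] //.
by rewrite big_map mulmx_sumr; apply: eq_bigr => p _; rewrite mulAv.
Qed.

Lemma lowword_eigenvector (A : 'M[K]_n.+1) (c : T -> K) (g0 : K) (v : vec) w :
  (forall j r, A * X false j r = c j *: (X false j r * A)) -> A *m v = g0 *: v ->
  A *m (lowword w *m v) = (g0 * \prod_(p <- w) c p.1) *: (lowword w *m v).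
Proof.
move=> hA Av; elim: w => [|p w IH]; first by rewrite big_nil mulr1 mul1mx.
rewrite big_cons /= mulAv -mulAv hA -scalemxAl mulAv IH -scalemxAr scalerA.
by rewrite mulrCA mulrA.
Qed.

Lemma top_eigenvalue_neq0 v s i : top g v -> v != 0 -> g s i != 0.
Proof.
move=> [_ gv] v0; apply: contraNneq v0 => g0; have := gv s i; rewrite g0 scale0r => E.
by rewrite -[v](@mul1mx K) -[1%:M](opPhi_invl V s i) mulAv E mulmx0.
Qed.

(* [A] separates [m] from the top weight space; such operators commute, hence
   they can be multiplied. *)
Definition separated (m : vec) : Prop := exists (A : 'M[K]_n.+1) (c : K),
  [/\ forall B, (forall j, GRing.comm (L true j) B) -> GRing.comm A B,
      forall j, GRing.comm (L true j) A, c != 0,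
      forall v, top g v -> A *m v = c *: v & A *m m = 0].

Lemma separatedD m m' : separated m -> separated m' -> separated (m + m').
Proof.
move=> [A [c [A1 A2 c0 At Am]]] [A' [c' [A1' A2' c0' At' Am']]].
exists (A * A'), (c * c'); split.
- by move=> B hB; rewrite /GRing.comm -mulrA (A1' B hB) mulrA (A1 B hB) mulrA.
- by move=> j; rewrite /GRing.comm mulrA A2 -mulrA A2' mulrA.
- by rewrite mulf_neq0.
- by move=> v tv; rewrite mulAv At' // -scalemxAr At // scalerA mulrC.
by rewrite mulmxDr [X in _ + X]mulAv Am' mulmx0 addr0 (A1 A' A2') mulAv Am mulmx0.
Qed.

(** On a top vector a nonempty word multiplies the eigenvalue of phi_(j,0)^+ by a product of
    q_j^(-C_jk), which genericity makes different from 1 for some j. Subtracting the eigenvalue of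
    the word from phi_(j,0)^+ separates. *)
Lemma separated_word w v : w != [::] -> top g v -> separated (lowword w *m v).
Proof.
move=> w0 tv; have [v0|v0] := eqVneq v 0.
  rewrite v0 mulmx0; exists 1, 1; split=> [B _|j||u _|]; rewrite ?oner_neq0 ?mulmx0 //.
  - exact: commr_sym (commr1 _).
  - exact: commr1.
  - by rewrite scale1r mul1mx.
have [|j cj] := q_generic.2 (map fst w); first by case: (w) w0.
pose ev := g true j * \prod_(p <- w) qi j ^ (sg true * sg false * C j p.1).
have hev : g true j - ev != 0.
  rewrite subr_eq0 -[g true j]mulr1 /ev -subr_eq0 -mulrBr mulf_neq0 ?(top_eigenvalue_neq0 _ _ tv) //.
  rewrite subr_eq0; apply: contraNneq cj => E;
    rewrite big_map -[X in _ == X]invr1 [in X in _ == X]E.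
  rewrite -prodfV; apply/eqP; apply: eq_bigr => p _.
  by rewrite mul1r mulN1r -invr_expz invrK.
have AC B : GRing.comm (L true j) B -> GRing.comm (L true j - ev *: 1) B.
  by move=> hB; rewrite /GRing.comm mulrBl mulrBr hB -scalerAl -scalerAr mul1r mulr1.
exists (L true j - ev *: 1), (g true j - ev); split=> //.
- by move=> B hB; apply: AC.
- by move=> j'; apply/commr_sym/AC; exact: opPhi_comm.
- by move=> u [_ gu]; rewrite mulmxBl -scalemxAl mul1mx gu scalerBl.
rewrite mulmxBl -scalemxAl mul1mx.
rewrite (@lowword_eigenvector _ (fun k => qi j ^ (sg true * sg false * C j k))
  (g true j)) ?subrr //.
- by move=> k r; exact: opPhi_X.
- by case: tv.
Qed.

(** The arguments of the lowering operators are themselves sums of words on the top, so a lowered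
    vector is a sum of nonempty words. *)
Lemma lowered_separated m : (exists2 v, top g v & v != 0) -> lowered m -> separated m.
Proof.
case=> v0 tv0 v0_neq0; have S0 : separated 0.
  exists 1, 1; split=> [B _|j||u _|]; rewrite ?oner_neq0 ?mulmx0 //.
  - exact: commr_sym (commr1 _).
  - exact: commr1.
  - by rewrite scale1r mul1mx.
elim=> // i r u {}m _ IH; apply: separatedD => //.
have [t ut] := lowrel_full q_generic irr top_cartan tv0 v0_neq0 u.
have [s [sE ->]] := lowrel_words (let: And5 a _ _ _ _ := top_cartan in a) ut.
rewrite mulmx_sumr big_seq; elim/big_rec: _ => // p w ps IHw.
by apply: separatedD => //; rewrite -mulAv; apply: (@separated_word ((i, r) :: p.1)) => //;
  exact: sE.
Qed.

Hypothesis top_neq0 : exists2 v, top g v & v != 0.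

Lemma top_lowered v : top g v -> lowered v -> v = 0.
Proof.
move=> tv /(lowered_separated top_neq0) [A [c [_ _ c0 At Av]]].
by have /eqP := At v tv; rewrite Av eq_sym scaler_eq0 (negPf c0) => /eqP.
Qed.

(** A nonzero vector of this kind would generate all of W by lowering operators alone, without
    leaving the lowered vectors, and the top would be lowered too. *)
Lemma singular_lowered v : singular v -> lowered v -> v = 0.
Proof.
move=> sv lv; apply: contrapT => /eqP v0; have [v1 tv1 /eqP v1_neq0] := top_neq0.
pose E u := singular u /\ lowered u; have [S0 SD SZ] := singular_subspace V.
have [M0 MD MZ] := lowered_subspace.
have cE : cartan_stable V E.
  split; first by split=> [|u u' [su lu] [su' lu']|c u [su lu]]; split; auto.
  - by move=> u [].
  - move=> s i u [su lu]; split; first exact: singular_opL.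
    by apply: lowered_qcommutes => //; exact: qcommutes_opL.
  - move=> s i u [su lu]; split; first exact: singular_opPhiInv.
    by apply: lowered_qcommutes => //; exact: qcommutes_opPhiInv.
  - by move=> i m u [su lu]; split; [exact: singular_opH | exact: lowered_opH].
apply: v1_neq0; apply: top_lowered => //.
have [t v1t] := lowrel_full q_generic irr cE (conj sv lv) v0 v1.
apply: (lowrel_sub lowered_subspace _ _ v1t) => [i r u _|u []] //.
exact: lowered_X.
Qed.

(** The rescaling affects only words with at least one letter, so both components have the same top
    part. *)
Lemma lowrel_decomp a b u t : lowrel V a b (top g) u t ->
  exists v, [/\ top g v, lowered (u - v) & lowered (t - v)].
Proof.
have [E _ _ _ _] := top_cartan; have [E0 ED EZ] := E.
have [M0 MD MZ] := lowered_subspace.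
elim=> {u t} [v tv|u t u' t' _ [v [tv lu lt]] _ [v' [tv' lu' lt']]|c u t _ [v [tv lu lt]]
  |i r u t _ _].
- by exists v; rewrite subrr.
- by exists (v + v'); rewrite !opprD (addrACA u) (addrACA t); split;
  [exact: ED | exact: MD | exact: MD].
- by exists (c *: v); rewrite -!scalerBr; split; [exact: EZ | exact: MZ | exact: MZ].
exists 0; rewrite !subr0 /shiftX mulmxDl -!scalemxAl.
by split=> //; [exact: lowered_X | apply: (MD); apply: (MZ); exact: lowered_X].
Qed.

Lemma lowrel_uniq0 a b t : lowrel V a b (top g) 0 t -> t = 0.
Proof.
move=> t0; apply: contrapT => /eqP t_neq0.
(* The top part shared with 0 is both top and lowered, hence zero. *)
have E0 u : lowrel V a b (top g) 0 u -> lowered u.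
  move=> /lowrel_decomp[v [tv]]; rewrite sub0r => lv.
  suff -> : v = 0 by rewrite subr0.
  apply: top_lowered => //; have [_ _ MZ] := lowered_subspace.
  by rewrite -[v]opprK -scaleN1r; exact: MZ.
have tc := top_cartan.
have [|||u [Eu u0 su]] := singular_vector q_generic (E := lowrel V a b (top g) 0)
  (V := V) _ _ _ t0 t_neq0.
- split=> [|u u' hu hu'|c u hu]; first exact: lowrel0 tc.
    by rewrite -[X in lowrel _ _ _ _ X](addr0 0); exact: LowAdd.
  by rewrite -[X in lowrel _ _ _ _ X](scaler0 _ c); exact: LowScale.
- by move=> i r u hu; have := lowrel_raise q_generic tc i r hu; rewrite mulmx0.
- by move=> i u hu; have := lowrel_opPhi tc true i 0 hu; rewrite mulmx0.
by move/eqP: u0; apply; apply: singular_lowered su (E0 _ Eu).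
Qed.

Lemma lowrel_uniq a b u t t' :
  lowrel V a b (top g) u t -> lowrel V a b (top g) u t' -> t = t'.
Proof.
move=> ut ut'; apply/eqP; rewrite -subr_eq0; apply/eqP; apply: (@lowrel_uniq0 a b).
rewrite -(subrr u) -[- u]scaleN1r -[- t']scaleN1r.
by apply: LowAdd => //; exact: LowScale.
Qed.


End Top.

(** * Intertwiners and the new Cartan currents *)

Section PolynomialMatrices.
Variable K : numFieldType.

(** In characteristic 0 the natural numbers already give more roots than the degree allows. *)
Lemma poly_eq_horner (p r : {poly K}) : (forall z, p.[z] = r.[z]) -> p = r.
Proof.
move=> E; apply/eqP; rewrite -subr_eq0; apply: contraT => pr0.
have := max_poly_roots pr0 (rs := [seq k%:R | k <- iota 0 (size (p - r))]).
rewrite size_map size_iota ltnn => -> //.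
  by apply/allP => z _; rewrite /root hornerD hornerN E subrr.
by rewrite map_inj_uniq ?iota_uniq // => k l /eqP; rewrite eqr_nat => /eqP.
Qed.

Lemma mx_eq_horner m n (A B : 'M[{poly K}]_(m, n)) :
  (forall z, map_mx (horner_eval z) A = map_mx (horner_eval z) B) -> A = B.
Proof.
move=> E; apply/matrixP => i j; apply: poly_eq_horner => z.
by have /matrixP/(_ i j) := E z; rewrite !mxE.
Qed.

Lemma map_mx_hornerC m n (A : 'M[K]_(m, n)) z :
  map_mx (horner_eval z) (map_mx polyC A) = A.
Proof. by apply/matrixP => i j; rewrite !mxE /horner_eval hornerC. Qed.

Lemma scale_mxI m n (p : {poly K}) : p != 0 -> injective
  (fun A : 'M[{poly K}]_(m, n) => p *: A).
Proof.
move=> p0 A B /matrixP E; apply/matrixP => i j; have := E i j.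
by rewrite !mxE => /(mulfI p0).
Qed.

End PolynomialMatrices.

Section Intertwiner.
Variables (K : numClosedFieldType) (T : finType).
Variables (C : T -> T -> int) (d : T -> nat) (q : K) (nu : {ffun T -> int}) (n : nat).
Variable V : operators C d q nu n.
Local Notation vec := 'cV[K]_n.+1.
Local Notation X := (opX V).
Local Notation mp := (map_mx (@polyC K)).
Local Notation ev z := (map_mx (horner_eval z)).
Hypothesis q_generic : generic C d q.
Hypothesis irr : irreducible_ops V.
Variable g : bool -> T -> K.
Hypothesis top_neq0 : exists2 v, top V g v & v != 0.

Lemma lowrel_top u : exists t, lowrel V (fun=> 1) (fun=> 0) (top V g) u t.
Proof.
by have [v tv v0] := top_neq0; exact: (lowrel_full q_generic irr
  (top_cartan V q_generic g) tv v0).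
Qed.

(** Induction over words: later claims about all of W are reduced by it to the top and to one
    lowering operator. *)
Lemma lowering_ind (F : vec -> Prop) : subspace F -> (forall v, top V g v -> F v) ->
  (forall i r, stable (X false i r) F) -> forall u, F u.
Proof. by move=> sF tF XF u; have [t ut] := lowrel_top u;
  exact: lowrel_sub sF XF tF ut. Qed.

(** A derivation of the unshifted relation has finitely many steps; replayed with factors polynomial
    in z, it keeps [u] and makes the second component polynomial in z. *)
Lemma lowrel_poly (a b : T -> {poly K}) (E : vec -> Prop) u t :
  lowrel V (fun=> 1) (fun=> 0) E u t -> exists tp : 'cV[{poly K}]_n.+1, forall z,
    lowrel V (fun i => (a i).[z]) (fun i => (b i).[z]) E u (ev z tp).
Proof.
elim=> {u t} [v Ev|u t u' t' _ [p h] _ [p' h']|c u t _ [p h]|i r u t _ [p h]].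
- by exists (mp v) => z; rewrite map_mx_hornerC; exact: LowBase.
- by exists (p + p') => z; rewrite map_mxD; exact: LowAdd.
- by exists (c%:P *: p) => z; rewrite map_mxZ /= [horner_eval z _]hornerC; exact: LowScale.
exists ((a i *: mp (X false i r) + b i *: mp (X false i (r + 1))) *m p) => z.
by rewrite map_mxM map_mxD !map_mxZ !map_mx_hornerC; exact: LowX.
Qed.

(** The columns of [A] are polynomial images of the basis vectors. At each value of z the two sides
    of an identity are images of the same vector, hence equal by [lowrel_uniq]; equality at all
    values gives equality of polynomials. *)
Lemma intertwiner (a b : T -> {poly K}) :
  let sX s i r := a i *: mp (X s i r) + b i *: mp (X s i (r + 1)) in
  exists A : 'M[{poly K}]_n.+1,
  [/\ forall v, top V g v -> A *m mp v = mp v,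
      forall i r, A *m mp (X false i r) = sX false i r *m A &
      forall i r, A *m sX true i r = mp (X true i r) *m A].
Proof.
move=> sX; have tc := top_cartan V q_generic g.
have rel u : exists tp : 'cV[{poly K}]_n.+1, forall z,
    lowrel V (fun i => (a i).[z]) (fun i => (b i).[z]) (top V g) u (ev z tp).
  by have [t ut] := lowrel_top u; exact: lowrel_poly ut.
have [t tP] := choice (fun k : 'I_n.+1 => rel (delta_mx k 0)).
pose A : 'M[{poly K}]_n.+1 := \matrix_(k, l) t l k 0.
have AP u z : lowrel V (fun i => (a i).[z]) (fun i => (b i).[z]) (top V g) u (ev z A *m u).
  have -> : ev z A *m u = \sum_k u k 0 *: ev z (t k).
    apply/matrixP => k l; rewrite !mxE summxE; apply: eq_bigr => m _.
    by rewrite !mxE ord1 mulrC.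
  rewrite {1}[u](_ : _ = \sum_k u k 0 *: delta_mx k 0); last first.
    by rewrite {1}[u]matrix_sum_delta; apply: eq_bigr => k _; rewrite big_ord1.
  elim/big_rec2: _ => [|k x y _ h]; first exact: lowrel0 tc.
  by apply: LowAdd => //; apply: LowScale.
have uniq u t1 t2 z := lowrel_uniq q_generic irr top_neq0 (a := fun i => (a i).[z])
  (b := fun i => (b i).[z]) (u := u) (t := t1) (t' := t2).
have evX s i r z : ev z (sX s i r) = shiftX V (fun i => (a i).[z]) (fun i =>
  (b i).[z]) s i r.
  by rewrite /sX map_mxD !map_mxZ !map_mx_hornerC.
exists A; split=> [v tv|i r|i r]; apply: mx_eq_horner => z;
  rewrite !map_mxM !map_mx_hornerC.
- by apply: uniq (AP _ _) _; exact: LowBase.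
- apply: mx_eq_mulcol => u; rewrite -!mulmxA evX.
  by apply: uniq (AP _ _) _; apply: LowX; exact: AP.
- apply: mx_eq_mulcol => u; rewrite -!mulmxA evX.
  by apply: uniq (AP _ _) _; apply: (lowrel_raise q_generic tc); exact: AP.
Qed.

(* The quotient of two intertwiners, made polynomial by the adjugate. *)
Lemma transfer (al be ga : T -> K) :
  exists (F : 'M[{poly K}]_n.+1) (f : {poly K}),
  [/\ f`_0 != 0, forall v, top V g v -> F *m mp v = f *: mp v,
      forall i r, F *m (mp (X false i r) - (be i *: 'X) *: mp (X false i (r + 1))) =
        (ga i)%:P *: (mp (X false i r) - (al i *: 'X) *: mp (X false i (r + 1))) *m F &
      forall i r, F *m ((ga i)%:P *: (mp (X true i r) - (al i *: 'X) *: mp (X true i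
        (r + 1)))) =
        (mp (X true i r) - (be i *: 'X) *: mp (X true i (r + 1))) *m F].
Proof.
(* The factors are ga (1 - al z u^-1) for [N] and 1 - be z u^-1 for [D]. *)
have [N [Nt Nm Np]] := intertwiner (fun i => (ga i)%:P) (fun i => - ((ga i * al i) *: 'X)).
have [D [Dt Dm Dp]] := intertwiner (fun=> 1) (fun i => - (be i *: 'X)).
pose f := \det D; pose y s i r := mp (X s i r) - (be i *: 'X) *: mp (X s i (r + 1)).
have {}Dm i r : D *m mp (X false i r) = y false i r *m D.
  by rewrite Dm scale1r scaleNr.
have {}Dp i r : D *m y true i r = mp (X true i r) *m D.
  by rewrite -Dp scale1r scaleNr.
have f0 : f`_0 != 0.
  suff -> : f`_0 = 1 by rewrite oner_neq0.
  rewrite -horner_coef0 -[f.[0]]/(horner_eval 0 f) -det_map_mx.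
  (* At z = 0 the factors of [D] are all 1, so nothing is rescaled. *)
  suff -> : ev 0 D = 1%:M by rewrite det1.
  apply: mx_eq_mulcol => u; rewrite mul1mx; move: u.
  apply: lowering_ind => [|v tv|i r u Du].
  - split=> [|u v Du Dv|c u Du]; first by rewrite mulmx0.
      by rewrite mulmxDr Du Dv.
    by rewrite -scalemxAr Du.
  - by have := congr1 (ev 0) (Dt v tv); rewrite map_mxM !map_mx_hornerC.
  - have := congr1 (ev 0) (Dm i r); rewrite !map_mxM map_mxB map_mxZ !map_mx_hornerC.
    have e0 : horner_eval 0 (be i *: 'X) = 0 by rewrite /horner_eval hornerZ hornerX mulr0.
    rewrite /= e0 scale0r subr0 => E.
    by rewrite mulmxA E -mulmxA Du.
have fn0 : f != 0 by apply: contraNneq f0 => ->; rewrite coef0.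
(* Multiplying D x = y D by the adjugate on both sides gives [f] times the claim, and [f]
   cancels. *)
have Am i r : \adj D *m y false i r = mp (X false i r) *m \adj D.
  apply: (scale_mxI fn0); rewrite /= -mul_mx_scalar -mul_mx_adj mulmxA -(mulmxA (\adj D)).
  by rewrite -Dm !mulmxA mul_adj_mx !mul_scalar_mx -scalemxAl.
have Ap i r : \adj D *m mp (X true i r) = y true i r *m \adj D.
  apply: (scale_mxI fn0); rewrite /= -mul_mx_scalar -mul_mx_adj mulmxA -(mulmxA (\adj D)).
  by rewrite -Dp !mulmxA mul_adj_mx !mul_scalar_mx -scalemxAl.
have shN s i r : (ga i)%:P *: mp (X s i r) + (- ((ga i * al i) *: 'X)) *: mp (X s i
  (r + 1)) =
    (ga i)%:P *: (mp (X s i r) - (al i *: 'X) *: mp (X s i (r + 1))).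
  by rewrite scalerBr scalerA scaleNr -!mul_polyC polyCM mulrA.
exists (N *m \adj D), f; split=> //.
- move=> v tv; have : \adj D *m (D *m mp v) = f *: mp v.
    by rewrite mulmxA mul_adj_mx mul_scalar_mx.
  by rewrite Dt // -mulmxA => ->; rewrite -scalemxAr Nt.
- move=> i r; rewrite -/(y false i r) -mulmxA Am mulmxA Nm shN.
  by rewrite mulmxA.
move=> i r; rewrite -mulmxA.
have -> : \adj D *m ((ga i)%:P *: (mp (X true i r) - (al i *: 'X) *: mp (X true i
  (r + 1)))) =
  ((ga i)%:P *: (y true i r - (al i *: 'X) *: y true i (r + 1))) *m \adj D.
  rewrite -scalemxAr mulmxBr -scalemxAr !Ap -[RHS]scalemxAl.
  by congr (_ *: _); rewrite [RHS]mulmxBl -scalemxAl.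
rewrite !mulmxA; congr (_ *m _).
(* The two shifts act on the index of the same current and so commute. *)
have -> : (ga i)%:P *: (y true i r - (al i *: 'X) *: y true i (r + 1)) =
  (ga i)%:P *: (mp (X true i r) - (al i *: 'X) *: mp (X true i (r + 1))) -
  (be i *: 'X) *: ((ga i)%:P *: (mp (X true i (r + 1)) - (al i *: 'X) *: mp (X true i
    (r + 1 + 1)))).
  by apply/matrixP => k l; rewrite !mxE -!mul_polyC; ring.
by rewrite mulmxBr -shN Np -scalemxAr -shN Np mulmxBl -scalemxAl.
Qed.

End Intertwiner.

Section HalfCurrents.
Variables (K : numFieldType) (F : unitAlgType K).

Lemma expCoef_ext (a b : nat -> F) m :
  (forall k, (0 < k)%N -> a k = b k) -> expCoef a m = expCoef b m.
Proof.
move=> ab; apply: eq_bigr => p _; congr (_ *: (polyseq (_ ^+ _))`_m).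
by apply/polyP => k; rewrite !coef_poly; case: ifP => // _; case: eqP => // /eqP;
  rewrite -lt0n => /ab.
Qed.

(* Coefficientwise form of
   [F(z) (1 - e z w^-1) x(w) = e (1 - e^-1 z w^-1) x(w) F(z)]. *)
Definition half_current (Phi : nat -> F) (x : int -> F) (e : K) : Prop :=
  (forall r, Phi 0%N * x r = e *: (x r * Phi 0%N)) /\
  forall m r, Phi m.+1 * x r - e *: (Phi m * x (r + 1)) =
    e *: (x r * Phi m.+1 - e^-1 *: (x (r + 1) * Phi m)).

(** Dividing by Phi_0 on the left absorbs the factor e and leaves the hypothesis of
    [logc_commutator] with be = e and al = e^-1. *)
Lemma half_current_log (Phi : nat -> F) : Phi 0%N \is a GRing.unit ->
  (forall k l, GRing.comm (Phi k) (Phi l)) ->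
  exists l : nat -> F, (forall m, Phi m = Phi 0%N * expCoef l m) /\
    forall x e, e != 0 -> half_current Phi x e -> forall m r,
      (l m.+1 * x r - x r * l m.+1) *+ m.+1 =
      (e ^+ m.+1 - e^-1 ^+ m.+1) *: x (r + m.+1%:Z).
Proof.
move=> Phi0 PhiC; pose a m := (Phi 0%N)^-1 * Phi m.
have a0 : a 0%N = 1 by rewrite /a mulVr.
have VC k : GRing.comm (Phi 0%N)^-1 (Phi k).
  by apply/commr_sym/commrV; exact: PhiC.
have aC k l : GRing.comm (a k) (a l).
  by apply/commr_sym; apply: commrM; apply/commr_sym; apply: commrM;
    [exact: commr_refl | exact: VC | apply/commr_sym; exact: VC | exact: PhiC].
exists (logc a); split=> [m|x e e_neq0 [x0 xS]];
  first by rewrite (expCoef_logc a0 aC) mulVKr.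
apply: (logc_commutator a0) => m r.
have E r' y : (Phi 0%N)^-1 * (e *: (x r' * y)) = x r' * ((Phi 0%N)^-1 * y).
  by apply: (mulrI Phi0); rewrite mulVKr // [RHS]mulrA x0 -scalerAl -!mulrA mulVKr.
have := congr1 (fun y => (Phi 0%N)^-1 * y) (xS m r).
rewrite scalerBr !mulrBr E (scalerA e) mulrC -scalerA -[in RHS]scalerAr E.
by rewrite -scalerAr !mulrA.
Qed.

End HalfCurrents.

(** * Commutation tested on the top weight space *)

Section Transfer.
Variables (K : numClosedFieldType) (T : finType).
Variables (C : T -> T -> int) (d : T -> nat) (q : K) (nu : {ffun T -> int}) (n : nat).
Variable V : operators C d q nu n.
Local Notation vec := 'cV[K]_n.+1.
Local Notation X := (opX V).
Local Notation P := (opPhi V).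
Local Notation H := (opH V).
Local Notation L s i := (P s i (lead nu s i)).
Local Notation mp := (map_mx (@polyC K)).
Hypothesis q_generic : generic C d q.
Hypothesis irr : irreducible_ops V.
Variable g : bool -> T -> K.
Hypothesis top_neq0 : exists2 v, top V g v & v != 0.

Let lowering_ind := lowering_ind q_generic irr top_neq0.

(** Coefficients, shifts and indices do not depend on [r]. The coefficients of a polynomial current
    have this form, and so have a leading coefficient alone and an h_m together with 1. *)
Definition shift_family (I : Type) (A : I -> 'M[K]_n.+1) : Prop :=
  forall l j, exists s : seq (K * int * I), forall r, A l * X false j r =
    \sum_(p <- s) p.1.1 *: (X false j (r + p.1.2) * A p.2).

(** Moving both operators past a lowering one yields the same double sum in either order, up to
    commuting other members of the families; hence the induction treats all pairs of indices at
    once. *)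
Lemma shift_family_comm (I I' : Type) (A : I -> 'M[K]_n.+1) (B : I' -> 'M[K]_n.+1) :
  shift_family A -> shift_family B ->
  (forall l l' v, top V g v -> A l *m (B l' *m v) = B l' *m (A l *m v)) ->
  forall l l', A l * B l' = B l' * A l.
Proof.
move=> sA sB AB l l'; apply: mx_eq_mulcol => u; rewrite !mulAv.
move: u l l'; apply: lowering_ind => [|v tv l l'|j r u AB' l l']; last 2 first.
- exact: AB.
- have [sa ha] := sA l j; have [sb hb] := sB l' j.
  have step (I0 I1 : Type) (A0 : I0 -> 'M[K]_n.+1) (B1 : 'M[K]_n.+1) l0 s0 s1
    (l1 : I1 -> 'M[K]_n.+1) :
      (forall r, A0 l0 * X false j r = \sum_(p <- s0) p.1.1 *: (X false j
        (r + p.1.2) * A0 p.2)) ->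
      (forall r, B1 * X false j r = \sum_(p <- s1) p.1.1 *: (X false j
        (r + p.1.2) * l1 p.2)) ->
      A0 l0 *m (B1 *m (X false j r *m u)) = \sum_(p <- s1) \sum_(p' <- s0)
        (p.1.1 * p'.1.1) *: (X false j (r + p.1.2 + p'.1.2) *m (A0 p'.2 *m (l1 p.2 *m u))).
    move=> h0 h1; rewrite -(mulAv B1) h1 mulmx_suml mulmx_sumr; apply: eq_bigr => p _.
    rewrite -scalemxAl -scalemxAr mulAv -(mulAv (A0 l0)) h0 mulmx_suml scaler_sumr.
    by apply: eq_bigr => p' _; rewrite -scalemxAl scalerA mulAv.
  rewrite (step _ _ _ _ _ _ _ _ ha hb) (step _ _ _ _ _ _ _ _ hb ha) exchange_big /=.
  apply: eq_bigr => p _; apply: eq_bigr => p' _; rewrite mulrC AB'.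
  by rewrite -!addrA [p'.1.2 + _]addrC.
split=> [l l'|u v hu hv l l'|c u hu l l']; first by rewrite !mulmx0.
  by rewrite !mulmxDr hu hv.
by rewrite -!scalemxAr hu.
Qed.

End Transfer.

(** * The Cartan current of a node outside [J] *)

Section CartanCurrent.
Variables (K : numClosedFieldType) (T : finType).
Variables (C : T -> T -> int) (d : T -> nat) (q : K) (nu : {ffun T -> int}) (n : nat).
Variable V : operators C d q nu n.
Local Notation vec := 'cV[K]_n.+1.
Local Notation X := (opX V).
Local Notation mp := (map_mx (@polyC K)).
Hypothesis q_generic : generic C d q.
Hypothesis irr : irreducible_ops V.
Variable g : bool -> T -> K.
Hypothesis top_neq0 : exists2 v, top V g v & v != 0.
Variables (p : K) (c : T -> int).
Hypotheses (p_neq0 : p != 0) (p_gen : p - p^-1 != 0).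

Let lowering_ind := lowering_ind q_generic irr top_neq0.

(** The image contains the top, where [A] is a nonzero scalar, and is stable under lowering; so [A]
    is onto. *)
Lemma qcommutes_unit (A : 'M[K]_n.+1) (ka : T -> K) (f : K) : f != 0 ->
  (forall j, ka j != 0) ->
  (forall j r, A * X false j r = ka j *: (X false j r * A)) ->
  (forall v, top V g v -> A *m v = f *: v) -> A \is a GRing.unit.
Proof.
move=> f0 ka0 AX At.
have im : forall u : vec, exists u', A *m u' = u.
  apply: lowering_ind => [|v tv|j r u [u' <-]].
  - split=> [|u v [u' <-] [v' <-]|a u [u' <-]].
    + by exists 0; rewrite mulmx0.
    + by exists (u' + v'); rewrite mulmxDr.
    + by exists (a *: u'); rewrite -scalemxAr.
  - exists (f^-1 *: v); have [_ _ tZ] : subspace (top V g) by case: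
    (top_cartan V q_generic g).
    by rewrite At ?scalerA ?mulfV ?scale1r //; exact: tZ.
  exists ((ka j)^-1 *: (X false j r *m u')).
  by rewrite -scalemxAr -!mulAv AX -scalemxAl scalerA mulVf ?scale1r.
have [b bP] := choice (fun k : 'I_n.+1 => im (delta_mx k 0)).
have : A *m (\matrix_(k, l) b l k 0) = 1%:M.
  apply/matrixP => k l; have /matrixP/(_ k 0) := bP l; rewrite !mxE !andbT => <-.
  by apply: eq_bigr => m _; rewrite !mxE.
by move=> /mulmx1_unit[].
Qed.

(* The currents phi^+ = phi^- of a node outside J, given by one Laurent
   polynomial of degree mu. *)
Definition cartan_current (mu : nat) (Phi H' : int -> 'M[K]_n.+1) : Prop :=
  let cl (s : bool) : int := if s then 0 else mu%:Z in
  [/\ [/\ forall s m, (0 < m)%N -> Phi (cl s - sg s * m%:Z) = 0,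
          forall s, Phi (cl s) \is a GRing.unit,
          forall s m, (0 < m)%N -> Phi (cl s + sg s * m%:Z) = Phi (cl s) *
            expCoef (fun k => ((sg s)%:~R * (p - p^-1)) *: H' (sg s * k%:Z)) m &
          H' 0 = 0],
      forall s t j r, Phi (cl s) * X t j r =
        (p ^ (sg s * sg t * c j)) *: (X t j r * Phi (cl s)),
      forall t j m r, m != 0 -> H' m * X t j r - X t j r * H' m =
        ((sg t)%:~R * (m%:~R)^-1 * qint p (m * c j)) *: X t j (m + r),
      forall r, exists f : K, forall v, top V g v -> Phi r *m v = f *: v &
      shift_family V Phi].

Local Notation cf m := (map_mx (fun r : {poly K} => r`_m)).

Lemma cf_mulr m k l k' (A : 'M[{poly K}]_(k, l)) (B : 'M[K]_(l, k')) :
  cf m (A *m mp B) = cf m A *m B.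
Proof.
by apply/matrixP => i j; rewrite !mxE coef_sum; apply: eq_bigr => h _; rewrite !mxE coefMC.
Qed.

Lemma cf_mull m k l k' (A : 'M[K]_(k', k)) (B : 'M[{poly K}]_(k, l)) :
  cf m (mp A *m B) = A *m cf m B.
Proof.
by apply/matrixP => i j; rewrite !mxE coef_sum; apply: eq_bigr => h _; rewrite !mxE coefCM.
Qed.

Lemma cfB m k l (A B : 'M[{poly K}]_(k, l)) : cf m (A - B) = cf m A - cf m B.
Proof. by apply/matrixP => i j; rewrite !mxE coefB. Qed.

Lemma cfZ m k l a (A : 'M[{poly K}]_(k, l)) : cf m (a%:P *: A) = a *: cf m A.
Proof. by apply/matrixP => i j; rewrite !mxE coefCM. Qed.

Lemma cfX m k l a (A : 'M[{poly K}]_(k, l)) :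
  cf m ((a *: 'X) *: A) = if m is m'.+1 then a *: cf m' A else 0.
Proof.
by apply/matrixP => i j; rewrite !mxE -scalerAl coefZ coefXM; case: m => [|m];
  rewrite ?mulr0 !mxE.
Qed.

Lemma cf_current (F : 'M[{poly K}]_n.+1) (al be ga : K) (x : int -> 'M[K]_n.+1) m r :
  F *m (mp (x r) - (be *: 'X) *: mp (x (r + 1))) =
    ga%:P *: (mp (x r) - (al *: 'X) *: mp (x (r + 1))) *m F ->
  cf m F * x r - be *: (if m is m'.+1 then cf m' F * x (r + 1) else 0) =
  ga *: (x r * cf m F - al *: (if m is m'.+1 then x (r + 1) * cf m' F else 0)).
Proof.
move=> /(congr1 (cf m)); rewrite mulmxBr -scalemxAr cfB cf_mulr cfX -scalemxAl cfZ.
rewrite mulmxBl cfB cf_mull -scalemxAl cfX.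
by case: m => [|m]; rewrite ?scaler0 // cf_mulr cf_mull.
Qed.

Lemma cartan_currentP : exists mu Phi H', cartan_current mu Phi H'.
Proof.
pose e t j : K := p ^ (sg t * c j).
have e_neq0 t j : e t j != 0 by rewrite expfz_neq0.
(* With these values ga (1 - al z u^-1) = p^(-c_j) - z u^-1 and 1 - be z u^-1 = 1 - p^(-c_j) z
   u^-1. *)
have [F [f [f0 Ft Fm Fp]]] := transfer q_generic irr top_neq0
  (fun j => p ^ (c j)) (fun j => p ^ (- c j)) (fun j => p ^ (- c j)).
pose Phi m := cf m F.
have PhiX t j : half_current Phi (X t j) (e t j).
  have Ft' r : F *m (mp (X t j r) - ((e t j) *: 'X) *: mp (X t j (r + 1))) =
      (e t j)%:P *: (mp (X t j r) - ((e t j)^-1 *: 'X) *: mp (X t j (r + 1))) *m F.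
    rewrite /e invr_expz; case: (t); last by rewrite mulN1r opprK Fm.
    rewrite mul1r -[RHS]scalemxAl -Fp.
    rewrite -scalemxAr scalerA -polyCM -expfzDr // subrr.
    by rewrite expr0z scale1r.
  split=> [r|m r]; last exact: cf_current (Ft' r).
  by have := cf_current 0 (Ft' r); rewrite !scaler0 !subr0.
have Phit m v : top V g v -> Phi m *m v = f`_m *: v.
  move=> /Ft /(congr1 (cf m)); rewrite cf_mulr => ->.
  by apply/matrixP => i j; rewrite !mxE coefMC.
pose mu := (size f).-1.
have fmu : f`_mu != 0.
  by rewrite -/(lead_coef f) lead_coef_eq0; apply: contraNneq f0 => ->; rewrite coef0.
(* Descent from a bound on the degrees of the entries: if Phi_(m+1) = 0, then Phi_m commutes with
   lowering operators up to scalars, and it kills the top because f_m = 0. *)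
have Phi_mu m : (mu < m)%N -> Phi m = 0.
  pose N := (\max_(kl : 'I_n.+1 * 'I_n.+1) size (F kl.1 kl.2))%N.
  have PhiN k : (N <= k)%N -> Phi k = 0.
    move=> Nk; apply/matrixP => i j; rewrite !mxE nth_default //.
    by apply: leq_trans Nk; exact: (leq_bigmax (i, j)).
  have [k Nk] : exists k, (N <= m + k)%N by exists N; exact: leq_addl.
  elim: k m Nk => [|k IH] m Nk mum; first by apply: PhiN; rewrite -[m]addn0.
  have Phi1 : Phi m.+1 = 0 by apply: IH; rewrite ?addSnnS // ltnW.
  have PX j r : Phi m * X false j r = (e false j)^-1 *: (X false j r * Phi m).
    have [_ /(_ m (r - 1))] := PhiX false j; rewrite Phi1 subrK mul0r mulr0 !sub0r.
    rewrite scalerN scalerA mulfV // scale1r => /oppr_inj <-.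
    by rewrite scalerA mulVf // scale1r.
  apply: mx_eq_mulcol => u; rewrite mul0mx; move: u.
  apply: lowering_ind => [|v tv|j r u hu].
  - split=> [|u v hu hv|a u hu]; first exact: mulmx0.
      by rewrite mulmxDr hu hv addr0.
    by rewrite -scalemxAr hu scaler0.
  - by rewrite Phit // nth_default ?scale0r // -(prednK
    (n := size f)) // lt0n size_poly_eq0 -lead_coef_eq0.
  by rewrite -mulAv PX -scalemxAl mulAv hu mulmx0 scaler0.
have Phi_shift : shift_family V Phi.
  move=> m j; have [P0 PS] := PhiX false j; elim: m => [|m [s IH]].
    by exists [:: (e false j, 0, 0%N)] => r; rewrite big_seq1 addr0 P0.
  exists [:: (e false j, 0, m.+1), (-1, 1, m) &
      [seq (e false j * h.1.1, 1 + h.1.2, h.2) | h <- s]] => r.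
  rewrite !big_cons big_map /= addr0 scaleN1r addrA.
  have := PS m r; rewrite scalerBr scalerA mulfV // scale1r => <-;
    rewrite -[LHS](subrK (e false j *: (Phi m * X false j (r + 1)))).
  congr (_ + _); rewrite IH scaler_sumr; apply: eq_bigr => h _.
  by rewrite scalerA addrA.
have PhiC k l : GRing.comm (Phi k) (Phi l).
  apply: (shift_family_comm q_generic irr top_neq0 Phi_shift Phi_shift) => k' l' v tv.
  by rewrite !(Phit _ v tv) -!scalemxAr !(Phit _ v tv) !scalerA mulrC.
(* The polynomial read from its top degree, for the expansion at infinity. Reversing the index of x
   and inverting e preserves the form of the relation. *)
pose Psi m := if (m <= mu)%N then Phi (mu - m)%N else 0.
have PsiX t j : half_current Psi (fun r => X t j (- r)) (e t j)^-1.
  have [P0 PS] := PhiX t j.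
  have PS' m r : Phi m * X t j r - (e t j)^-1 *: (Phi m.+1 * X t j (r - 1)) =
      (e t j)^-1 *: (X t j r * Phi m - e t j *: (X t j (r - 1) * Phi m.+1)).
    have := PS m (r - 1); rewrite subrK => /(congr1 ( *:%R (- (e t j)^-1))).
    rewrite !scalerBr !scalerA !mulNr !mulVf // !scaleNr !scale1r opprK addrC => ->.
    by rewrite mul1r opprK addrC.
  split=> [r|m r]; rewrite /Psi.
    have := PS' mu (- r); rewrite (Phi_mu mu.+1) // mul0r mulr0 !scaler0 !subr0.
    by rewrite leq0n subn0.
  rewrite opprD invrK; case: (ltngtP m mu) => [lt_m|gt_m|->].
  - by rewrite -(subnSK lt_m) PS'.
  - by rewrite !mul0r !mulr0 !scaler0 subr0 scaler0.
  by rewrite subnn !mul0r !mulr0 !sub0r P0 scalerN !scalerA mulVf.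
have Phi0 : Phi 0%N \is a GRing.unit.
  apply: (qcommutes_unit f0 (e_neq0 false)) => [j r|v tv]; last exact: Phit.
  by have [-> _] := PhiX false j.
have Psi0 : Psi 0%N \is a GRing.unit.
  apply: (qcommutes_unit fmu (fun j => invr_neq0 (e_neq0 false j))) => [j r|v tv].
    by have [/(_ (- r))] := PsiX false j; rewrite opprK => -> _.
  by rewrite /Psi subn0 Phit.
have PsiC k l : GRing.comm (Psi k) (Psi l).
  rewrite /Psi; do 2 case: ifP => _; try exact: PhiC; rewrite /GRing.comm ?mulr0 ?mul0r //.
have [lp [lpE lpX]] := half_current_log Phi0 PhiC.
have [lm [lmE lmX]] := half_current_log Psi0 PsiC.
pose P' (r : int) : 'M[K]_n.+1 := if r is Posz m then Phi m else 0.
(* Negative indices use the logarithm of the reversed polynomial; the sign in front is that of the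
   exponent in the definition of the h_(i,-m). *)
pose H' (r : int) : 'M[K]_n.+1 := match r with
  | Posz 0 => 0 | Posz m => (p - p^-1)^-1 *: lp m | Negz m => -
    (p - p^-1)^-1 *: lm m.+1 end.
pose ph s := if s then Phi else Psi; pose cl (s : bool) : int := if s then 0 else mu%:Z.
have P'ph s m : P' (cl s + sg s * m%:Z) = ph s m.
  case: s; first by rewrite /cl /sg add0r mul1r.
  rewrite /cl /sg mulN1r /= /Psi; case: leqP => [mle|mgt]; first by rewrite subzn.
  suff -> : mu%:Z - m%:Z = Negz (m - mu.+1) by [].
  by rewrite NegzE subnSK // -subzn ?opprB // ltnW.
have P'cl s : P' (cl s) = ph s 0%N by rewrite -P'ph mulr0 addr0.
have phE s m : (0 < m)%N -> ph s m = ph s 0%N *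
    expCoef (fun k => ((sg s)%:~R * (p - p^-1)) *: H' (sg s * k%:Z)) m.
  move=> m0; have H'E (k : nat) : (0 < k)%N ->
      ((sg s)%:~R * (p - p^-1)) *: H' (sg s * k%:Z) = (if s then lp else lm) k.
    case: k => // k _; case: (s); first by rewrite !mul1r /= scalerA mulfV ?scale1r.
    by rewrite !mulN1r -NegzE /= scalerA mulrNN mulfV ?scale1r.
  by rewrite (expCoef_ext _ H'E); case: (s); rewrite /= -(lpE, lmE).
have phX s t j : half_current (ph s) (fun r => X t j (sg s * r)) (p ^ (sg s * sg t * c j)).
  case: s; rewrite ?mul1r ?mulN1r ?mulNr -?invr_expz.
    rewrite (_ : (fun r => _) = X t j); first exact: PhiX.
    by apply/funext => r; rewrite mul1r.
  rewrite (_ : (fun r => _) = (fun r => X t j (- r))); first exact: PsiX.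
  by apply/funext => r; rewrite mulN1r.
exists mu, P', H'; split.
- split=> [s m m0|s|s m m0|//].
  + case: s; first by rewrite /= sub0r mul1r; case: m m0.
    by rewrite /= mulN1r opprK /= Phi_mu // -[ltnLHS]addn0 ltn_add2l.
  + by rewrite P'cl; case: s.
  + by rewrite P'ph P'cl; exact: phE.
- move=> s t j r; rewrite P'cl; have [/(_ (sg s * r)) E _] := phX s t j.
  by move: E; rewrite mulrA [sg s * sg s](_ : _ = 1) ?mul1r //; case: (s).
- move=> t j m r m0.
  have [s [k ->]] : exists s k, m = sg s * k.+1%:Z.
    case: (m) m0 => [[//|k]|k] _; first by exists true, k; rewrite mul1r.
    by exists false, k; rewrite mulN1r NegzE.
  pose l := (if s then lp else lm) k.+1.
  have -> : H' (sg s * k.+1%:Z) = ((sg s)%:~R * (p - p^-1))^-1 *: l.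
    by rewrite /l; case: (s); rewrite ?mul1r // !mulN1r -NegzE /= invrN.
  have lX : (l * X t j r - X t j r * l) *+ k.+1 =
      ((p ^ (sg s * sg t * c j)) ^+ k.+1 - (p ^ (sg s * sg t * c j))^-1 ^+ k.+1) *:
        X t j (sg s * k.+1%:Z + r).
    have lX' : forall x e, e != 0 -> half_current (ph s) x e -> forall m r,
      ((if s then lp else lm) m.+1 * x r - x r * (if s then lp else lm) m.+1) *+ m.+1 =
      (e ^+ m.+1 - e^-1 ^+ m.+1) *: x (r + m.+1%:Z) by rewrite /ph; case: (s).
    have := lX' _ _ (expfz_neq0 _ p_neq0) (phX s t j) k (sg s * r).
    have -> : sg s * (sg s * r) = r by rewrite mulrA; case: (s);
      rewrite ?mul1r ?mulN1r ?opprK ?mul1r.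
    by rewrite mulrDr (addrC (sg s * _)) mulrA [sg s * sg s](_ : _ = 1) ?mul1r //;
      case: (s).
  rewrite -scalerAl -scalerAr -scalerBr.
  have -> : l * X t j r - X t j r * l = k.+1%:R^-1 *: ((l * X t j r - X t j r * l) *+ k.+1).
    by rewrite -scaler_nat scalerA mulVf ?scale1r // pnatr_eq0.
  rewrite lX !scalerA; congr (_ *: _).
  (* Every power of p involved is u or u^-1, so each choice of signs leaves an identity in a
     field. *)
  pose u := p ^ (c j * k.+1%:Z); have u0 : u != 0 by rewrite expfz_neq0.
  have -> : (p ^ (sg s * sg t * c j)) ^+ k.+1 = if s == t then u else u^-1.
    by rewrite exprnP exprz_exp -mulrA; case: (s); case: (t);
      rewrite ?mulrN1 ?opprK ?mul1r ?mulN1r ?mulNr -?invr_expz.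
  have -> : (p ^ (sg s * sg t * c j))^-1 ^+ k.+1 = if s == t then u^-1 else u.
    by rewrite exprVn exprnP exprz_exp -mulrA; case: (s); case: (t);
      rewrite ?mulrN1 ?opprK ?mul1r ?mulN1r ?mulNr -?invr_expz ?invrK.
  have -> : qint p (sg s * k.+1%:Z * c j) = (if s then u - u^-1 else u^-1 - u) / (p - p^-1).
    rewrite /qint -mulrA (mulrC (k.+1%:Z)); case: (s);
      by rewrite ?mul1r ?mulN1r ?opprK -?invr_expz ?invrK.
  rewrite intrM -[(k.+1%:Z)%:~R]pmulrn.
  have k0 : k.+1%:R != 0 :> K by rewrite pnatr_eq0.
  move: k.+1%:R (p - p^-1) (u^-1) k0 p_gen => w y v w0 y0.
  by case: (s); case: (t); rewrite /= ?mulrN1z ?mulr1z; field; apply/andP.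
- case=> m; last by exists 0 => v _; rewrite mul0mx scale0r.
  by exists f`_m => v; exact: Phit.
case=> m j; last by exists [::] => r; rewrite big_nil mul0r.
have [s hs] := Phi_shift m j; exists [seq (h.1, Posz h.2) | h <- s] => r.
by rewrite /= hs big_map.
Qed.

End CartanCurrent.

(** * Representations by matrices *)

Section FreeHom.
Variables (K : fieldType) (G : choiceType) (A : algType K).
Implicit Types (E : freeAlg K G -> A).

Definition alg_hom E : Prop :=
  [/\ {morph E : x y / x + y}, {morph E : x y / x * y}, E 1 = 1 &
      forall k, {morph E : x / k *: x}].

Section Laws.
Variable E : freeAlg K G -> A.
Hypothesis hE : alg_hom E.

Lemma alg_hom0 : E 0 = 0.
Proof. by case: hE => _ _ _ EZ; rewrite -(scale0r (1 : freeAlg K G)) EZ scale0r. Qed.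

Lemma alg_homB x y : E (x - y) = E x - E y.
Proof. by case: hE => ED _ _ EZ; rewrite -scaleN1r ED EZ scaleN1r. Qed.

Lemma alg_hom_sum (I : Type) (r : seq I) (P : pred I) (f : I -> freeAlg K G) :
  E (\sum_(i <- r | P i) f i) = \sum_(i <- r | P i) E (f i).
Proof. by case: hE => ED _ _ _; apply: (big_morph E ED); exact: alg_hom0. Qed.

Lemma alg_hom_prod (I : Type) (r : seq I) (P : pred I) (f : I -> freeAlg K G) :
  E (\prod_(i <- r | P i) f i) = \prod_(i <- r | P i) E (f i).
Proof. by case: hE => _ EM E1 _; exact: (big_morph E EM E1). Qed.

Lemma alg_hom_expCoef a m : E (expCoef a m) = expCoef (fun k => E (a k)) m.
Proof.
case: (hE) => ED EM E1 EZ.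
have X p (P : {poly freeAlg K G}) (Q : {poly A}) :
    (forall k, E P`_k = Q`_k) -> forall k, E (P ^+ p)`_k = (Q ^+ p)`_k.
  move=> PQ; elim: p => [|p IH] k.
    by rewrite !expr0 !coef1; case: eqP => _; [exact: E1 | exact: alg_hom0].
  by rewrite !exprS !coefM alg_hom_sum; apply: eq_bigr => l _; rewrite EM PQ IH.
rewrite /expCoef alg_hom_sum; apply: eq_bigr => p _; rewrite EZ; congr (_ *: _);
  apply: X => k.
by rewrite !coef_poly; do 2?[case: ifP => _ //]; exact: alg_hom0.
Qed.

End Laws.

Lemma freeAlg_ind (Q : freeAlg K G -> Prop) :
  Q 1 -> (forall x y, Q x -> Q y -> Q (x + y)) -> (forall x y, Q x -> Q y -> Q (x * y)) ->
  (forall k x, Q x -> Q (k *: x)) -> (forall g, Q (fgen K g)) -> forall x, Q x.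
Proof.
move=> Q1 QD QM QZ Qg x; rewrite (monalgE x); elim/big_rec: _ => [|m y _ Qy].
  by rewrite -(scale0r 1); exact: QZ.
apply: QD => //; have -> : << x@_m *g m >> = x@_m *: (<< m >> : freeAlg K G).
  by rewrite -mul_malgC malgM_def fgmulUU mulr1 mul1m.
apply: QZ; case: m => s; elim: s => [|g s IH].
  by have -> : << FMonom [::] >> = 1 :> freeAlg K G by congr << _ >>; rewrite -fmoneE.
have -> : << FMonom (g :: s) >> = fgen K g * << FMonom s >> :> freeAlg K G.
  rewrite fgen.unlock malgM_def fgmulUU mulr1; congr << _ >>.
  by apply/eqP; rewrite -val_eqE /= fmM fmuE.
exact: QM.
Qed.

Lemma alg_hom_eq E E' : alg_hom E -> alg_hom E' ->
  (forall g, E (fgen K g) = E' (fgen K g)) -> forall x, E x = E' x.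
Proof.
move=> [ED EM E1 EZ] [ED' EM' E1' EZ'] Eg; apply: freeAlg_ind => //.
- by rewrite E1 E1'.
- by move=> x y Ex Ey; rewrite ED ED' Ex Ey.
- by move=> x y Ex Ey; rewrite EM EM' Ex Ey.
- by move=> k x Ex; rewrite EZ EZ' Ex.
Qed.

Variable rho : G -> A.

Definition monEval (m : {fmonom G}) : A := \prod_(g <- m) rho g.

Fact monEval_mmorphism : mmorphism monEval.
Proof. by split=> [x y|]; rewrite /monEval ?fmM ?big_cat ?fm1 ?big_nil. Qed.
HB.instance Definition _ :=
  isMultiplicative.Build {fmonom G} A monEval monEval_mmorphism.

Definition freeEval : freeAlg K G -> A := mmap (in_alg A) monEval.

Lemma freeEval_gen g : freeEval (fgen K g) = rho g.
Proof. by rewrite fgen.unlock /freeEval mmapU /= scale1r mul1r /monEval fmU big_seq1. Qed.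

Lemma freeEval_hom : alg_hom freeEval.
Proof.
have [M M1] : multiplicative freeEval.
  apply: commr_mmap_is_multiplicative => x m m' /=.
  by rewrite /GRing.comm -scalerAl -scalerAr mul1r mulr1.
split=> [x y|x y||k x] //; first exact: mmapD.
by rewrite /freeEval mmapZ /= -scalerAl mul1r.
Qed.

End FreeHom.


(** * Coordinates on a finite-dimensional module *)

Section Coordinates.
Variables (K : fieldType) (W : lmodType K).

Definition lincomb m (b : 'I_m -> W) (c : 'cV[K]_m) : W := \sum_i c i 0 *: b i.

Lemma lincombD m (b : 'I_m -> W) : {morph lincomb b : c c' / c + c'}.
Proof.
move=> c c'; rewrite /lincomb -big_split /=; apply: eq_bigr => i _.
by rewrite mxE scalerDl.
Qed.

Lemma lincombZ m (b : 'I_m -> W) k c : lincomb b (k *: c) = k *: lincomb b c.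
Proof.
by rewrite /lincomb scaler_sumr; apply: eq_bigr => i _; rewrite mxE scalerA.
Qed.

(** A spanning family of least size is a basis, since a linear relation with c_i nonzero would
    express b_i by the others. The size is a successor because W is nonzero, so that square matrices
    form a nonzero ring. *)
Lemma coordinates m0 (b0 : 'I_m0 -> W) : (forall v, exists c, v = lincomb b0 c) ->
  (exists v : W, v != 0) -> exists n (b : 'I_n.+1 -> W), bijective (lincomb b).
Proof.
move=> b0_span [v0 v0_neq0].
pose spanning m := exists b : 'I_m -> W, forall v, exists c, v = lincomb b c.
have ex : exists m, `[< spanning m >] by exists m0; apply/asboolP; exists b0.
case: (ex_minnP ex) => m /asboolP[b b_span] m_min.
have inj : injective (lincomb b).
  suff inj0 c : lincomb b c = 0 -> c = 0.
    move=> c c' cc'; apply/eqP; rewrite -subr_eq0; apply/eqP/inj0.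
    by rewrite -scaleN1r lincombD lincombZ cc' scaleN1r subrr.
  move=> c0; apply: contrapT => /eqP; case: m b b_span m_min c c0 => [
    |m] b b_span m_min c c0.
    by rewrite (flatmx0 c) eqxx.
  case/cV0Pn => i ci.
  suff /asboolP/m_min : spanning m by rewrite ltnn.
  pose rem (e : 'cV[K]_m.+1) : 'cV[K]_m := \col_j e (lift i j) 0.
  have split e : lincomb b e = e i 0 *: b i + lincomb (b \o lift i) (rem e).
    by rewrite /lincomb (bigD1_ord i) //=; congr (_ + _); apply: eq_bigr => j _;
      rewrite mxE.
  have bi : b i = lincomb (b \o lift i) (- (c i 0)^-1 *: rem c).
    move: c0; rewrite split => /eqP; rewrite addr_eq0 => /eqP c0.
    by rewrite lincombZ -[lincomb _ _]opprK -c0 scaleNr scalerN opprK scalerA mulVf // scale1r.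
  exists (b \o lift i) => v; have [e ->] := b_span v.
  by exists (e i 0 *: (- (c i 0)^-1 *: rem c) + rem e);
    rewrite split bi lincombD (lincombZ _ (e i 0)).
case: m b b_span inj {m_min} => [|m] b b_span inj.
  by have [c v0E] := b_span v0; move: v0_neq0; rewrite v0E /lincomb big_ord0 eqxx.
have [f' f'K] := choice b_span; exists m, b, f'; last by move=> v; rewrite -f'K.
by move=> c; apply: inj; rewrite -f'K.
Qed.

Lemma action_matrices (U : Type) (act : U -> W -> W) n (b : 'I_n.+1 -> W) :
  (forall u v w, act u (v + w) = act u v + act u w) ->
  (forall u k v, act u (k *: v) = k *: act u v) -> bijective (lincomb b) ->
  exists rho : U -> 'M[K]_n.+1, forall u v, lincomb b (rho u *m v) = act u (lincomb b v).
Proof.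
move=> actD actZ [f' fK f'K].
exists (fun u => \matrix_(k, l) f' (act u (b l)) k 0) => u v.
have -> : (\matrix_(k, l) f' (act u (b l)) k 0) *m v = \sum_l v l 0 *: f' (act u (b l)).
  by apply/colP => k; rewrite !mxE summxE; apply: eq_bigr => l _; rewrite !mxE mulrC.
have b0 : lincomb b 0 = 0 by rewrite -[X in lincomb b X](scale0r 0) lincombZ scale0r.
have act0 : act u 0 = 0 by rewrite -[X in act u X](scale0r 0) actZ scale0r.
rewrite (big_morph _ (lincombD b) b0) [in RHS]/lincomb (big_morph _ (actD u) act0).
by apply: eq_bigr => l _; rewrite lincombZ f'K actZ.
Qed.

End Coordinates.

Section ModuleMatrices.
Variables (K : fieldType) (T : finType).
Variables (C : T -> T -> int) (d : T -> nat) (q : K) (nu : {ffun T -> int}).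
Variable W : lmodType (Uq C d q nu).
Local Notation U := (Uq C d q nu).
Local Notation sc := (Uscal C d q nu).

Lemma pres_scaleE (k : K) (u : presAlg (UqRel C d q nu)) : (k *:
  (1 : presAlg _)) * u = k *: u.
Proof. by rewrite -pres_scalerAl mul1r. Qed.

Lemma UscalE k (u : U) : sc k * u = k *: u.
Proof. exact: pres_scaleE. Qed.

Lemma pres_scale_comm (k : K) (u : presAlg (UqRel C d q nu)) :
  u * (k *: (1 : presAlg _)) = k *: (1 : presAlg _) * u.
Proof. by rewrite pres_scaleE -pres_scalerAr mulr1. Qed.

Lemma Uscal_comm k (u : U) : u * sc k = sc k * u.
Proof. exact: pres_scale_comm. Qed.

Lemma UscalM a b : sc (a * b) = sc a * sc b.
Proof. by rewrite UscalE /Uscal scalerA. Qed.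

(** An alias that carries the structure over [K], as [W] itself is a module over the whole
    algebra. *)
Definition scalars : Type := W.
HB.instance Definition _ := GRing.Zmodule.on scalars.

Definition Kscale (k : K) (v : scalars) : scalars := sc k *: (v : W).

Fact KscaleA a b v : Kscale a (Kscale b v) = Kscale (a * b) v.
Proof. exact: etrans (scalerA (sc a) (sc b) (v : W)) (congr1 (fun u => u *: (v : W)) (esym
  (UscalM a b))). Qed.

Fact Kscale1 : left_id 1 Kscale.
Proof. by move=> v; exact: etrans (congr1 (fun u => u *: (v : W)) (scale1r (1 : U)))
  (scale1r (v : W)). Qed.

Fact KscaleDr : right_distributive Kscale +%R.
Proof. by move=> k v w; exact: (scalerDr (sc k) (v : W) w). Qed.

Fact KscaleDl v : {morph Kscale^~ v : a b / a + b}.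
Proof.
by move=> a b; exact: etrans (congr1 (fun u => u *: (v : W)) (scalerDl (1 : U) a b))
  (scalerDl (v : W) (sc a) (sc b)).
Qed.

HB.instance Definition _ :=
  GRing.Zmodule_isLmodule.Build K scalars KscaleA Kscale1 KscaleDr KscaleDl.

Lemma findim_matrices : findim W -> (exists v : W, v != 0) ->
  exists n (f : 'cV[K]_n.+1 -> W) (rho : U -> 'M[K]_n.+1),
  [/\ {morph f : u v / u + v}, forall k v, f (k *: v) = sc k *: f v, bijective f &
      forall u v, f (rho u *m v) = u *: f v].
Proof.
case=> b0 _ b0_span W0.
have span v : exists c, v = lincomb (W := scalars) (fun i : 'I_(size b0) => b0`_i) c.
  have [c E] := b0_span v I; exists (\col_i c i); apply: etrans E _.
  by apply: eq_bigr => i _; rewrite mxE.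
have [n [b bB]] := coordinates span W0.
pose act (u : U) (v : scalars) : scalars := u *: (v : W).
have actD u v w : act u (v + w) = act u v + act u w by exact: (scalerDr u (v : W) w).
have actZ u k v : act u (k *: v) = k *: act u v.
  exact: etrans (etrans (scalerA u (sc k) (v : W)) (congr1 (fun x => x *: (v : W))
    (Uscal_comm k u)))
    (esym (scalerA (sc k) u (v : W))).
have [rho rhoE] := action_matrices actD actZ bB.
exists n, (lincomb b), rho; split=> [u v|k v|//|//].
  exact: (lincombD b u v).
exact: (lincombZ b k v).
Qed.

End ModuleMatrices.

(* Rewriting with the morphism laws one at a time is slow in the free algebra,
   whence these composite forms. *)
Section HomExpressions.
Variables (K : fieldType) (G : choiceType) (A : algType K) (E : freeAlg K G -> A).
Hypothesis hE : alg_hom E.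
Implicit Types (a b c e : freeAlg K G) (k : K).

Lemma alg_homM a b : E (a * b) = E a * E b.
Proof. by case: hE => _ EM _ _; exact: EM. Qed.

Lemma alg_homZ k a : E (k *: a) = k *: E a.
Proof. by case: hE => _ _ _ EZ; exact: EZ. Qed.

Lemma alg_homZM k a b : E (k *: (a * b)) = k *: (E a * E b).
Proof. by rewrite alg_homZ alg_homM. Qed.

Lemma alg_homBM a b c e : E (a * b - c * e) = E a * E b - E c * E e.
Proof. by rewrite alg_homB //; congr (_ - _); exact: alg_homM. Qed.

Lemma alg_homZBM k a b c e : E (k *: (a * b - c * e)) = k *: (E a * E b - E c * E e).
Proof. by rewrite alg_homZ alg_homBM. Qed.

Lemma alg_homBMZ k a b c e : E (a * b - k *: (c * e)) = E a * E b - k *: (E c * E e).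
Proof. by rewrite alg_homB // alg_homM alg_homZM. Qed.

Lemma alg_homBZM k a b c e : E (k *: (a * b) - c * e) = k *: (E a * E b) - E c * E e.
Proof. by rewrite alg_homB // alg_homM alg_homZM. Qed.

End HomExpressions.

Definition op_gen (K : numClosedFieldType) (T : finType) (C : T -> T -> int) (d : T -> nat)
    (q : K) (nu : {ffun T -> int}) n (V : operators C d q nu n) (a : gen T) : 'M[K]_n.+1 :=
  match a with
  | GX s i r => opX V s i r
  | GPhi s i r => opPhi V s i r
  | GPhiInv s i => opPhiInv V s i
  | GH i m => opH V i m
  end.

Section HomOperators.
Variables (K : numClosedFieldType) (T : finType).
Variables (C : T -> T -> int) (d : T -> nat) (q : K) (nu : {ffun T -> int}) (n : nat).
Variable E : freeAlg K (gen T) -> 'M[K]_n.+1.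
Hypotheses (hE : alg_hom E) (E_rel : forall r s, UqRel C d q nu r s -> E r = E s).
Local Notation x s i r := (fgen K (GX s i r)).
Local Notation phi s i r := (fgen K (GPhi s i r)).
Local Notation phiInv s i := (fgen K (GPhiInv s i)).
Local Notation h i m := (fgen K (GH i m)).

Let ED := let: And4 a _ _ _ := hE in a.
Let EM := let: And4 _ a _ _ := hE in a.
Let E1 := let: And4 _ _ a _ := hE in a.
Let EZ := let: And4 _ _ _ a := hE in a.
Let EB := alg_homB hE.
Let E0 := alg_hom0 hE.

Fact homPhi_comm s t i j r m :
  E (phi s i r) * E (phi t j m) = E (phi t j m) * E (phi s i r).
Proof. by rewrite -!EM; apply: E_rel; exact: Rel_phi_comm. Qed.

Fact homPhi_invl s i : E (phiInv s i) * E (phi s i (lead nu s i)) = 1.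
Proof. by rewrite -EM -E1; apply: E_rel; exact: Rel_phi_invl. Qed.

Fact homPhi_vanish s i m : (0 < m)%N -> E (phi s i (lead nu s i - sg s * m%:Z)) = 0.
Proof. by move=> m0; rewrite -E0; apply: E_rel; exact: Rel_phi_vanish. Qed.

Fact homPhi_exp s i m : (0 < m)%N -> E (phi s i (lead nu s i + sg s * m%:Z)) =
  E (phi s i (lead nu s i)) *
  expCoef (fun k => ((sg s)%:~R * (qi d q i - (qi d q i)^-1)) *: E (h i (sg s * k%:Z))) m.
Proof.
move=> _; rewrite (E_rel (Rel_phi_exp _ _ _ _ s i m)) EM (alg_hom_expCoef hE).
by congr (_ * expCoef _ _); apply/funext => k; exact: EZ.
Qed.

Fact homH0 i : E (h i 0) = 0.
Proof. by rewrite -E0; apply: E_rel; exact: Rel_h0. Qed.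

Fact homPhi_X s t i j r : E (phi s i (lead nu s i)) * E (x t j r) =
  (qi d q i ^ (sg s * sg t * C i j)) *: (E (x t j r) * E (phi s i (lead nu s i))).
Proof. by rewrite -!EM -EZ; apply: E_rel; exact: Rel_phi_x. Qed.

Fact homH_X t i j m r : m != 0 ->
  E (h i m) * E (x t j r) - E (x t j r) * E (h i m) =
  ((sg t)%:~R * (m%:~R)^-1 * qint (qi d q i) (m * C i j)) *: E (x t j (m + r)).
Proof. by move=> m0; rewrite -!EM -EB -EZ; apply: E_rel; exact: Rel_h_x. Qed.

Fact homX_X i j r s : (qi d q i - (qi d q i)^-1) *:
    (E (x true i r) * E (x false j s) - E (x false j s) * E (x true i r)) =
    if i == j then E (phi true i (r + s)) - E (phi false j (r + s)) else 0.
Proof.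
rewrite -!EM -EB -EZ (E_rel (Rel_x_x _ _ _ _ i j r s)).
by case: ifP => _; [exact: EB | exact: E0].
Qed.

Definition hom_operators : operators C d q nu n := Operators (opPhiInv := fun s i => E
  (phiInv s i))
  homPhi_comm homPhi_invl homPhi_vanish homPhi_exp homH0 homPhi_X homH_X homX_X.

Lemma hom_operators_gen a : E (fgen K a) = op_gen hom_operators a.
Proof. by case: a. Qed.

End HomOperators.

(** * The relations on the inflated space *)

Section Inflate.
Variables (K : numClosedFieldType) (T : finType).
Variables (C : T -> T -> int) (d : T -> nat) (q : K) (J : {set T}).
Variables (nu : {ffun {i | i \in J} -> int}) (n : nat).
Local Notation TJ := {i | i \in J}.
Local Notation vec := 'cV[K]_n.+1.
Variable E : freeAlg K (gen TJ) -> 'M[K]_n.+1.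
Hypotheses (hE : alg_hom E)
  (E_rel : forall r s, UqRel (cartanJ C J) (symJ d J) q nu r s -> E r = E s).
Variable V : operators (cartanJ C J) (symJ d J) q nu n.
Hypothesis E_gen : forall a, E (fgen K a) = op_gen V a.
Hypothesis q_generic : generic (cartanJ C J) (symJ d J) q.
Hypothesis irr : irreducible_ops V.
Variable g : bool -> TJ -> K.
Hypothesis top_neq0 : exists2 v, top V g v & v != 0.
Hypothesis C_offdiag : forall i j, i != j -> C i j <= 0.
Variables (deg : T -> nat) (Phi H' : T -> int -> 'M[K]_n.+1).
Hypothesis PhiP : forall i,
  cartan_current V g (qi d q i) (fun j => C i (val j)) (deg i) (Phi i) (H' i).

Definition extend (A : Type) (F : TJ -> A) (G : T -> A) (i : T) : A :=
  if insub i is Some j then F j else G i.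

Lemma extend_in A (F : TJ -> A) G j : extend F G (val j) = F j.
Proof. by rewrite /extend valK. Qed.

Lemma extend_out A (F : TJ -> A) G i : i \notin J -> extend F G i = G i.
Proof. by move=> iJ; rewrite /extend insubN. Qed.

Variant node_spec i : Prop :=
| NodeIn (j : TJ) of i = val j
| NodeOut of i \notin J.

Lemma nodeP i : node_spec i.
Proof. by case: (boolP (i \in J)) => iJ; [apply: (@NodeIn i (exist _ i iJ))
  | apply: NodeOut]. Qed.

Definition infl_weight : {ffun T -> int} := [ffun i => extend nu (fun i => (deg i)%:Z) i].

Definition infl_gen (a : gen T) : 'M[K]_n.+1 :=
  match a with
  | GX s i r => extend (fun j => opX V s j r) (fun=> 0) i
  | GPhi s i r => extend (fun j => opPhi V s j r) (fun i => Phi i r) i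
  | GPhiInv s i => extend (fun j => opPhiInv V s j)
      (fun i => (Phi i (if s then 0 else (deg i)%:Z))^-1) i
  | GH i m => extend (fun j => opH V j m) (fun i => H' i m) i
  end.

Definition infl : freeAlg K (gen T) -> 'M[K]_n.+1 := freeEval infl_gen.

Lemma lead_in s j : lead infl_weight s (val j) = lead nu s j.
Proof. by rewrite /lead ffunE extend_in. Qed.

Lemma lead_out s i : i \notin J -> lead infl_weight s i = if s then 0 else (deg i)%:Z.
Proof. by move=> iJ; rewrite /lead ffunE extend_out. Qed.

Lemma infl_freeMap x : infl (freeMap (genMap val) x) = E x.
Proof.
have hI : alg_hom infl by exact: freeEval_hom.
have hC : alg_hom (fun x => infl (freeMap (genMap (val : TJ -> T)) x)).
  case: hI => ID IM I1 IZ; split=> [a b|a b||k a].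
  - by rewrite freeMapD ID.
  - by rewrite freeMapM IM.
  - by rewrite freeMap1 I1.
  - by rewrite freeMapZ IZ.
apply: (alg_hom_eq hC hE) => a; rewrite freeMap_gen /infl freeEval_gen.
by rewrite E_gen; case: a => *; rewrite /= extend_in.
Qed.

(** The old Cartan operators preserve the top, where the new current is scalar, so they commute with
    it there. *)
Lemma opPhi_current s j r i m : GRing.comm (Phi i m) (opPhi V s j r).
Proof.
have [_ _ _ top_sc PS] := PhiP i.
have tc := top_cartan V q_generic g.
apply: (subalg_opPhi (subalg_centralizer (Phi i m))) => {s j r} [s j|j r].
  have LS : shift_family V (fun _ : unit => opPhi V s j (lead nu s j)).
    move=> _ k; have [c hc] := qcommutes_opL V s j false k.
    by exists [:: (c, 0, tt)] => r; rewrite big_seq1 addr0 hc.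
  apply: (shift_family_comm q_generic irr top_neq0 PS LS _ m tt) => l _ v tv.
  have [f hf] := top_sc l; have tLv : top V g (opPhi V s j (lead nu s j) *m v).
    by case: tc => _ _ tL _ _; exact: tL.
  by rewrite (hf _ tLv) (hf _ tv) scalemxAr.
(* The identity is adjoined because moving h past a lowering operator leaves a term without h. *)
have HS : shift_family V (fun b : bool => if b then opH V j r else 1).
  move=> [] k; last by exists [:: (1, 0, false)] => r';
    rewrite big_seq1 addr0 mul1r mulr1 scale1r.
  have [c hc] := opH_Xr V false j k r.
  exists [:: (1, 0, true); (c, r, false)] => r'.
  by rewrite big_cons big_seq1 /= addr0 scale1r mulr1 hc (addrC r).
apply: (shift_family_comm q_generic irr top_neq0 PS HS _ m true) => l b v tv.
have [f hf] := top_sc l; case: b; last by rewrite !mul1mx.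
have tHv : top V g (opH V j r *m v) by case: tc => _ _ _ _ tH; exact: tH.
by rewrite (hf _ tHv) (hf _ tv) scalemxAr.
Qed.

Lemma current_current i r j m : GRing.comm (Phi i r) (Phi j m).
Proof.
have [_ _ _ sci Pi] := PhiP i; have [_ _ _ scj Pj] := PhiP j.
apply: (shift_family_comm q_generic irr top_neq0 Pi Pj) => l l' v tv.
have [f hf] := sci l; have [f' hf'] := scj l'.
by rewrite (hf _ tv) (hf' _ tv) -!scalemxAr (hf _ tv) (hf' _ tv) !scalerA mulrC.
Qed.

Lemma prod_zero (A : nzRingType) (I : finType) (P : pred I) i0 :
  P i0 -> \prod_(i | P i) (0 : A) = 0.
Proof.
move=> Pi0; rewrite big_const; have : (0 < #|P|)%N by apply/card_gt0P; exists i0.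
by case: #|_| => // k _; rewrite iterS mul0r.
Qed.

Lemma infl_rel r s : UqRel C d q infl_weight r s -> infl r = infl s.
Proof.
have hI : alg_hom infl by exact: freeEval_hom.
have Ig a : infl (fgen K a) = infl_gen a by exact: freeEval_gen.
have Im := infl_freeMap; move: infl hI Ig Im => F hI Ig Im.
have [ID IM I1 IZ] := hI; have IB := alg_homB hI; have I0 := alg_hom0 hI.
have IX_out t i r' : i \notin J -> infl_gen (GX t i r') = 0 by exact: extend_out.
case=> {r s}.
- move=> s t i j r m; apply: etrans (alg_homM hI _ _) _;
  apply: etrans _ (esym (alg_homM hI _ _)); rewrite !Ig /=.
  case: (nodeP i) => [i' ->|iJ]; case: (nodeP j) => [j' ->|jJ].
  + by rewrite !extend_in; exact: opPhi_comm.
  + by rewrite extend_in extend_out //; symmetry; exact: opPhi_current.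
  + by rewrite extend_in extend_out //; exact: opPhi_current.
  + by rewrite !extend_out //; exact: current_current.
- move=> s i; rewrite IM I1 !Ig /=; case: (nodeP i) => [i' ->|iJ].
    by rewrite !extend_in lead_in; exact: opPhi_invl.
  rewrite !extend_out // lead_out // mulVr //.
  by have [[_ PU _ _] _ _ _ _] := PhiP i; exact: PU.
- move=> s i; rewrite IM I1 !Ig /=; case: (nodeP i) => [i' ->|iJ].
    by rewrite !extend_in lead_in; exact: opPhi_invr.
  rewrite !extend_out // lead_out // divrr //.
  by have [[_ PU _ _] _ _ _ _] := PhiP i; exact: PU.
- move=> s i m m0; rewrite Ig I0 /=; case: (nodeP i) => [i' ->|iJ].
    by rewrite !extend_in lead_in; exact: opPhi_vanish.
  by rewrite !extend_out // lead_out //; have [[PV _ _ _] _ _ _ _] := PhiP i; exact: PV.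
- move=> s i [|m]; rewrite IM 2!Ig (alg_hom_expCoef hI).
    by rewrite expCoef0 mulr1 mulr0 addr0.
  set a := fun k : nat => F _.
  have -> : a = fun k => ((sg s)%:~R * (qi d q i - (qi d q i)^-1)) *: infl_gen (GH i
    (sg s * k%:Z)).
    by apply/funext => k; rewrite /a IZ Ig.
  move=> {a}; case: (nodeP i) => [i' ->|iJ].
    have -> : (fun k : nat => ((sg s)%:~R * (qi d q (val i') - (qi d q (val i'))^-1)) *:
        infl_gen (GH (val i') (sg s * k%:Z))) =
        fun k => ((sg s)%:~R * (qi d q (val i') - (qi d q (val i'))^-1)) *: opH V i'
          (sg s * k%:Z).
      by apply/funext => k; rewrite /= extend_in.
    by rewrite lead_in /infl_gen !extend_in; exact: opPhi_exp.
  have -> : (fun k : nat => ((sg s)%:~R * (qi d q i - (qi d q i)^-1)) *: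
      infl_gen (GH i (sg s * k%:Z))) =
      fun k => ((sg s)%:~R * (qi d q i - (qi d q i)^-1)) *: H' i (sg s * k%:Z).
    by apply/funext => k; rewrite /= extend_out.
  rewrite lead_out // /infl_gen !extend_out //.
  by have [[_ _ PE _] _ _ _ _] := PhiP i; exact: PE.
- move=> i; rewrite Ig I0 /=; case: (nodeP i) => [i' ->|iJ].
    by rewrite extend_in; exact: opH0.
  by rewrite extend_out //; have [[]] := PhiP i.
- move=> s t i j r; apply: etrans (alg_homM hI _ _) _;
  apply: etrans _ (esym (alg_homZM hI _ _ _)); rewrite !Ig.
  case: (nodeP j) => [j' ->|jJ]; last by rewrite IX_out // mulr0 mul0r scaler0.
  rewrite /= extend_in; case: (nodeP i) => [i' ->|iJ].
    by rewrite !extend_in lead_in; exact: opPhi_X.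
  by rewrite !extend_out // lead_out //; have [_ PX _ _ _] := PhiP i; exact: PX.
- move=> t i j m r m0; apply: etrans (alg_homBM hI _ _ _ _) _;
  apply: etrans _ (esym (alg_homZ hI _ _)); rewrite !Ig.
  case: (nodeP j) => [j' ->|jJ]; last by rewrite !IX_out // mulr0 mul0r subr0 scaler0.
  rewrite /= !extend_in; case: (nodeP i) => [i' ->|iJ].
    by rewrite !extend_in; exact: opH_X.
  by rewrite !extend_out //; have [_ _ HX _ _] := PhiP i; exact: HX.
- move=> i j r s; apply: etrans (alg_homZBM hI _ _ _ _ _) _; rewrite !Ig.
  have -> : F (if i == j then fgen K (GPhi true i (r + s)) - fgen K (GPhi false j
    (r + s)) else 0) =
      if i == j then infl_gen (GPhi true i (r + s)) - infl_gen (GPhi false j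
        (r + s)) else 0.
    by case: ifP => _ //; rewrite IB !Ig.
  case: (nodeP i) => [i' ->|iJ]; case: (nodeP j) => [j' ->|jJ].
  + by rewrite /= !extend_in val_eqE (opX_X V i' j' r s).
  + rewrite (IX_out _ _ _ jJ) mulr0 mul0r subrr scaler0; case: eqP => // ij.
    by move: jJ; rewrite -ij (valP i').
  + rewrite (IX_out _ _ _ iJ) mulr0 mul0r subrr scaler0; case: eqP => // ij.
    by move: iJ; rewrite ij (valP j').
  (* For equal nodes outside [J] the difference of the phi's vanishes, both signs being given by the
     same polynomial. *)
  + rewrite (IX_out _ _ _ iJ) mulr0 mul0r subrr scaler0; case: eqP => // ij.
    by rewrite -ij /= !extend_out // subrr.
- move=> t i j r s; apply: etrans (alg_homBMZ hI _ _ _ _ _) _;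
  apply: etrans _ (esym (alg_homBZM hI _ _ _ _ _)); rewrite !Ig.
  case: (nodeP i) => [i' ->|iJ]; last by rewrite !(IX_out _ _ _ iJ) !(mulr0, mul0r, scaler0, subr0).
  case: (nodeP j) => [j' ->|jJ]; last by rewrite !(IX_out _ _ _ jJ) !(mulr0, mul0r, scaler0, subr0).
  rewrite /= !extend_in.
  have := etrans (esym (alg_homBMZ hE _ _ _ _ _))
    (etrans (E_rel (Rel_drinfeld _ _ _ _ t i' j' r s)) (alg_homBZM hE _ _ _ _ _)).
  by rewrite !E_gen.
move=> t i j r' p r ij hp; rewrite I0.
(* As C_ij <= 0, every Serre monomial has at least one factor x_i, on the left or on the right of
   x_j. *)
have p0 : (0 < p)%N.
  have : (0 : int) < p%:Z by rewrite hp subr_gt0 (Order.POrderTheory.le_lt_trans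
    (C_offdiag ij)).
  by [].
case: (nodeP i) => [i' Ei|iJ]; last first.
  rewrite (alg_hom_sum hI) big1 // => w _; rewrite (alg_hom_sum hI) big1 // => l _.
  rewrite IZ !IM !(alg_hom_prod hI).
  have X (P : pred 'I_p) (f : 'I_p -> int) k0 :
      P k0 -> \prod_(k < p | P k) F (fgen K (GX t i (f k))) = 0.
    move=> Pk0; rewrite -[RHS](prod_zero _ Pk0); apply: eq_bigr => k _.
    by rewrite Ig IX_out.
  case: (ltnP 0 l) => l0.
    by rewrite (X _ _ (Ordinal p0)) // !mul0r scaler0.
  by rewrite (X (fun k : 'I_p => (l <= k)%N) _ (Ordinal p0)) ?mulr0 ?scaler0 //
    (leq_trans l0).
case: (nodeP j) => [j' Ej|jJ]; last first.
  rewrite (alg_hom_sum hI) big1 // => w _; rewrite (alg_hom_sum hI) big1 // => l _.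
  by rewrite IZ !IM (Ig (GX t j r')) IX_out // mulr0 mul0r scaler0.
rewrite Ei Ej in ij hp *; rewrite -[serre _ _ _ _ _ _ _](freeMap_serre d q t i' j' r' r).
rewrite Im -(alg_hom0 hE); apply: E_rel; exact: Rel_serre.
Qed.

End Inflate.

(** * The inflated module *)

Section RepModule.
Variables (K : numClosedFieldType) (T : finType).
Variables (C : T -> T -> int) (d : T -> nat) (q : K) (mu : {ffun T -> int}) (n : nat).
Local Notation vec := 'cV[K]_n.+1.
Variable E : freeAlg K (gen T) -> 'M[K]_n.+1.
Hypotheses (hE : alg_hom E) (E_rel : forall r s, UqRel C d q mu r s -> E r = E s).
Local Notation A := (presAlg (UqRel C d q mu)).

Definition rep_act (u : A) : 'M[K]_n.+1 := E (repr u).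

Lemma rep_act_pi x : rep_act (pres_pi _ x) = E x.
Proof.
have [ED EM E1 EZ] := hE; apply/eqP; rewrite -subr_eq0 -(alg_homB hE).
have : relIdeal (UqRel C d q mu) (repr (pres_pi (UqRel C d q mu) x) - x).
  by apply/pres_piP; exact: pres_repr.
elim=> [|y z _ /eqP hy _ /eqP hz|a b r s rs]; first by rewrite (alg_hom0 hE).
  by rewrite ED hy hz addr0.
by rewrite !EM (alg_homB hE) (E_rel rs) subrr mulr0 mul0r.
Qed.

Lemma rep_actD : {morph rep_act : u v / u + v}.
Proof.
have [ED _ _ _] := hE => u v.
by rewrite -(pres_repr u) -(pres_repr v) -pres_piD !rep_act_pi ED.
Qed.

Lemma rep_actM : {morph rep_act : u v / u * v}.
Proof.
have [_ EM _ _] := hE => u v; rewrite -(pres_repr u) -(pres_repr v).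
by rewrite -[X in rep_act X = _]pres_piM !rep_act_pi EM.
Qed.

Lemma rep_act1 : rep_act 1 = 1.
Proof. by have [_ _ E1 _] := hE; rewrite [LHS]rep_act_pi E1. Qed.

Lemma rep_actZ k u : rep_act (k *: u) = k *: rep_act u.
Proof.
have [_ _ _ EZ] := hE; rewrite -(pres_repr u) -[X in rep_act X = _]pres_piZ.
by rewrite !rep_act_pi EZ.
Qed.

(** The proofs are parameters of the type so that the module structure, which rests on them, can be
    found from it. *)
Definition repmod (_ : alg_hom E)
  (_ : forall r s, UqRel C d q mu r s -> E r = E s) : Type := vec.
Local Notation M := (repmod hE E_rel).
HB.instance Definition _ := GRing.Zmodule.on M.

Definition rep_scale (u : Uq C d q mu) (v : M) : M := rep_act u *m (v : vec).

Fact rep_scaleA u v w : rep_scale u (rep_scale v w) = rep_scale (u * v) w.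
Proof. by rewrite /rep_scale mulmxA; congr (_ *m _); exact: esym (rep_actM u v). Qed.

Fact rep_scale1 : left_id 1 rep_scale.
Proof. by move=> v; rewrite /rep_scale [rep_act 1]rep_act1 mul1mx. Qed.

Fact rep_scaleDr : right_distributive rep_scale +%R.
Proof. by move=> u v w; exact: (mulmxDr (rep_act u) (v : vec) w). Qed.

Fact rep_scaleDl v : {morph rep_scale^~ v : a b / a + b}.
Proof.
move=> a b; apply: etrans (mulmxDl (rep_act a) (rep_act b) (v : vec)).
by congr (_ *m _); exact: (rep_actD a b).
Qed.

HB.instance Definition _ := GRing.Zmodule_isLmodule.Build (Uq C d q mu) M
  rep_scaleA rep_scale1 rep_scaleDr rep_scaleDl.

Lemma rep_scaleE u (v : M) : u *: v = rep_act u *m (v : vec).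
Proof. by []. Qed.

Lemma rep_scal k (v : M) : Uscal C d q mu k *: v = k *: (v : vec) :> vec.
Proof. by rewrite rep_scaleE [rep_act _]rep_actZ rep_act1 -scalemxAl mul1mx. Qed.

Lemma rep_gen a (v : M) : (pgen (UqRel C d q mu) a : Uq C d q mu) *: v = E (fgen K a) *m
  (v : vec).
Proof. by rewrite rep_scaleE [rep_act _]rep_act_pi. Qed.

Variables (B : 'M[K]_n.+1) (lam : bool -> T -> 'I_n.+1 -> K).
Hypotheses (B_unit : B \is a GRing.unit) (lam_neq0 : forall s i k, lam s i k != 0).
Hypothesis B_eigen : forall s i k,
  E (fgen K (GPhi s i (lead mu s i))) *m col k B = lam s i k *: col k B.

Fact eigen_torus s k : [forall i, [ffun i => lam s i k ^ sg s] i != 0].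
Proof. by apply/forallP => i; rewrite ffunE expfz_neq0. Qed.

(** Weights of sign - are the inverses of the eigenvalues of phi^-, whence the exponent [sg s]. *)
Definition eigenwt s k : torus K T := Torus (eigen_torus s k).

Lemma weightSpaceP s g (y : vec) :
  weightSpace s g (B *m y : M) <-> forall k, y k 0 != 0 -> eigenwt s k = g.
Proof.
have BE i : E (fgen K (GPhi s i (lead mu s i))) *m B =
    B *m diag_mx (\row_k lam s i k).
  apply/matrixP => a b; have /matrixP/(_ a 0) := B_eigen s i b.
  rewrite mul_mx_diag !mxE => H; rewrite mulrC -H; apply: eq_bigr => c _.
  by rewrite !mxE.
have sgK t (z : K) : (z ^ sg t) ^ sg t = z.
  by case: t => /=; rewrite ?expr1z // !exprN1 invrK.
have Eq i : (Uphi C d q mu s i (lead mu s i) *: (B *m y : M) =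
      Uscal C d q mu (g i ^ sg s) *: (B *m y : M)) <->
    forall k, lam s i k * y k 0 = g i ^ sg s * y k 0.
  rewrite rep_gen rep_scal mulmxA BE -mulmxA scalemxAr;
    split=> [/(congr1 (mulmx (invmx B)))|H].
    rewrite !(mulKmx B_unit) => /matrixP H k; have := H k 0.
    by rewrite mul_diag_mx !mxE.
  congr (_ *m _); apply/matrixP => k l; rewrite ord1 mul_diag_mx !mxE; exact: H.
split=> [H k yk|H i].
  apply/val_inj/ffunP => i; rewrite ffunE.
  by have /Eq/(_ k)/(mulIf yk) -> := H i; rewrite sgK.
apply/Eq => k; have [->|yk] := eqVneq (y k 0) 0; first by rewrite !mulr0.
by rewrite -(H k yk) /= ffunE sgK.
Qed.

(** All is read off from the eigenbasis: finitely many weights occur, and each of them serves as its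
    own upper bound. *)
Lemma repmod_categoryO : categoryO M.
Proof.
have toB (v : vec) : v = B *m (invmx B *m v) by rewrite (mulKVmx B_unit).
have wtB (s : bool) g v : weightSpace s g (v : M) <->
    forall k, (invmx B *m (v : vec)) k 0 != 0 -> eigenwt s k = g.
  by rewrite {1}(toB v); exact: weightSpaceP.
split.
- move=> s; split=> [v|gs f ugs fE f0 g ggs].
  + pose y := invmx B *m (v : vec).
    exists (undup [seq eigenwt s k | k <- enum 'I_n.+1]),
      (fun g => B *m (\col_k if eigenwt s k == g then y k 0 else 0) : M).
    split=> [g _|]; first by apply/weightSpaceP => k; rewrite mxE;
      have [//|_] := eqVneq (eigenwt s k) g; rewrite eqxx.
    rewrite {1}(toB v); apply: etrans (mulmx_sumr _ _ _ _); congr (_ *m _).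
    apply/colP => k; rewrite summxE (bigD1_seq (eigenwt s k)) ?undup_uniq //=; last first.
      by rewrite mem_undup map_f // mem_enum.
    rewrite mxE eqxx big1 ?addr0 // => g gk; rewrite mxE eq_sym (negPf gk).
    by [].
  + have y0 g' : g' \in gs -> forall k, (invmx B *m
    (f g' : vec)) k 0 != 0 -> eigenwt s k = g'.
      by move=> /fE /wtB.
    have sum0 k : \sum_(g' <- gs) (invmx B *m (f g' : vec)) k 0 = 0.
      have /matrixP/(_ k 0) : invmx B *m (\sum_(g' <- gs) (f g' : vec)) = 0.
        by rewrite [X in _ *m X]f0 mulmx0.
      by rewrite mulmx_sumr summxE mxE.
    suff H : invmx B *m (f g : vec) = 0 by rewrite (toB (f g)) H mulmx0.
    apply/colP => k; rewrite [RHS]mxE; have [kg|kg] := eqVneq (eigenwt s k) g; last first.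
      by apply: contraNeq kg => /(y0 g ggs) ->.
    rewrite -(sum0 k) (bigD1_seq g) //= big_seq_cond big1 ?addr0 // => g' /andP[g's gg'].
    by apply: contraNeq gg' => /(y0 _ g's) <-; rewrite kg.
- move=> s g; pose b := [seq ((if eigenwt s k == g then col k B else 0 : vec) : M)
  | k <- enum 'I_n.+1].
  have sb : size b = n.+1 by rewrite size_map size_enum_ord.
  exists b => [v /mapP[k _ ->]|v /wtB hv].
    case: eqP => [kg|_]; last first.
      by rewrite -[0](mulmx0 _ B); apply/weightSpaceP => k'; rewrite mxE eqxx.
    rewrite colE; apply/weightSpaceP => k'; rewrite mxE andbT.
    by have [->|_] := eqVneq k' k; rewrite ?kg // eqxx.
  pose y := invmx B *m (v : vec).
  exists (fun i => y (inord i) 0).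
  have sumE (F : nat -> vec) N : N = n.+1 -> \sum_(i < N) F i = \sum_(i < n.+1) F i by move=> ->.
  apply: etrans (esym (sumE (fun i => Uscal C d q mu (y (inord i) 0) *: (b`_i : M)) _ sb)).
  rewrite (toB v) -/y; apply/colP => a; rewrite mxE summxE; apply: eq_bigr => k _.
  rewrite rep_scal /b (nth_map k) ?size_enum_ord // nth_ord_enum inord_val.
  rewrite mulrC; have [_|kg] := eqVneq (eigenwt s k) g; first by rewrite !mxE.
  have z0 : (0 : vec) a 0 = 0 by rewrite mxE.
  rewrite [RHS]mxE z0 mulr0; have [->|/hv kg'] := eqVneq (y k 0) 0; first by rewrite mul0r.
  by rewrite kg' eqxx in kg.
exists [seq eigenwt s k | s <- [:: true; false], k <- enum 'I_n.+1] => s g [v v0 /wtB hv].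
exists g; last first.
  exists (fun=> 0%N) => j; rewrite big1 => [|i _]; last by rewrite mul0r expr0z.
  by rewrite divff //; have /forallP := valP g; apply.
have [k yk] : exists k, (invmx B *m (v : vec)) k 0 != 0.
  apply/cV0Pn; apply: contraNneq v0 => y0; apply/eqP.
  by rewrite (toB v) y0 mulmx0.
rewrite -(hv k yk); apply/allpairsPdep; exists s, k.
by rewrite mem_enum !inE; case: (s).
Qed.

End RepModule.

Lemma spanning_basis (K : fieldType) n (S : 'cV[K]_n.+1 -> Prop) :
  (forall u, exists s : seq 'cV[K]_n.+1,
    (forall x, x \in s -> S x) /\ u = \sum_(x <- s) x) ->
  exists2 B : 'M[K]_n.+1, B \is a GRing.unit & forall k, S (col k B).
Proof.
move=> span; have [s sP] := choice (fun k : 'I_n.+1 => span (delta_mx k 0)).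
pose L := flatten [seq s k | k <- enum 'I_n.+1].
have LS x : x \in L -> S x by move=> /flatten_mapP[k _ xk]; exact: (sP k).1.
pose A : 'M[K]_(size L, n.+1) := \matrix_(a < size L) (L`_a)^T.
have Afull : row_full A.
  rewrite -sub1mx; apply/row_subP => k.
  have -> : row k 1%:M = \sum_(x <- s k) x^T :> 'rV[K]_n.+1.
    rewrite row1 -[delta_mx 0 k]trmxK trmx_delta (sP k).2.
    by rewrite raddf_sum.
  rewrite big_seq; apply: summx_sub => x xs.
  have xL : x \in L by apply/flatten_mapP; exists k; rewrite ?mem_enum.
  have iL : (index x L < size L)%N by rewrite index_mem.
  have -> : x^T = row (Ordinal iL) A by rewrite rowK /= nth_index.
  exact: row_sub.
exists (rowsub (fullrankfun Afull) A)^T.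
  by rewrite unitmx_tr -row_full_unit; exact: fullrowsub_full.
move=> k; rewrite -tr_row; apply: LS.
have -> : (row k (rowsub (fullrankfun Afull) A))^T = L`_(fullrankfun Afull k).
  by apply/matrixP => a b; rewrite !mxE ord1.
exact: mem_nth.
Qed.

(** * A basis of weight vectors *)

Section EigenBasis.
Variables (K : numClosedFieldType) (T : finType).
Variables (C : T -> T -> int) (d : T -> nat) (q : K) (nu : {ffun T -> int}) (n : nat).
Variable V : operators C d q nu n.
Hypothesis q_generic : generic C d q.
Hypothesis irr : irreducible_ops V.
Variable g : bool -> T -> K.
Hypothesis top_neq0 : exists2 v, top V g v & v != 0.

(** Words on the top diagonalize at once all leading coefficients, of both signs and at old and new
    nodes. *)
Lemma word_basis : exists2 B : 'M[K]_n.+1, B \is a GRing.unit &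
  forall k, exists w v, top V g v /\ col k B = lowword V w *m v.
Proof.
apply: (spanning_basis (S := fun x => exists w v, top V g v /\ x = lowword V w *m v)) => u.
have [t ut] := lowrel_top q_generic irr top_neq0 u.
have [s [sE ->]] := lowrel_words (let: And5 a _ _ _ _ := top_cartan V q_generic g in a) ut.
exists [seq lowword V p.1 *m p.2 | p <- s]; split; last by rewrite big_map.
by move=> x /mapP[p ps ->]; exists p.1, p.2; split; first exact: sE.
Qed.

Lemma word_basis_eigen (B A : 'M[K]_n.+1) (c : T -> K) (f : K) k :
  (exists w v, top V g v /\ col k B = lowword V w *m v) ->
  B \is a GRing.unit -> A \is a GRing.unit ->
  (forall j r, A * opX V false j r = c j *: (opX V false j r * A)) ->
  (forall v, top V g v -> A *m v = f *: v) ->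
  exists2 l : K, l != 0 & A *m col k B = l *: col k B.
Proof.
move=> [w [v [tv E]]] Bu Au AX At.
have Ew := lowword_eigenvector w AX (At v tv); rewrite -E in Ew.
eexists; last exact: Ew.
apply/eqP => l0; rewrite l0 scale0r in Ew.
have := congr1 (mulmx (invmx B)) (congr1 (mulmx (invmx A)) Ew).
rewrite !mulmx0 (mulKmx Au) colE (mulKmx Bu) => /matrixP/(_ k 0).
by rewrite !mxE !eqxx => /eqP; rewrite oner_eq0.
Qed.

End EigenBasis.

Section IrreducibleMatrices.
Variables (K : numClosedFieldType) (T : finType).
Variables (C : T -> T -> int) (d : T -> nat) (q : K) (nu : {ffun T -> int}) (n : nat).
Variable W : lmodType (Uq C d q nu).
Local Notation U := (Uq C d q nu).
Local Notation pi := (pres_pi (UqRel C d q nu)).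
Variables (f : 'cV[K]_n.+1 -> W) (rho : U -> 'M[K]_n.+1).
Hypotheses (fD : {morph f : u v / u + v}) (fZ : forall k v, f
  (k *: v) = Uscal C d q nu k *: f v).
Hypotheses (fB : bijective f) (f_rho : forall u v, f (rho u *m v) = u *: f v).

Definition mx_rep (x : freeAlg K (gen T)) : 'M[K]_n.+1 := rho (pi x).

Lemma rhoE (u : U) (A : 'M[K]_n.+1) : (forall v, u *: f v = f (A *m v)) -> rho u = A.
Proof. by move=> H; apply: mx_eq_mulcol => v; apply: (bij_inj fB); rewrite f_rho H. Qed.

Lemma rhoD u v : rho (u + v) = rho u + rho v.
Proof. by apply: rhoE => w; rewrite mulmxDl fD !f_rho; exact: scalerDl. Qed.

Lemma rhoM u v : rho (u * v) = rho u * rho v.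
Proof. by apply: rhoE => w; rewrite mulAv !f_rho; exact: esym (scalerA _ _ _). Qed.

Lemma rho1 : rho 1 = 1.
Proof. by apply: rhoE => w; rewrite mul1mx; exact: scale1r. Qed.

Lemma rhoZ k u : rho (k *: u) = k *: rho u.
Proof.
apply: rhoE => w; rewrite -scalemxAl fZ f_rho; apply: etrans (esym (scalerA _ _ _)).
by rewrite UscalE.
Qed.

Lemma mx_rep_hom : alg_hom mx_rep.
Proof.
split=> [x y|x y||k x]; rewrite /mx_rep.
- by rewrite pres_piD; exact: rhoD.
- by rewrite [pi (x * y)]pres_piM; exact: rhoM.
- exact: rho1.
- by rewrite [pi (k *: x)]pres_piZ; exact: rhoZ.
Qed.

Lemma mx_rep_rel r s : UqRel C d q nu r s -> mx_rep r = mx_rep s.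
Proof.
move=> rs; rewrite /mx_rep; congr (rho _); apply/pres_piP.
by have := RelIdealM 1 1 rs; rewrite mul1r mulr1.
Qed.

Lemma coord0 : f 0 = 0.
Proof. by apply: (addrI (f 0)); rewrite -fD !addr0. Qed.

Lemma mx_rep_irreducible : irreducibleModule W ->
  irreducible_ops (hom_operators mx_rep_hom mx_rep_rel).
Proof.
case=> _ W_irr E sE sX sP sPi sH; have [E0 ED EZ] := sE.
have [f' fK f'K] := fB.
have sub : submodule (fun w => E (f' w)).
  split.
  - by rewrite -coord0 fK.
  - by move=> v w Ev Ew; rewrite -[v]f'K -[w]f'K -fD fK; exact: ED.
  move=> u w Ew; rewrite -[w]f'K -f_rho fK.
  have [RD RM R1 RZ] := mx_rep_hom.
  have RE : forall x, stable (mx_rep x) E.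
    apply: freeAlg_ind => [|x y hx hy|x y hx hy|k x hx|a] v Ev.
    - by rewrite R1 mul1mx.
    - by rewrite RD mulmxDl; apply: ED; [exact: hx | exact: hy].
    - by rewrite RM mulAv; apply: hx; exact: hy.
    - by rewrite RZ -scalemxAl; apply: EZ; exact: hx.
    by case: a => *; [exact: sX | exact: sP | exact: sPi | exact: sH].
  by have := RE (repr u); rewrite /mx_rep pres_repr; apply.
have [Z|F] := W_irr _ sub; [left | right] => v.
  by move=> Ev; apply: (bij_inj fB); rewrite coord0; apply: Z; rewrite fK.
by have := F (f v); rewrite fK.
Qed.

End IrreducibleMatrices.

(** * Distinctness of weights from positive definiteness *)

Section SimpleCartan.
Variables (n : nat) (C : 'M[int]_n) (d : 'I_n -> nat) (K : numClosedFieldType) (q : K).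
Hypothesis g_simple : simpleCartan C d.
Hypotheses (q_neq0 : q != 0) (q_not_root : forall m : nat, (0 < m)%N -> q ^+ m != 1).

Lemma expz_neq1 (m : int) : m != 0 -> q ^ m != 1.
Proof.
case: m => m m0; first by apply: q_not_root; case: m m0.
by rewrite NegzE -invr_expz invr_eq1; exact: q_not_root.
Qed.

Lemma qi_simple i : qi d q i != 0 /\ qi d q i - (qi d q i)^-1 != 0.
Proof.
have d0 := sc_sym_gt0 g_simple i; have qi0 : qi d q i != 0 by rewrite expf_neq0.
split=> //; rewrite subr_eq0; apply: contraNneq (q_not_root (m := d i * 2) _) => [E|].
  by rewrite exprM expr2 {2}[q ^+ d i]E mulfV.
by rewrite muln_gt0 d0.
Qed.

Lemma count_sum (I : finType) (w : seq I) (F : I -> int) :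
  \sum_(i : I) (count_mem i w)%:Z * F i = \sum_(i <- w) F i.
Proof.
elim: w => [|k w IH]; first by rewrite big_nil big1 // => i _; rewrite mul0r.
rewrite big_cons -IH (bigD1 k) //= [in RHS](bigD1 k) //= eqxx PoszD mulrDl mul1r -addrA.
congr (_ + (_ + _)); apply: eq_bigr => i; rewrite eq_sym => /negPf ->.
by rewrite add0n.
Qed.

(** The product over [w] is q to the power (alpha_j, beta), where beta is the sum of the simple
    roots in [w]. If all these exponents vanished, so would (beta, beta), although beta is
    nonzero. *)
Lemma generic_simple (J : {set 'I_n}) : generic (cartanJ C J) (symJ d J) q.
Proof.
split=> [i|w w0]; first exact: (qi_simple (val i)).2.
pose S (j : {i | i \in J}) : int := \sum_(k <- w) (d (val j))%:Z * C (val j) (val k).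
have prodE j : \prod_(k <- w) qi (symJ d J) q j ^ cartanJ C J j k = q ^ S j.
  rewrite /S; elim: (w) => [|k u IH]; first by rewrite !big_nil expr0z.
  by rewrite !big_cons expfzDr // IH /qi exprnP exprz_exp.
have [j Sj] : exists j, S j != 0.
  apply: contrapT => S0.
  have {}S0 j : S j = 0 by apply: contrapT => /eqP Sj; apply: S0; exists j.
  pose a i : int := (count_mem i (map val w))%:Z.
  have : exists i, a i != 0.
    case Ew: w w0 => [|j u] // _; exists (val j); by rewrite /a Ew /= eqxx.
  move=> /(sc_posdef g_simple); apply/negP; rewrite -Order.TotalTheory.leNgt.
  have -> : \sum_i \sum_j a i * a j * ((d i)%:Z * C i j) =
      \sum_(i <- map val w) \sum_(j <- map val w) (d i)%:Z * C i j.
    rewrite -[RHS]count_sum; apply: eq_bigr => i _;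
      rewrite -[X in _ = _ * X]count_sum mulr_sumr.
    by apply: eq_bigr => j _; rewrite -mulrA.
  rewrite big_map big1 // => i _; rewrite big_map; exact: S0.
by exists j; rewrite prodE; exact: expz_neq1.
Qed.

End SimpleCartan.

Theorem theorem1p2 (R : realType) (n : nat) (C : 'M[int]_n) (d : 'I_n -> nat)
    (g_simple : simpleCartan C d)
    (q : R[i]) (q_neq0 : q != 0)
    (q_not_root : forall m : nat, (0 < m)%N -> q ^+ m != 1)
    (J : {set 'I_n}) (nu : {ffun {i | i \in J} -> int})
    (W : lmodType (Uq (cartanJ C J) (symJ d J) q nu))
    (W_findim : findim W) (W_irr : irreducibleModule W) :
  exists (mu : {ffun 'I_n -> int}) (mu_nu : resCoweight J mu = nu)
    (V : lmodType (Uq C d q mu)),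
    categoryO V /\ isInflation mu_nu W V.
Proof.
have q_gen := generic_simple g_simple q_neq0 q_not_root J.
have [m [f [rho [fD fZ fB f_rho]]]] := findim_matrices W_findim W_irr.1.
pose E := mx_rep rho.
pose hE : alg_hom E := mx_rep_hom fD fZ fB f_rho.
pose E_rel := mx_rep_rel rho.
pose V := hom_operators hE E_rel.
have E_gen a : E (fgen _ a) = op_gen V a := hom_operators_gen hE E_rel a.
have irr : irreducible_ops V := mx_rep_irreducible W_irr.
have [g [v [gv v0]]] := top_exists V q_gen.
have top_neq0 : exists2 v, top V g v & v != 0 by exists v.
have cur i : exists c : nat * (int -> 'M[R[i]]_m.+1) * (int -> 'M[R[i]]_m.+1),
    cartan_current V g (qi d q i) (fun j => C i (val j)) c.1.1 c.1.2 c.2.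
  have [qi0 qi1] := qi_simple g_simple q_neq0 q_not_root i.
  have [a [b [c abc]]] := cartan_currentP q_gen irr top_neq0 (fun j => C i (val j)) qi0 qi1.
  by exists (a, b, c).
have [c cP] := choice cur.
pose deg i := (c i).1.1; pose Phi i := (c i).1.2; pose H' i := (c i).2.
pose mu := infl_weight nu deg.
have mu_nu : resCoweight J mu = nu by apply/ffunP => j; rewrite !ffunE extend_in.
have hI : alg_hom (infl V deg Phi H') := freeEval_hom _.
have I_rel := infl_rel hE E_rel E_gen q_gen irr top_neq0 (sc_offdiag g_simple) cP.
have [B B_unit Bw] := word_basis q_gen irr top_neq0.
have eig s i k : exists l, l != 0 /\
    infl V deg Phi H' (fgen _ (GPhi s i (lead mu s i))) *m col k B = l *: col k B.
  rewrite /infl freeEval_gen /=; case: (nodeP J i) => [j ->|iJ].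
    rewrite extend_in lead_in.
    have [l l0 lE] := word_basis_eigen (Bw k) B_unit (opPhi_unit V s j)
      (opPhi_X V s false j) (fun v tv => tv.2 s j).
    by exists l.
  rewrite extend_out // lead_out //; have [[_ PU _ _] PX _ Psc _] := cP i.
  have [h hv] := Psc (if s then 0 else (deg i)%:Z).
  have [l l0 lE] := word_basis_eigen (Bw k) B_unit (PU s) (PX s false) hv.
  by exists l.
have [lam lamP] := choice (fun x : bool * 'I_n * 'I_m.+1 => eig x.1.1 x.1.2 x.2).
exists mu, mu_nu, (repmod hI I_rel); split.
  apply: (repmod_categoryO _ _ (B := B) (lam := fun s i k => lam (s, i, k))) => //.
    by move=> s i k; have [] := lamP (s, i, k).
  by move=> s i k; have [_] := lamP (s, i, k).
split; last first.
  move=> s i r w iJ; apply: etrans (rep_gen (GX s i r) w) _.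
  by rewrite /infl freeEval_gen /= extend_out // mul0mx.
pose RV := resModule mu_nu (repmod hI I_rel).
(* The coordinate map of W is the isomorphism: along the embedding for [J], the inflated matrices
   are those of W. *)
have f_act (u : Uq (cartanJ C J) (symJ d J) q nu) (w : RV) : f (u *: w) = u *: f w.
  rewrite -f_rho; congr (f (_ *m _)).
  apply: etrans (rep_act_pi hI I_rel _) _; apply: etrans (infl_freeMap hE E_gen _ _ _ _) _.
  by rewrite /E /mx_rep pres_repr.
have lf : linear (f : RV -> W).
  by move=> a u w; exact: etrans (fD (a *: u) w) (congr1 (fun x => x + f w) (f_act a u)).
pose F : {linear RV -> W} := HB.pack (f : RV -> W) (GRing.isLinear.Build _ _ _ _
  (f : RV -> W) lf).
by exists F; exact: fB.
Qed.
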